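(* Let $D\subseteq\mathbb{C}\times\mathbb{R}$ be invariant under $(z,\beta)\mapsto(z,-\beta)$. If $\Omega:=\Omega_D$ is a $(1,3)$-slice domain, then $\mathrm{Reg}_{(1,3)}(\Omega,\mathbb{H})=\mathcal{SR}(\Omega,\mathbb{H})$. Namely, every $f\in\mathrm{Reg}_{(1,3)}(\Omega,\mathbb{H})$ is a $(1,3)$-function, i.e., there exist unique real analytic functions $F_\emptyset,F_1:D\to\mathbb{H}$, respectively even and odd in $\beta$, such that $$f(z+\beta J)=F_\emptyset(z,\beta)+JF_1(z,\beta)$$ for all $J\in\mathbb{S}^1$ and all $z+\beta J\in\Omega$ (with $z\in\mathbb{C},\beta\in\mathbb{R}$). In particular, $f$ is real analytic. Moreover, writing $z=x_0+ix_1$, $$(\partial_{x_0}+i\partial_{x_1})F_\emptyset-\partial_\beta F_1=0\,,\qquad \partial_\beta F_\emptyset+(\partial_{x_0}-i\partial_{x_1})F_1=0\,,$$ whence $F_\emptyset(x_0+ix_1,\beta)$ and $F_1(x_0+ix_1,\beta)$ are harmonic in $x_0,x_1,\beta$. Finally, $f$ is $(1,3)$-slice preserving if, and only if, $F_\emptyset(D)\subseteq\mathbb{C}$ and $F_1(D)\subseteq\mathbb{R}+j\mathbb{R}+k\mathbb{R}$.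
   Context: $\mathbb{H}=\mathbb{R}+i\mathbb{R}+j\mathbb{R}+k\mathbb{R}$ is the algebra of real quaternions; $\mathbb{C}:=\mathbb{R}+i\mathbb{R}\subset\mathbb{H}$; $\mathbb{S}^1:=\{jb+kc: b,c\in\mathbb{R},\ b^2+c^2=1\}$. For $J\in\mathbb{S}^1$, $\mathbb{R}^{2+1}_J:=\mathrm{Span}_{\mathbb{R}}(1,i,J)$, with points written $x_0+ix_1+\beta J$ ($x_0,x_1,\beta\in\mathbb{R}$). For $V\subseteq\mathbb{R}^{2+1}_J$ open, a $C^1$ function $\phi:V\to\mathbb{H}$ is $J$-monogenic if $(\partial_{x_0}+i\partial_{x_1}+J\partial_\beta)\phi(x_0+ix_1+\beta J)\equiv0$ on $V$ (left multiplication). A domain $\Omega$ in $\mathbb{H}$ is a nonempty connected open subset; $\Omega_J:=\Omega\cap\mathbb{R}^{2+1}_J$ and, for $f:\Omega\to\mathbb{H}$, $f_J:=f|_{\Omega_J}$. The function $f$ is $(1,3)$-regular if $f_J$ is $J$-monogenic for every $J\in\mathbb{S}^1$; $\mathrm{Reg}_{(1,3)}(\Omega,\mathbb{H})$ is the set of such functions. A $(1,3)$-regular $f$ is $(1,3)$-slice preserving if $f(\Omega_J)\subseteq\mathbb{R}^{2+1}_J$ for all $J\in\mathbb{S}^1$. A domain $\Omega$ is a $(1,3)$-slice domain if $\Omega\cap\mathbb{C}\neq\emptyset$ and $\Omega_J$ is connected for every $J\in\mathbb{S}^1$. For $D\subseteq\mathbb{C}\times\mathbb{R}$ invariant under $(z,\beta)\mapsto(z,-\beta)$,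 $\Omega_D:=\{z+\beta J:(z,\beta)\in D,\ J\in\mathbb{S}^1\}\subseteq\mathbb{H}$. A function $f:\Omega_D\to\mathbb{H}$ is a $(1,3)$-function if there are functions $F_\emptyset,F_1:D\to\mathbb{H}$, respectively even and odd in $\beta$, with $f(z+\beta J)=F_\emptyset(z,\beta)+JF_1(z,\beta)$ for all $(z,\beta)\in D$, $J\in\mathbb{S}^1$. When $\Omega_D$ is a domain, $\mathcal{SR}(\Omega_D,\mathbb{H})$ (strongly $(1,3)$-regular functions) is the set of $(1,3)$-functions on $\Omega_D$ that are $(1,3)$-regular. *)

(* Defs.v *)
From HB Require Import structures.
From mathcomp Require Import all_boot all_order all_algebra.
From mathcomp Require Import mathcomp_extra boolp classical_sets functions.
From mathcomp Require Import reals ereal topology normedtype sequences esum.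
From mathcomp Require Import derive ring.
Set Implicit Arguments.
Unset Strict Implicit.
Unset Printing Implicit Defensive.
Import Order.TTheory GRing.Theory Num.Theory.
Import numFieldNormedType.Exports.
Local Open Scope classical_set_scope.
Local Open Scope ring_scope.

(* The real quaternion a + ib + jc + kd is the row vector (a, b, c, d), so the
   topology and the derivatives are those of the normed space R^4. *)
Notation quaternion R := ('rV[R]_4).

(* The point (x0 + i x1, beta) of C x R is the row vector (x0, x1, beta). *)
Notation CxR R := ('rV[R]_3).

Section Quaternions.
Context {R : realType}.
Implicit Types (p q J : quaternion R) (D : set (CxR R)).

Definition quat (a b c d : R) : quaternion R :=
  \row_(l < 4) nth 0 [:: a; b; c; d] l.

Definition q1 : quaternion R := quat 1 0 0 0.
Definition qi : quaternion R := quat 0 1 0 0.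
Definition qj : quaternion R := quat 0 0 1 0.
Definition qk : quaternion R := quat 0 0 0 1.

Definition qmul p q : quaternion R :=
  quat
    (p 0 0 * q 0 0 - p 0 1 * q 0 1 - p 0 2 * q 0 2 - p 0 3 * q 0 3)
    (p 0 0 * q 0 1 + p 0 1 * q 0 0 + p 0 2 * q 0 3 - p 0 3 * q 0 2)
    (p 0 0 * q 0 2 - p 0 1 * q 0 3 + p 0 2 * q 0 0 + p 0 3 * q 0 1)
    (p 0 0 * q 0 3 + p 0 1 * q 0 2 - p 0 2 * q 0 1 + p 0 3 * q 0 0).

Definition complex_plane : set (quaternion R) :=
  [set q | exists a b, q = a *: q1 + b *: qi].

(* R + jR + kR *)
Definition jk_space : set (quaternion R) :=
  [set q | exists a b c, q = a *: q1 + b *: qj + c *: qk].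

Definition sphere1 : set (quaternion R) :=
  [set J | exists b c, J = b *: qj + c *: qk /\ b ^+ 2 + c ^+ 2 = 1].

(* slice_pt J (z, beta) = z + beta J *)
Definition slice_pt J (x : CxR R) : quaternion R :=
  x 0 0 *: q1 + x 0 1 *: qi + x 0 2 *: J.

(* the real span of 1, i, J *)
Definition slice_space J : set (quaternion R) := range (slice_pt J).

Definition conj_beta (x : CxR R) : CxR R :=
  \row_(l < 3) nth 0 [:: x 0 0; x 0 1; - x 0 2] l.

Definition beta_invariant D : Prop := forall x, D x -> D (conj_beta x).

Definition Omega_of D : set (quaternion R) :=
  [set slice_pt J x | x in D & J in sphere1].

End Quaternions.

Section Analysis.
Context {R : realType}.

(* f is C^1 on U along the directions in B: the directional derivatives exist
   on U and are continuous on U.  When U is relatively open in a translate of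
   the span of B, both conditions only involve f restricted to U. *)
Definition C1_along (V W : normedModType R) (B : seq V) (U : set V)
    (f : V -> W) : Prop :=
  forall v, v \in B ->
    (forall a, U a -> derivable f a v) /\ {within U, continuous ('D_v f)}.

Definition unit_vec n (l : 'I_n) : 'rV[R]_n := delta_mx 0 l.

Definition basis n : seq 'rV[R]_n := [seq unit_vec l | l <- enum 'I_n].

(* f is of class C^2 on the open set U, with vanishing Laplacian *)
Definition harmonic_on n (W : normedModType R) (U : set 'rV[R]_n)
    (f : 'rV[R]_n -> W) : Prop :=
  [/\ C1_along (basis n) U f,
      (forall l, C1_along (basis n) U ('D_(unit_vec l) f)) &
      forall a, U a -> \sum_l 'D_(unit_vec l) ('D_(unit_vec l) f) a = 0].

Definition monomial n (m : {ffun 'I_n -> nat}) (x : 'rV[R]_n) : R :=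
  \prod_l x 0 l ^+ m l.

Definition box_index n N (m : {ffun 'I_n -> 'I_N}) : {ffun 'I_n -> nat} :=
  [ffun l => m l : nat].

(* Near a, f is the sum of an absolutely convergent multi-indexed power series
   centered at a; by absolute convergence the sum can be taken along the boxes
   {m | m l < N for all l}. *)
Definition real_analytic_at n (W : normedModType R) (f : 'rV[R]_n -> W)
    (a : 'rV[R]_n) : Prop :=
  exists c : {ffun 'I_n -> nat} -> W, exists2 r : R, 0 < r &
    forall x, ball a r x ->
      summable [set: {ffun 'I_n -> nat}]
        (fun m => `|monomial m (x - a) *: c m|%:E) /\
      (fun N => \sum_(m : {ffun 'I_n -> 'I_N})
         monomial (box_index m) (x - a) *: c (box_index m)) @ \oo --> f x.

Definition real_analytic_on n (W : normedModType R) (U : set 'rV[R]_n)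
    (f : 'rV[R]_n -> W) : Prop :=
  forall a, U a -> real_analytic_at f a.

End Analysis.

Section Regularity.
Context {R : realType}.
Implicit Types (J : quaternion R) (Omega V : set (quaternion R)).
Implicit Types (D : set (CxR R)) (f : quaternion R -> quaternion R).
Implicit Types (F : CxR R -> quaternion R).

(* As in the rest of this file, functions are total and only their values on
   the set under consideration matter.  Along x0 + i x1 + beta J, the partial
   derivatives in x0, x1, beta are the derivatives in the directions 1, i, J. *)
Definition J_monogenic J V f : Prop :=
  C1_along [:: q1; qi; J] V f /\
  forall a, V a ->
    'D_q1 f a + qmul qi ('D_qi f a) + qmul J ('D_J f a) = 0.

Definition slice Omega J : set (quaternion R) := Omega `&` slice_space J.

Definition domain Omega : Prop :=
  [/\ Omega !=set0, open Omega & connected Omega].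

Definition slice_domain Omega : Prop :=
  [/\ domain Omega, Omega `&` complex_plane !=set0 &
      forall J, sphere1 J -> connected (slice Omega J)].

(* Reg_(1,3)(Omega, H) *)
Definition Reg13 Omega : set (quaternion R -> quaternion R) :=
  [set f | forall J, sphere1 J -> J_monogenic J (slice Omega J) f].

Definition slice_preserving Omega f : Prop :=
  forall J, sphere1 J -> f @` slice Omega J `<=` slice_space J.

Definition even_beta D F : Prop := forall x, D x -> F (conj_beta x) = F x.
Definition odd_beta D F : Prop := forall x, D x -> F (conj_beta x) = - F x.

Definition is_stem D f F0 F1 : Prop :=
  [/\ even_beta D F0, odd_beta D F1 &
      forall x J, D x -> sphere1 J ->
        f (slice_pt J x) = F0 x + qmul J (F1 x)].

Definition function13 D f : Prop := exists F0 F1, is_stem D f F0 F1.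

(* SR(Omega_D, H) *)
Definition SR13 D : set (quaternion R -> quaternion R) :=
  [set f | function13 D f /\ Reg13 (Omega_of D) f].

Definition analytic_stem D f F0 F1 : Prop :=
  [/\ real_analytic_on D F0, real_analytic_on D F1 & is_stem D f F0 F1].

Definition d_x0 F : CxR R -> quaternion R := 'D_(unit_vec 0) F.
Definition d_x1 F : CxR R -> quaternion R := 'D_(unit_vec 1) F.
Definition d_beta F : CxR R -> quaternion R := 'D_(unit_vec 2) F.

End Regularity.

Section Sanity.
Context {R : realType}.
Implicit Types (p q r J : quaternion R) (D : set (CxR R)).

Lemma quat_ext p q : p 0 0 = q 0 0 -> p 0 1 = q 0 1 -> p 0 2 = q 0 2 ->
  p 0 3 = q 0 3 -> p = q.
Proof.
move=> h0 h1 h2 h3; apply/rowP => -[[|[|[|[|//]]]] lt4].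
- by rewrite (_ : Ordinal _ = 0) //; exact/val_inj.
- by rewrite (_ : Ordinal _ = 1) //; exact/val_inj.
- by rewrite (_ : Ordinal _ = 2) //; exact/val_inj.
- by rewrite (_ : Ordinal _ = 3) //; exact/val_inj.
Qed.

Lemma qmulA p q r : qmul p (qmul q r) = qmul (qmul p q) r.
Proof. by apply: quat_ext; rewrite !mxE /=; ring. Qed.

Lemma qmul1q p : qmul q1 p = p.
Proof. by apply: quat_ext; rewrite !mxE /=; ring. Qed.

Lemma qmulq1 p : qmul p q1 = p.
Proof. by apply: quat_ext; rewrite !mxE /=; ring. Qed.

Lemma qmulii : qmul qi qi = - q1 :> quaternion R.
Proof. by apply: quat_ext; rewrite !mxE /=; ring. Qed.

Lemma qmuljj : qmul qj qj = - q1 :> quaternion R.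
Proof. by apply: quat_ext; rewrite !mxE /=; ring. Qed.

Lemma qmulkk : qmul qk qk = - q1 :> quaternion R.
Proof. by apply: quat_ext; rewrite !mxE /=; ring. Qed.

Lemma qmulijk : qmul qi (qmul qj qk) = - q1 :> quaternion R.
Proof. by apply: quat_ext; rewrite !mxE /=; ring. Qed.

(* For x in C x R, membership in D and in Omega_D (along any J) agree. *)
Lemma Omega_of_slice_pt D J (x : CxR R) : beta_invariant D -> sphere1 J ->
  Omega_of D (slice_pt J x) <-> D x.
Proof.
move=> Dinv S1J; split; last by move=> Dx; exists x => //; exists J.
case=> y Dy [K [b [c [-> bc1]]]]; case: S1J => b' [c' [-> bc1']] /rowP eqxy.
have e0 := eqxy 0; have e1 := eqxy 1; have e2 := eqxy 2; have e3 := eqxy 3.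
move: e0 e1 e2 e3; rewrite !mxE /= !(mulr0, mulr1, add0r, addr0).
move=> e0 e1 e2 e3.
have sq : (y 0 2) ^+ 2 = (x 0 2) ^+ 2.
  rewrite -[LHS]mulr1 -[RHS]mulr1 -{1}bc1 -bc1' !mulrDr -!exprMn.
  by rewrite e2 e3.
have row3 (u v : CxR R) : u 0 0 = v 0 0 -> u 0 1 = v 0 1 ->
    u 0 2 = v 0 2 -> u = v.
  move=> h0 h1 h2; apply/rowP => -[[|[|[|//]]] lt3].
  - by rewrite (_ : Ordinal _ = 0) //; exact/val_inj.
  - by rewrite (_ : Ordinal _ = 1) //; exact/val_inj.
  - by rewrite (_ : Ordinal _ = 2) //; exact/val_inj.
move/eqP: sq; rewrite eqf_sqr => /orP[] /eqP e.
  by rewrite -(row3 y x).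
rewrite (row3 x (conj_beta y)); first exact: Dinv.
- by rewrite !mxE.
- by rewrite !mxE.
- by rewrite !mxE /= e opprK.
Qed.

End Sanity.

(* Main.v *)
Require Import Defs.
From mathcomp Require Import all_boot all_order all_algebra.
From mathcomp Require Import finmap interval_inference mathcomp_extra boolp.
From mathcomp Require Import classical_sets functions cardinality fsbigop.
From mathcomp Require Import reals ereal topology normedtype sequences esum.
From mathcomp Require Import derive realfun exp.
From mathcomp Require Import measure lebesgue_measure lebesgue_integral ftc.
From mathcomp Require Import ring lra zify.
Set Implicit Arguments.
Unset Strict Implicit.
Unset Printing Implicit Defensive.
Import Order.TTheory GRing.Theory Num.Theory.
Import numFieldNormedType.Exports.
Local Open Scope classical_set_scope.
Local Open Scope ring_scope.

(** Let J be a unit of the (j, k)-plane.  Read in the coordinates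
(x0, x1, beta) of the slice of J, regularity of f says that the function
u_J = f o slice_pt J on D solves
  d_beta u = J (d_0 u + i d_1 u),
and the left multiplications by J and by J i are anticommuting square roots of
-1.  Applying the equation twice therefore gives, formally, that u_J is
harmonic, hence real analytic.

Take J = j and put F0 = (u_j + u_(-j)) / 2, F1 = - j (u_j - u_(-j)) / 2.  Since
u_J (z, - beta) = u_(-J) (z, beta), F0 is even and F1 is odd, and the sum and
the difference of the equations of u_j and u_(-j) are the announced first-order
system.  For any K the function u_K - (F0 + K F1) solves the equation of u_K;
it vanishes on beta = 0, where the point z + beta K does not depend on K.  The
equation expresses d_beta through d_0 and d_1, so all its derivatives vanish on
beta = 0 as well; being analytic on the connected set D, which meets beta = 0,
it vanishes on D ([identity_theorem], [monogenic_identity]).  Hence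
f = F0 + K F1 on every slice ([stem_equation]).  Uniqueness and the criterion
for slice preservation are algebra.

Two points need analysis.  The first is that a C^1 solution of the equation is
harmonic and analytic.  Averaging u over segments in the directions x0 and x1
(Steklov averages) turns one derivative in each of these directions into a
difference quotient, so that the average has enough derivatives for the formal
computation and is harmonic in the classical sense ([steklov_harmonic]); u is a
uniform limit of its averages.  For classical harmonic functions the maximum
principle with an explicit quadratic barrier bounds the gradient by the supremum
([gradient_estimate]).  This bound passes to uniform limits, so that these are
infinitely differentiable and harmonic; applied N times on cubes shrinking by
r / (2 N), it gives the estimates |d^N u| <= C^(N + 1) N! ([cauchy_bounds]) and
the Taylor series converges.

The second is that f is analytic in four real variables, although
  f (x0 + i x1 + j b + k c) = F0 (z, rho) + (b / rho) j F1 (z, rho)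
                                          + (c / rho) k F1 (z, rho),
with rho = sqrt (b^2 + c^2), is singular in form at rho = 0.  Where rho <> 0, the
functions b^p c^q rho^(- t) (d^w G) (z, rho) are stable under differentiation,
with coefficients small enough for bounds of the type above
([recursion_bound]).  Where rho = 0, parity leaves only the terms in which
rho^n, b rho^(n - 1) or c rho^(n - 1) is a polynomial in b and c; substituting
these in the power series of G gives a power series ([cyl_power_series]). *)

(** * Cubes and derivatives along lines *)

Section Cubes.
Context {R : realType} {n : nat}.
Implicit Types (a b x : 'rV[R]_n) (r s t : R) (l : 'I_n).

Definition cube a r : set 'rV[R]_n := [set x | forall i, `|x 0 i - a 0 i| < r].

(** The norm of row vectors is the supremum norm, so balls are cubes and
neighbourhoods are handled coordinate by coordinate. *)
Lemma ball_cube a r : 0 < r -> ball a r = cube a r.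
Proof.
move=> r0; apply/seteqP; split => x.
  by move=> [_ h] i; rewrite distrC; exact: (h 0 i).
move=> h; split => // i j; rewrite (ord1 i).
by rewrite /ball/= distrC; exact: h.
Qed.

Lemma cube_open a r : 0 < r -> open (cube a r).
Proof. by move=> r0; rewrite -ball_cube//; exact: ball_open. Qed.

Lemma near_cube a r x : 0 < r -> cube a r x -> \forall y \near x, cube a r y.
Proof. by move=> r0 ax; apply: open_nbhs_nbhs; split => //; exact: cube_open. Qed.

Lemma cube_center a r : 0 < r -> cube a r a.
Proof. by move=> r0 i; rewrite subrr normr0. Qed.

Lemma cube_trans a b r s x : cube a r b -> cube b s x -> cube a (r + s) x.
Proof.
move=> ab bx i; rewrite -(subrK (b 0 i) (x 0 i)) -addrA addrC.
by rewrite (le_lt_trans (ler_normD _ _))// ltrD.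
Qed.

Lemma sub_cube a r s : r <= s -> cube a r `<=` cube a s.
Proof. by move=> rs x ax i; rewrite (lt_le_trans (ax i)). Qed.

Lemma nbhs_cube (U : set 'rV[R]_n) x : nbhs x U ->
  exists2 r, 0 < r & cube x r `<=` U.
Proof.
by move=> /nbhs_ballP[r /= r0 rU]; exists r => //; rewrite -ball_cube.
Qed.

Lemma coordDe x t l i :
  (x + t *: unit_vec l) 0 i = x 0 i + t * (i == l)%:R.
Proof. by rewrite !mxE eqxx /=. Qed.

Lemma cube_shift a r x s t l : cube a r x -> `|t| <= s ->
  cube a (r + s) (x + t *: unit_vec l).
Proof.
move=> ax ts i; rewrite coordDe addrAC.
rewrite (le_lt_trans (ler_normD _ _))// ltr_leD// normrM.
by rewrite (le_trans _ ts)// ler_piMr//; case: eqP; rewrite ?normr1 ?normr0.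
Qed.

End Cubes.

Lemma cvg_sumr (R : realType) (V : normedModType R) (T : Type) (F : set_system T) (I : Type)
    (r : seq I) (P : pred I) (f : I -> T -> V) (y : I -> V) : Filter F ->
  (forall i, P i -> f i x @[x --> F] --> y i) ->
  \sum_(i <- r | P i) f i x @[x --> F] --> \sum_(i <- r | P i) y i.
Proof.
by move=> FF h; apply: cvg_big => //; exact: add_continuous.
Qed.

Section Lines.
Context {R : realType} {V W : normedModType R}.
Implicit Types (f : V -> W) (x v : V) (t : R).

Let growth f x v t : (fun h : R => h^-1 *: (((fun s : R => f (x + s *: v)) \o shift t)
    (h *: (1:R)) - f (x + t *: v))) =
  (fun h => h^-1 *: ((f \o shift (x + t *: v)) (h *: v) - f (x + t *: v))).
Proof.
by apply/funext => h /=; rewrite [h%:A]mulr1 scalerDl addrCA addrA.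
Qed.

(** Derivatives in a direction are derivatives along a line, so one-variable
calculus applies to them. *)
Lemma derivable_line f x v t :
  derivable (fun s : R => f (x + s *: v)) t (1:R) <-> derivable f (x + t *: v) v.
Proof. by rewrite /derivable growth. Qed.

Lemma derive_line f x v t :
  'D_(1:R) (fun s : R => f (x + s *: v)) t = 'D_v f (x + t *: v).
Proof. by rewrite /derive growth. Qed.

Let growth_shift f h v x :
  (fun t : R => t^-1 *: (((fun y => f (y + h)) \o shift x) (t *: v) - f (x + h))) =
  (fun t : R => t^-1 *: ((f \o shift (x + h)) (t *: v) - f (x + h))).
Proof. by apply/funext => t/=; rewrite -addrA. Qed.

Lemma derive_shift_arg f h v :
  'D_v (fun x => f (x + h)) = (fun x => 'D_v f (x + h)).
Proof. by apply/funext => x; rewrite /derive growth_shift. Qed.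

Lemma derivable_shift_arg f h v x :
  derivable f (x + h) v -> derivable (fun y => f (y + h)) x v.
Proof. by rewrite /derivable growth_shift. Qed.

Lemma is_derive_line f x v t d :
  is_derive t (1:R) (fun s : R => f (x + s *: v)) d <-> is_derive (x + t *: v) v f d.
Proof.
split=> -[h1 h2]; split.
- exact/derivable_line.
- by rewrite -derive_line.
- exact/derivable_line.
- by rewrite derive_line.
Qed.

Lemma is_derive_line0 f x v d :
  is_derive (0:R) (1:R) (fun s : R => f (x + s *: v)) d <-> is_derive x v f d.
Proof.
have := is_derive_line f x v 0 d.
by rewrite (_ : x + 0 *: v = x)// scale0r addr0.
Qed.

Lemma derive_eq_on (U : set V) f g x v : open U -> U x ->
  (forall y, U y -> f y = g y) -> 'D_v f x = 'D_v g x.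
Proof.
move=> oU Ux fg; apply: near_eq_derive.
by have := open_nbhs_nbhs (conj oU Ux); apply: filterS.
Qed.

Lemma derivable_eq_on (U : set V) f g x v : open U -> U x ->
  (forall y, U y -> f y = g y) -> derivable f x v -> derivable g x v.
Proof.
move=> oU Ux fg; apply: near_eq_derivable.
by have := open_nbhs_nbhs (conj oU Ux); apply: filterS.
Qed.

End Lines.

Section LineMVT.
Context {R : realType} {V : normedModType R}.
Implicit Types (f : V -> R) (x v : V) (t : R).

(** Working with the difference quotients themselves makes it possible to pass
to uniform limits in them. *)
Lemma is_derive_diff_quotP f x v L : is_derive x v f L <->
  forall eps : R, 0 < eps -> exists2 del : R, 0 < del & forall t, t != 0 ->
    `|t| < del -> `|t^-1 * (f (x + t *: v) - f x) - L| <= eps.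
Proof.
split=> [[df <-] eps eps0|h].
  have /cvgrPdist_le/(_ _ eps0)[/= d d0 hd] := df.
  exists d => // t t0 td; rewrite distrC; have := hd t.
  by rewrite /= sub0r normrN [_ *: v + x]addrC; exact.
have H : (fun h => h^-1 *: ((f \o shift x) (h *: v) - f x)) @ 0^' --> (L : R^o).
  apply/cvgrPdist_le => eps eps0; have [d d0 hd] := h _ eps0.
  exists d => //= t; rewrite /= sub0r normrN => td t0.
  by rewrite distrC [_ *: v + x]addrC; exact: hd.
by split; [apply/cvg_ex; exists L|exact/cvg_lim].
Qed.

Lemma MVT_convex f x v t :
  (forall c : R, 0 <= c <= 1 -> derivable f (x + (c * t) *: v) v) ->
  exists2 c : R, 0 <= c <= 1 & f (x + t *: v) - f x = t * 'D_v f (x + (c * t) *: v).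
Proof.
move=> df; pose g (s : R) := f (x + (s * t) *: v).
have dg (s : R) : 0 <= s <= 1 -> is_derive s (1:R) g (t * 'D_v f (x + (s * t) *: v)).
  move=> /df dfs.
  have d1 : is_derive (s * t) (1:R) (fun s : R => f (x + s *: v))
      ('D_v f (x + (s * t) *: v)).
    by apply/is_derive_line; exact: derivableP.
  have d2 : is_derive s (1:R) (fun s : R => s * t) t.
    by apply: is_derive_eq; rewrite /GRing.scale/=; ring.
  by rewrite mulrC; exact: (@is_derive1_comp _ (fun s : R => f (x + s *: v))
    (fun s : R => s * t) s _ t d1 d2).
have [|s|s|c cI e] := @MVT_segment _ g (fun s : R => t * 'D_v f (x + (s * t) *: v)) 0 1.
- exact: ler01.
- by move=> /subset_itv_oo_cc; rewrite in_itv/=; exact: dg.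
- apply: derivable_within_continuous => z; rewrite in_itv/= => /dg h.
  by have [] := h.
- exists c; first by move: cI; rewrite in_itv.
  by move: e; rewrite /g mul1r mul0r scale0r addr0 subr0 mulr1.
Qed.

Lemma MVT_line f x v t :
  (forall s, `|s| <= `|t| -> derivable f (x + s *: v) v) ->
  exists2 s, `|s| <= `|t| & f (x + t *: v) - f x = t * 'D_v f (x + s *: v).
Proof.
move=> df; have ct (c : R) : 0 <= c <= 1 -> `|c * t| <= `|t|.
  by move=> /andP[c0 c1]; rewrite normrM ger0_norm// ler_piMl.
have [c /ct c1 ->] := MVT_convex (fun c cI => df _ (ct c cI)).
by exists (c * t).
Qed.

(** At the maximum the first derivative is zero; if the second one were
positive, the first derivative would be positive just after, and by the mean
value theorem so would be the increment. *)
Lemma derive2_at_max f x v (d : R) : 0 < d ->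
  (forall t, `|t| < d -> derivable f (x + t *: v) v) ->
  derivable ('D_v f) x v ->
  (forall t, `|t| < d -> f (x + t *: v) <= f x) ->
  'D_v ('D_v f) x <= 0.
Proof.
move=> d0 df ddf fmax.
have D0 : 'D_v f x = 0.
  have := @derive1_at_max _ (fun s : R => f (x + s *: v)) (- d) d 0.
  case.
  - lra.
  - by move=> t; rewrite in_itv/= -ltr_norml => td; apply/derivable_line/df.
  - by rewrite in_itv/=; apply/andP; split; lra.
  - move=> t; rewrite in_itv/= -ltr_norml => td.
    by rewrite scale0r addr0; exact: fmax.
  - by move=> _; rewrite derive_line scale0r addr0.
rewrite leNgt; apply/negP => c0.
set c := 'D_v ('D_v f) x in c0.
have /cvgrPdist_lt/(_ _ c0) := ddf; rewrite -/(derive ('D_v f) x v) -/c.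
move=> [/= e e0 he].
pose t := Num.min (e / 2) (d / 2).
have t0 : 0 < t by rewrite lt_min !divr_gt0.
have te : t <= e / 2 by rewrite /t ge_min lexx.
have td : t <= d / 2 by rewrite /t ge_min lexx orbT.
have dg s : s \in `]0, t[ ->
    is_derive s (1:R) (fun s : R => f (x + s *: v)) ('D_v f (x + s *: v)).
  rewrite in_itv/= => /andP[s0 st]; apply: DeriveDef; last by rewrite derive_line.
  by apply/derivable_line/df; rewrite gtr0_norm//; lra.
have cg : {within `[0, t], continuous (fun s : R => f (x + s *: v))}.
  apply: derivable_within_continuous => s; rewrite in_itv/= => /andP[s0 st].
  by apply/derivable_line/df; rewrite ger0_norm//; lra.
have [s sI es] := MVT t0 dg cg.
move: sI; rewrite in_itv/= => /andP[s0 st].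
have : f (x + t *: v) <= f x by apply: fmax; rewrite gtr0_norm; lra.
rewrite -subr_le0; move: es; rewrite scale0r addr0 subr0 => ->.
apply/negP; rewrite -ltNge mulr_gt0//.
have := he s; rewrite /= sub0r normrN gtr0_norm//.
move=> /(_ ltac:(lra) (lt0r_neq0 s0)).
rewrite D0 subr0 [s *: v + x]addrC ltr_norml => /andP[_ h].
have {}h : 0 < s^-1 * 'D_v f (x + s *: v) by move: h; rewrite /GRing.scale/=; lra.
by move: h; rewrite pmulr_rgt0 ?invr_gt0.
Qed.

End LineMVT.

(** * Classically harmonic functions *)

Section Harmonic.
Context {R : realType} {n : nat}.
Implicit Types (a b x : 'rV[R]_n) (r s t M : R) (l k : 'I_n).
Implicit Types (U : set 'rV[R]_n) (f g v w : 'rV[R]_n -> R).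
Notation e := unit_vec.
#[local] Opaque derive derivable.

(** Only pure second derivatives along the axes are asked for: the maximum
principle uses nothing else. *)
Definition C2harmonic U v := forall x, U x ->
  [/\ {for x, continuous v},
      forall l, derivable v x (e l) /\ derivable ('D_(e l) v) x (e l) &
      \sum_l 'D_(e l) ('D_(e l) v) x = 0].

Lemma derive_lin c d f g x (u : 'rV[R]_n) :
  derivable f x u -> derivable g x u ->
  derivable (fun y => c * f y + d * g y) x u /\
  'D_u (fun y => c * f y + d * g y) x = c * 'D_u f x + d * 'D_u g x.
Proof.
move=> df dg.
have [] := is_deriveD (is_deriveZ c (derivableP df)) (is_deriveZ d (derivableP dg)).
by [].
Qed.

Lemma sum_lin0 c d (A B : 'I_n -> R) : \sum_l A l = 0 -> \sum_l B l = 0 ->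
  \sum_l (c * A l + d * B l) = 0.
Proof. by move=> A0 B0; rewrite big_split/= -!mulr_sumr A0 B0 !mulr0 addr0. Qed.

Lemma C2harmonic_lin U c d v w : open U -> C2harmonic U v -> C2harmonic U w ->
  C2harmonic U (fun y => c * v y + d * w y).
Proof.
move=> oU Hv Hw x Ux; have [cv dv Lv] := Hv x Ux; have [cw dw Lw] := Hw x Ux.
have D1 l y : U y -> c * 'D_(e l) v y + d * 'D_(e l) w y =
    'D_(e l) (fun y => c * v y + d * w y) y.
  move=> Uy; have [_ dv' _] := Hv y Uy; have [_ dw' _] := Hw y Uy.
  by have [_ ->] := derive_lin c d (dv' l).1 (dw' l).1.
split.
- exact: (cvgD (cvgM (cvg_cst c) cv) (cvgM (cvg_cst d) cw)).
- move=> l; have [dvw _] := derive_lin c d (dv l).1 (dw l).1.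
  have [dvw2 _] := derive_lin c d (dv l).2 (dw l).2; split; first exact: dvw.
  exact: (derivable_eq_on oU Ux (D1 l) dvw2).
- apply: (etrans _ (sum_lin0 c d Lv Lw)).
  apply: eq_bigr => l _; rewrite -(derive_eq_on _ oU Ux (D1 l)).
  by have [_ ->] := derive_lin c d (dv l).2 (dw l).2.
Qed.

Lemma C2harmonic_sub U V v : V `<=` U -> C2harmonic U v -> C2harmonic V v.
Proof. by move=> VU Hv x /VU; exact: Hv. Qed.

Lemma C2harmonic_shift U h v : C2harmonic U v -> C2harmonic [set x | U (x + h)] (fun x => v (x + h)).
Proof.
move=> Hv x /= /Hv[cv dv Lv]; split.
- apply: (@continuous_comp _ _ _ (fun x => x + h) v); last exact: cv.
  exact: (cvgD cvg_id (cvg_cst h)).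
- move=> l; have -> := derive_shift_arg v h (e l).
  have [d1 d2] := dv l; split; first exact: (derivable_shift_arg d1).
  exact: (derivable_shift_arg d2).
- apply: (etrans _ Lv); apply: eq_bigr => l _.
  have -> := derive_shift_arg v h (e l).
  exact: (congr1 (@^~ x) (derive_shift_arg ('D_(e l) v) h (e l))).
Qed.

Lemma is_derive_oppv f x (u : 'rV[R]_n) d :
  is_derive x u f d -> is_derive x (- u) f (- d).
Proof.
move=> /is_derive_line0 df; apply/is_derive_line0.
have -> : (fun s : R => f (x + s *: - u)) = (fun s : R => f (x + s *: u)) \o -%R.
  by apply/funext => s/=; rewrite scalerN scaleNr.
by rewrite -[- d]mulrN1; apply: is_derive1_comp; rewrite oppr0.
Qed.

(** The reflection in the hyperplane through a orthogonal to the axis l. *)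
Definition mirror a l x : 'rV[R]_n := x - (2 * (x 0 l - a 0 l)) *: e l.

Lemma mirrorDe a l x t k : mirror a l (x + t *: e k) =
  mirror a l x + (if k == l then - t else t) *: e k.
Proof.
rewrite /mirror coordDe; apply/rowP => i; rewrite !mxE eqxx/= (eq_sym l).
case: (eqVneq k l) => [->|kl] /=; last by ring.
by case: (i == l); ring.
Qed.

Lemma is_derive_mirror f a l k x d : is_derive (mirror a l x) (e k) f d ->
  is_derive x (e k) (f \o mirror a l) ((if k == l then -1 else 1) * d).
Proof.
move=> df; apply/is_derive_line0.
pose u : 'rV[R]_n := if k == l then - e k else e k.
have -> : (fun s : R => (f \o mirror a l) (x + s *: e k)) =
         (fun s : R => f (mirror a l x + s *: u)).
  apply/funext => s/=; rewrite mirrorDe /u; case: ifP => _//.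
  by rewrite scalerN scaleNr.
apply/is_derive_line0; rewrite /u; case: ifP => _; last by rewrite mul1r.
by rewrite mulN1r; exact: is_derive_oppv.
Qed.

Lemma continuous_mirror a l : continuous (mirror a l).
Proof.
move=> x; rewrite /continuous_at /mirror.
have c : (fun y : 'rV[R]_n => 2 * (y 0 l - a 0 l)) @ x --> 2 * (x 0 l - a 0 l).
  exact: (cvgM (cvg_cst _) (cvgB (@coord_continuous _ _ _ 0 l x) (cvg_cst _))).
exact: (cvgB cvg_id (cvgZ c (cvg_cst _))).
Qed.

(** The reflection changes the sign of the derivative along l each time it is
taken, hence not at all after two derivatives. *)
Lemma C2harmonic_mirror U V a l v : open V -> (forall x, V x -> U (mirror a l x)) ->
  C2harmonic U v -> C2harmonic V (v \o mirror a l).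
Proof.
move=> oV VU Hv x Vx; have [cv dv Lv] := Hv _ (VU x Vx).
pose sg k : R := if k == l then -1 else 1.
have D1 k y : V y -> sg k * 'D_(e k) v (mirror a l y) =
    'D_(e k) (v \o mirror a l) y.
  move=> Vy; have [_ dv' _] := Hv _ (VU y Vy).
  by have [_ ->] := is_derive_mirror (derivableP (dv' k).1).
have D2 k : is_derive x (e k) (fun y => sg k * 'D_(e k) v (mirror a l y))
     ('D_(e k) ('D_(e k) v) (mirror a l x)).
  have d1 := is_derive_mirror (derivableP (dv k).2).
  have := is_deriveZ (sg k) d1; rewrite /GRing.scale/= mulrA.
  suff -> : sg k * (if k == l then -1 else 1) = 1 by rewrite mul1r.
  by rewrite /sg; case: ifP; rewrite ?mulr1// mulrNN mulr1.
split.
- exact: (continuous_comp (@continuous_mirror a l x) cv).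
- move=> k; split; first by have [] := is_derive_mirror (derivableP (dv k).1).
  by have [d2 _] := D2 k; exact: (derivable_eq_on oV Vx (D1 k) d2).
- apply: (etrans _ Lv); apply: eq_bigr => k _.
  by apply: (etrans (esym (derive_eq_on _ oV Vx (D1 k)))); have [_] := D2 k.
Qed.

(** Subtracting the parabola reduces this to an ordinary maximum.  The parabola
is meant to be the restriction of the barrier to a line. *)
Lemma derive2_at_max_quad f x (u : 'rV[R]_n) (B C d : R) : 0 < d ->
  (forall t, `|t| < d -> derivable f (x + t *: u) u) ->
  derivable ('D_u f) x u ->
  (forall t, `|t| < d -> f (x + t *: u) <= f x + B * t + C * t ^+ 2) ->
  'D_u ('D_u f) x <= 2 * C.
Proof.
move=> d0 df ddf fmax.
pose g (t : R) := f (x + t *: u); pose q (t : R) := B * t + C * t ^+ 2.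
have dq t : is_derive t (1:R) q (B + 2 * C * t).
  apply: is_derive_eq; rewrite /GRing.scale/=; ring.
have dg t : `|t| < d -> is_derive t (1:R) g ('D_u f (x + t *: u)).
  by move=> td; exact: (proj2 (is_derive_line f x u t _) (derivableP (df t td))).
have D1 t : `|t| < d ->
    is_derive t (1:R) (g - q) ('D_u f (x + t *: u) - (B + 2 * C * t)).
  by move=> /dg dgt; apply: is_deriveB.
pose I : set R := [set t | `|t| < d].
have oI : open I.
  rewrite (_ : I = ball (0:R) d); first exact: ball_open.
  by apply/seteqP; split => t; rewrite /I/ball/= sub0r normrN.
have I0 : I 0 by rewrite /I/= normr0.
have E1 t : I t -> 'D_u f (x + t *: u) - (B + 2 * C * t) = 'D_1 (g - q) t.
  by move=> It; have [_ ->] := D1 _ It.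
have dl : is_derive (0:R) (1:R) (fun t : R => B + 2 * C * t) (2 * C).
  apply: is_derive_eq; rewrite /GRing.scale/=; ring.
have df2 : is_derive (0:R) (1:R) (fun t : R => 'D_u f (x + t *: u)) ('D_u ('D_u f) x).
  exact: (proj2 (is_derive_line0 ('D_u f) x u _) (derivableP ddf)).
have D2 : is_derive (0:R) (1:R) (fun t => 'D_u f (x + t *: u) - (B + 2 * C * t))
    ('D_u ('D_u f) x - 2 * C) by exact: is_deriveB.
rewrite -subr_le0; have [_ <-] := D2; rewrite (derive_eq_on _ oI I0 E1).
apply: (@derive2_at_max _ _ (g - q) 0 1 d d0).
- by move=> t td; rewrite add0r [_%:A]mulr1; have [] := D1 _ td.
- by have [d2 _] := D2; exact: (derivable_eq_on oI I0 E1 d2).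
- move=> t td; rewrite add0r [_%:A]mulr1 /g/q/= !fctE.
  rewrite scale0r addr0 mulr0 expr0n/= mulr0 addr0 subr0.
  by rewrite lerBlDr addrA; exact: fmax.
Qed.

End Harmonic.

(** * The gradient estimate *)

Section GradientEstimate.
Context {R : realType} {n : nat}.
Implicit Types (a b x p : 'rV[R]_n) (r s t M : R) (l k : 'I_n).
Implicit Types (U : set 'rV[R]_n) (f g v w : 'rV[R]_n -> R).
Notation e := unit_vec.
#[local] Opaque derive derivable.

(** The comparison function on the half cube where x_l >= a_l: a quadratic
polynomial that is nonnegative there and at least M on the faces off the
hyperplane x_l = a_l.  Its second derivatives are 2 M / d^2 along each of the
n - 1 axes other than l and - 2 n M / d^2 along l, so its Laplacian is negative. *)
Definition barrier a l (M d : R) x : R :=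
  M / d ^+ 2 * (\sum_(i | i != l) (x 0 i - a 0 i) ^+ 2 +
    (x 0 l - a 0 l) * (n.+1%:R * d - n%:R * (x 0 l - a 0 l))).

Definition half_cube a l (d : R) : set 'rV[R]_n :=
  [set x | forall i, (if i == l then `[a 0 i, a 0 i + d]%classic
                      else `[a 0 i - d, a 0 i + d]%classic) (x 0 i)].

Lemma half_cube_compact a l d : compact (half_cube a l d).
Proof.
apply: (@rV_compact _ _ (fun i => if i == l then `[a 0 i, a 0 i + d]%classic
                      else `[a 0 i - d, a 0 i + d]%classic)).
by move=> i; case: ifP => _; exact: segment_compact.
Qed.

Lemma half_cubeP a l d x : half_cube a l d x <->
  0 <= x 0 l - a 0 l <= d /\ forall i, i != l -> `|x 0 i - a 0 i| <= d.
Proof.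
split.
  move=> h; split.
    by move: (h l); rewrite eqxx/= in_itv/= => /andP[h1 h2]; apply/andP; split; lra.
  move=> i il; move: (h i); rewrite (negbTE il)/= in_itv/= => /andP[h1 h2].
  by rewrite ler_norml; apply/andP; split; lra.
move=> [/andP[h1 h2] h] i; case: eqVneq => [->|/h].
  by rewrite /= in_itv/=; apply/andP; split; lra.
by rewrite ler_norml /= in_itv/= => /andP[h3 h4]; apply/andP; split; lra.
Qed.

Lemma barrier_line a l M d x t k : barrier a l M d (x + t *: e k) =
  barrier a l M d x +
  (if k == l then M / d ^+ 2 * (n.+1%:R * d - 2 * n%:R * (x 0 l - a 0 l))
   else M / d ^+ 2 * (2 * (x 0 k - a 0 k))) * t +
  (if k == l then - n%:R else 1) * (M / d ^+ 2) * t ^+ 2.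
Proof.
rewrite /barrier; case: (eqVneq k l) => [->|kl].
  have -> : \sum_(i | i != l) ((x + t *: e l) 0 i - a 0 i) ^+ 2 =
      \sum_(i | i != l) (x 0 i - a 0 i) ^+ 2.
    by apply: eq_bigr => i il; rewrite coordDe (negbTE il) mulr0 addr0.
  by rewrite coordDe eqxx mulr1; set S := \sum_(i | _) _; ring.
rewrite !(bigD1 k kl)/= !coordDe eqxx (eq_sym l) (negbTE kl).
have -> : \sum_(i | (i != l) && (i != k)) ((x + t *: e k) 0 i - a 0 i) ^+ 2 =
    \sum_(i | (i != l) && (i != k)) (x 0 i - a 0 i) ^+ 2.
  by apply: eq_bigr => i /andP[_ ik]; rewrite coordDe (negbTE ik) mulr0 addr0.
by rewrite mulr1 mulr0 addr0; set S := \sum_(i | _) _; ring.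
Qed.

Lemma barrier_ge0 a l M d x : 0 < M -> 0 < d -> half_cube a l d x ->
  0 <= barrier a l M d x.
Proof.
move=> M0 d0 /half_cubeP[/andP[x0 xd] _]; rewrite /barrier.
apply: mulr_ge0; first by rewrite divr_ge0// ?exprn_ge0// ltW.
apply: addr_ge0; first by apply: sumr_ge0 => i _; exact: sqr_ge0.
apply: mulr_ge0 => //; rewrite -natr1; set N : R := n%:R.
have N0 : 0 <= N by rewrite ler0n.
by nra.
Qed.

Lemma barrier_geM a l M d x : 0 < M -> 0 < d -> half_cube a l d x ->
  (exists i, `|x 0 i - a 0 i| = d) -> M <= barrier a l M d x.
Proof.
move=> M0 d0 /half_cubeP[/andP[x0 xd] _] [i xi]; rewrite /barrier.
rewrite mulrAC ler_pdivlMr ?exprn_gt0// ler_pM2l//.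
have N0 : 0 <= n%:R :> R by rewrite ler0n.
have [il|il] := eqVneq i l.
  move: xi; rewrite il ger0_norm// => ->.
  apply: ler_wpDl; first by apply: sumr_ge0 => j _; exact: sqr_ge0.
  by rewrite -natr1; nra.
rewrite (bigD1 i)//= -addrA.
have -> : (x 0 i - a 0 i) ^+ 2 = d ^+ 2 by rewrite -xi real_normK ?num_real.
rewrite lerDl addr_ge0//; first by apply: sumr_ge0 => j _; exact: sqr_ge0.
by apply: mulr_ge0 => //; rewrite -natr1; nra.
Qed.

Lemma continuous_barrier a l M d : continuous (barrier a l M d).
Proof.
move=> x; rewrite /continuous_at /barrier.
have FF : Filter (nbhs (x : 'rV[R]_n)) := nbhs_filter x.
have c i : (fun x : 'rV[R]_n => x 0 i - a 0 i) @ x --> x 0 i - a 0 i.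
  exact: (cvgB (@coord_continuous _ _ _ 0 i x) (cvg_cst (a 0 i))).
have cS : (fun x : 'rV[R]_n => \sum_(i | i != l) (x 0 i - a 0 i) ^+ 2) @ x -->
    \sum_(i | i != l) (x 0 i - a 0 i) ^+ 2.
  by apply: (cvg_sumr (nbhs_filter x)) => i il; exact: (cvgM (c i) (c i)).
have cl : (fun y : 'rV[R]_n =>
    (y 0 l - a 0 l) * (n.+1%:R * d - n%:R * (y 0 l - a 0 l))) @ x -->
    (x 0 l - a 0 l) * (n.+1%:R * d - n%:R * (x 0 l - a 0 l)).
  exact: (cvgM (c l) (cvgB (@cvg_cst _ (n.+1%:R * d : R) _ _ FF)
    (cvgM (@cvg_cst _ (n%:R : R) _ _ FF) (c l)))).
exact: (cvgM (@cvg_cst _ (M / d ^+ 2) _ _ FF) (cvgD cS cl)).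
Qed.

(** At a maximum of f - barrier inside the half cube, every second derivative of f
is at most that of the barrier; their sums would satisfy 0 <= - 2 M / d^2.  So a
maximum off the outer faces lies on the hyperplane of reflection. *)
Lemma barrier_max_pt U a l M d f p : 0 < M -> 0 < d ->
  half_cube a l d `<=` U -> C2harmonic U f -> half_cube a l d p ->
  (forall x, half_cube a l d x ->
     f x - barrier a l M d x <= f p - barrier a l M d p) ->
  (forall i, `|p 0 i - a 0 i| < d) -> p 0 l - a 0 l <= 0.
Proof.
move=> M0 d0 KU Hf Kp pmax pd; rewrite leNgt; apply/negP => pl0.
have [_ df Lf] := Hf p (KU _ Kp).
pose c k : R := (if k == l then - n%:R else 1) * (M / d ^+ 2).
suff H k : 'D_(e k) ('D_(e k) f) p <= 2 * c k.
  have : \sum_k 'D_(e k) ('D_(e k) f) p <= \sum_k 2 * c k by exact: ler_sum.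
  rewrite Lf -mulr_sumr -mulr_suml (bigD1 l)//= eqxx.
  rewrite (eq_bigr (fun=> 1)); last by move=> i /negbTE->.
  rewrite sumr_const cardC1 card_ord leNgt => /negP; apply.
  have n0 : (0 < n)%N by exact: leq_ltn_trans (ltn_ord l).
  rewrite -subn1 natrB// (_ : - n%:R + (n%:R - 1%:R) = -1); last by ring.
  have : 0 < M / d ^+ 2 by rewrite divr_gt0// exprn_gt0.
  by lra.
(* On this range the line through p in the direction k stays in the half cube. *)
pose dl := Num.min (d - `|p 0 k - a 0 k|) (p 0 l - a 0 l).
have dl0 : 0 < dl by rewrite lt_min pl0 subr_gt0 pd.
have Kt t : `|t| < dl -> half_cube a l d (p + t *: e k).
  rewrite lt_min => /andP[]; rewrite ltrBrDr => tk tl.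
  have hk : `|(p + t *: e k) 0 k - a 0 k| <= d.
    rewrite coordDe eqxx mulr1 addrAC addrC.
    by rewrite (le_trans (ler_normD _ _))// ltW.
  apply/half_cubeP; split; last first.
    move=> i il; have [->//|ik] := eqVneq i k.
    by rewrite coordDe (negbTE ik) mulr0 addr0 ltW.
  have [kl|kl] := eqVneq k l; last first.
    rewrite coordDe eq_sym (negbTE kl) mulr0 addr0 ltW//=.
    by have := pd l; rewrite gtr0_norm// => /ltW.
  move: hk; rewrite kl !coordDe eqxx mulr1 ler_norml => /andP[_ ->].
  by move: tl; rewrite ltr_norml => /andP[tl _]; rewrite andbT; lra.
apply: (@derive2_at_max_quad _ _ f p (e k)
  (if k == l then M / d ^+ 2 * (n.+1%:R * d - 2 * n%:R * (p 0 l - a 0 l))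
   else M / d ^+ 2 * (2 * (p 0 k - a 0 k))) (c k) dl dl0).
- by move=> t /Kt/KU/Hf[_ h _]; have [] := h k.
- by have [] := df k.
- by move=> t /Kt/pmax; rewrite barrier_line /c; set A := (X in X * t); lra.
Qed.

(** Maximum principle for the odd part of v under the reflection: it vanishes on
the hyperplane of reflection, where the barrier is nonnegative, and it is at
most M on the other faces, where the barrier is at least M. *)
Lemma odd_part_le_barrier a l r M d v x : 0 < M -> 0 < d < r ->
  C2harmonic (cube a r) v -> (forall x, cube a r x -> `|v x| <= M) ->
  half_cube a l d x -> (v x - v (mirror a l x)) / 2 <= barrier a l M d x.
Proof.
move=> M0 /andP[d0 dr] Hv vM Kx.
have r0 : 0 < r by exact: lt_trans dr.
have mirror_cube y : cube a r y -> cube a r (mirror a l y).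
  move=> ay i; rewrite /mirror !mxE eqxx/=; have [->|il] := eqVneq i l.
    by rewrite mulr1 -normrN; move: (ay l); congr (`| _ | < _); ring.
  by rewrite mulr0 subr0.
pose f y := 2^-1 * v y + - 2^-1 * (v \o mirror a l) y.
have Hf : C2harmonic (cube a r) f.
  have oU := @cube_open _ _ a r r0.
  exact: (C2harmonic_lin _ _ oU Hv (C2harmonic_mirror oU mirror_cube Hv)).
have fE y : (v y - v (mirror a l y)) / 2 = f y by rewrite /f /=; ring.
have fM y : cube a r y -> f y <= M.
  move=> ay; rewrite -fE.
  have := vM _ ay; have := vM _ (mirror_cube y ay).
  by rewrite !ler_norml => /andP[h1 h2] /andP[h3 h4]; lra.
have KU : half_cube a l d `<=` cube a r.
  move=> y /half_cubeP[/andP[h1 h2] h3] i; apply: le_lt_trans dr.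
  by have [->|/h3//] := eqVneq i l; rewrite ger0_norm.
have cw : {within half_cube a l d, continuous (fun y => f y - barrier a l M d y)}.
  apply: continuous_in_subspaceT => y /set_mem/KU/Hf[cf _ _].
  exact: (cvgB cf (@continuous_barrier a l M d y)).
have [p /set_mem Kp pmax] := EVT_max_rV
  (ex_intro _ x Kx) (@half_cube_compact a l d) cw.
rewrite fE -subr_le0.
apply: (le_trans (pmax _ (mem_set Kx))); rewrite subr_le0.
have [/forallP ph|/forallPn/= [i pi]] := boolP [forall i, `|p 0 i - a 0 i| < d].
  have pl := barrier_max_pt M0 d0 KU Hf Kp
    (fun y Ky => pmax y (mem_set Ky)) ph.
  have {}pl : p 0 l = a 0 l.
    apply/eqP; rewrite -subr_eq0 eq_le pl/=.
    by move/half_cubeP : Kp => [/andP[]].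
  rewrite -fE /mirror pl subrr mulr0 scale0r subr0 subrr mul0r.
  exact: barrier_ge0.
apply: (le_trans (fM _ (KU _ Kp))); apply: barrier_geM => //; exists i.
apply/eqP; rewrite eq_le (leNgt d) pi andbT.
move/half_cubeP : Kp => [/andP[h1 h2] h3].
by have [->|/h3//] := eqVneq i l; rewrite ger0_norm.
Qed.

(** The odd part has the derivative of v at a, the barrier has slope
(n + 1) M / d there, and both vanish at a. *)
Lemma gradient_estimate_strict a l r M d v : 0 < M -> 0 < d < r ->
  C2harmonic (cube a r) v -> (forall x, cube a r x -> `|v x| <= M) ->
  'D_(e l) v a <= n.+1%:R * M / d.
Proof.
move=> M0 dr Hv vM; have [d0 _] := andP dr; rewrite leNgt; apply/negP => DL.
have r0 : 0 < r by move/andP : dr => [d0' dr']; exact: lt_trans dr'.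
set L := n.+1%:R * M / d in DL.
have [_ /(_ l)[dv _] _] := Hv a (cube_center a r0).
(* A slope above L would exceed the barrier at a small distance t from a. *)
pose g := ('D_(e l) v a - L) / 2.
have g0 : 0 < g by rewrite divr_gt0// subr_gt0.
have [del del0 Hq] := (proj1 (is_derive_diff_quotP v a (e l) _) (derivableP dv)) _ g0.
pose t := Num.min (del / 2) d.
have t0 : 0 < t by rewrite lt_min d0 divr_gt0.
have td : t < del by rewrite (@le_lt_trans _ _ (del / 2))// ?ge_min ?lexx//; lra.
have tld : t <= d by rewrite ge_min lexx orbT.
have Lg : L < 'D_(e l) v a - g by rewrite /g; lra.
have := Hq t (lt0r_neq0 t0); rewrite gtr0_norm// => /(_ td).
have := Hq (- t); rewrite oppr_eq0 normrN gtr0_norm// => /(_ (lt0r_neq0 t0) td).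
rewrite !ler_norml => /andP[h1 _] /andP[h2 _].
have {}h1 : L < t^-1 * (v a - v (a - t *: e l)).
  by move: h1; rewrite invrN scaleNr mulNr -mulrN opprB; lra.
have {}h2 : L < t^-1 * (v (a + t *: e l) - v a) by lra.
move: h1 h2; rewrite ![t^-1 * _]mulrC !ltr_pdivlMr// => h1 h2.
have Kx : half_cube a l d (a + t *: e l).
  apply/half_cubeP; split.
    by rewrite coordDe eqxx mulr1 addrAC subrr add0r tld ltW.
  by move=> i il; rewrite coordDe (negbTE il) mulr0 addr0 subrr normr0 ltW.
have := odd_part_le_barrier M0 dr Hv vM Kx.
rewrite mirrorDe eqxx /mirror subrr mulr0 scale0r subr0 scaleNr.
apply/negP; rewrite -ltNge.
have -> : barrier a l M d (a + t *: e l) = L * t - M / d ^+ 2 * n%:R * t ^+ 2.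
  rewrite barrier_line eqxx /barrier subrr mul0r addr0 big1; last first.
    by move=> i _; rewrite subrr expr0n.
  by rewrite /L; field; rewrite gt_eqF.
have Q0 : 0 <= M / d ^+ 2 := divr_ge0 (ltW M0) (sqr_ge0 d).
have := mulr_ge0 (mulr_ge0 Q0 (ler0n _ n)) (sqr_ge0 t).
by set Q := M / d ^+ 2 * _ * _; lra.
Qed.

Lemma C2harmonicN U v : open U -> C2harmonic U v -> C2harmonic U (fun x => - v x).
Proof.
move=> oU Hv; have := C2harmonic_lin (-1) 0 oU Hv Hv.
by rewrite (_ : (fun y => -1 * v y + 0 * v y) = (fun x => - v x))//;
  apply/funext => y; rewrite mulN1r mul0r addr0.
Qed.

(** The factor 2 comes from using cubes of half the radius, the n + 1 from the
slope of the barrier. *)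
Definition kappa : R := 2 * n.+1%:R.

Lemma kappa_gt0 : 0 < kappa.
Proof. by rewrite mulr_gt0. Qed.

(** The bound below comes from the bound above applied to - v. *)
Lemma gradient_estimate a l r M v : 0 < M -> 0 < r ->
  C2harmonic (cube a r) v -> (forall x, cube a r x -> `|v x| <= M) ->
  `|'D_(e l) v a| <= kappa * M / r.
Proof.
move=> M0 r0 Hv vM.
have dr : 0 < r / 2 < r by apply/andP; split; lra.
have E : kappa * M / r = n.+1%:R * M / (r / 2) by rewrite /kappa; field; lra.
rewrite E ler_norml.
rewrite (gradient_estimate_strict l M0 dr Hv vM) andbT.
have := @gradient_estimate_strict a l r M (r / 2) (fun x => - v x) M0 dr.
have [_ /(_ l)[dv _] _] := Hv a (cube_center a r0).
have [_ ->] := is_deriveN (derivableP dv); rewrite lerNl; apply.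
  by apply: C2harmonicN => //; exact: cube_open.
by move=> x /vM; rewrite normrN.
Qed.

End GradientEstimate.

(** * Uniform limits of harmonic functions *)

Section UniformLimits.
Context {R : realType} {n : nat}.
Implicit Types (a b x p : 'rV[R]_n) (r s t M eps : R) (l k : 'I_n).
Implicit Types (U : set 'rV[R]_n) (f g v w : 'rV[R]_n -> R).
Notation e := unit_vec.
Notation kappa := (kappa (R := R) (n := n)).
#[local] Opaque derive derivable.

Lemma le_addM_eps (A B C : R) : 0 <= C ->
  (forall eps, 0 < eps -> A <= B + C * eps) -> A <= B.
Proof.
move=> C0 h; apply/ler_addgt0Pr => eps eps0.
have C1 : 0 < C + 1 by lra.
have := h (eps / (C + 1)) (divr_gt0 eps0 C1); move/le_trans; apply.
by rewrite lerD2l mulrA ler_pdivrMr// mulrC; nra.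
Qed.

Definition bounded_by a r g M := forall x, cube a r x -> `|g x| <= M.

(** Uniform approximation by harmonic functions on one fixed cube: the form in
which harmonicity is inherited by limits. *)
Definition harmonic_limit a r g := forall eps, 0 < eps ->
  exists2 v, C2harmonic (cube a r) v & forall x, cube a r x -> `|g x - v x| <= eps.

Definition diff_quot l t g x : R := t^-1 * (g (x + t *: e l) - g x).

Lemma cube_recenter a b r s q : cube a r b -> r + s <= q ->
  cube b s `<=` cube a q.
Proof. by move=> ab rsq x /(cube_trans ab); exact: sub_cube. Qed.

Lemma gradient_estimate_at a b r s q M l v : 0 < M -> 0 < s ->
  cube a r b -> r + s <= q -> C2harmonic (cube a q) v -> bounded_by a q v M ->
  `|'D_(e l) v b| <= kappa * M / s.
Proof.
move=> M0 s0 ab rsq Hv vM; have sub := cube_recenter ab rsq.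
apply: gradient_estimate => //; first exact: (C2harmonic_sub sub Hv).
by move=> x /sub; exact: vM.
Qed.

Lemma C2harmonic_quot a r s t l v : 0 < s -> s + `|t| <= r -> C2harmonic (cube a r) v ->
  C2harmonic (cube a s) (diff_quot l t v).
Proof.
move=> s0 str Hv; have oU := @cube_open _ _ a s s0.
have H1 : C2harmonic (cube a s) (fun x => v (x + t *: e l)).
  apply: (C2harmonic_sub _ (@C2harmonic_shift _ _ _ (t *: e l) _ Hv)) => x ax /=.
  exact: (sub_cube str (cube_shift l ax (lexx _))).
have H2 : C2harmonic (cube a s) v.
  by apply: (C2harmonic_sub _ Hv); apply: sub_cube; have := normr_ge0 t; lra.
have := C2harmonic_lin t^-1 (- t^-1) oU H1 H2.
by congr (C2harmonic _ _); apply/funext => x; rewrite /diff_quot; ring.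
Qed.

Lemma C2harmonic_derivable a r v x l : C2harmonic (cube a r) v -> cube a r x -> derivable v x (e l).
Proof. by move=> Hv ax; have [_ /(_ l)[]] := Hv x ax. Qed.

(** By the mean value theorem the quotient is D_l v at an intermediate point
a + s e_l, and the difference from D_l v at a is the derivative at a of the
increment w = v (. + s e_l) - v.  The gradient estimate for v bounds w by a
multiple of |s|, and then the gradient estimate for w bounds its derivative. *)
Lemma C2harmonic_diff_quot_estimate a r M l t v : 0 < r -> 0 < M -> C2harmonic (cube a r) v ->
  bounded_by a r v M -> t != 0 -> `|t| < r / 4 ->
  `|diff_quot l t v a - 'D_(e l) v a| <= 8 * kappa ^+ 2 * M / r ^+ 2 * `|t|.
Proof.
move=> r0 M0 Hv vM t0 tr; have k0 := @kappa_gt0 R n.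
have aa : cube a (r / 4) a by apply: cube_center; lra.
have line x s : cube a (r / 4) x -> `|s| <= `|t| -> cube a (r / 2) (x + s *: e l).
  move=> ax st; have := @cube_shift _ _ a (r / 4) x (r / 4) s l ax.
  by rewrite (_ : r / 4 + r / 4 = r / 2); [apply; lra|lra].
have half : cube a (r / 2) `<=` cube a r by apply: sub_cube; lra.
have [s st E] := @MVT_line _ _ v a (e l) t
  (fun s st => C2harmonic_derivable (l := l) Hv (half _ (line a s aa st))).
rewrite /diff_quot E mulKf//.
have [->|s0] := eqVneq s 0.
  rewrite scale0r addr0 subrr normr0 mulr_ge0// divr_ge0// ?exprn_ge0//; last lra.
  by rewrite !mulr_ge0// ltW.
have s0' : 0 < `|s| by rewrite normr_gt0.
pose w x := 1 * v (x + s *: e l) + -1 * v x.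
have oU := @cube_open _ _ a (r / 4) (ltac:(lra)).
have H1 : C2harmonic (cube a (r / 4)) (fun x => v (x + s *: e l)).
  apply: (C2harmonic_sub _ (@C2harmonic_shift _ _ _ (s *: e l) _ Hv)) => x ax /=.
  exact/half/line.
have H2 : C2harmonic (cube a (r / 4)) v by apply: (C2harmonic_sub _ Hv); apply: sub_cube; lra.
have Hw : C2harmonic (cube a (r / 4)) w := C2harmonic_lin 1 (-1) oU H1 H2.
pose M' := `|s| * (kappa * M / (r / 2)).
have M'0 : 0 < M' by rewrite mulr_gt0// divr_gt0 ?mulr_gt0//; lra.
have wM : bounded_by a (r / 4) w M'.
  move=> x ax; rewrite /w mul1r mulN1r.
  have lx s' : `|s'| <= `|s| -> cube a (r / 2) (x + s' *: e l).
    by move=> ss; apply: line => //; exact: le_trans st.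
  have [s' ss' ->] := @MVT_line _ _ v x (e l) s
    (fun s' ss => C2harmonic_derivable (l := l) Hv (half _ (lx s' ss))).
  rewrite normrM ler_pM2l//.
  by apply: (@gradient_estimate_at a _ (r / 2) (r / 2) r) => //;
    [lra|exact: lx|lra].
have := gradient_estimate l M'0 (ltac:(lra) : 0 < r / 4) Hw wM.
have d1 := derivable_shift_arg (C2harmonic_derivable (l := l) Hv (half _ (line a s aa st))).
have [_ ->] := derive_lin 1 (-1) d1 (C2harmonic_derivable (l := l) H2 aa).
rewrite mul1r mulN1r (congr1 (@^~ a) (derive_shift_arg v (s *: e l) (e l))).
move=> /le_trans; apply.
rewrite (_ : kappa * M' / (r / 4) = 8 * kappa ^+ 2 * M / r ^+ 2 * `|s|); last first.
  by rewrite /M'; field; lra.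
by rewrite ler_wpM2l// divr_ge0 ?sqr_ge0// !mulr_ge0// ltW.
Qed.

(** The limit is the supremum of the lower bounds q t - K |t|: the Cauchy
condition says that each of these is below each upper bound q s + K |s|. *)
Lemma diff_quot_cauchy_limit (q : R -> R) (K d : R) : 0 < d ->
  (forall s t, s != 0 -> t != 0 -> `|s| < d -> `|t| < d ->
     `|q s - q t| <= K * (`|s| + `|t|)) ->
  exists L, forall t, t != 0 -> `|t| < d -> `|q t - L| <= K * `|t|.
Proof.
move=> d0 h.
pose A := [set y | exists t, [/\ t != 0, `|t| < d & y = q t - K * `|t|]].
have ub s : s != 0 -> `|s| < d -> ubound A (q s + K * `|s|).
  move=> s0 sd _ [t [t0 td ->]]; have := h _ _ t0 s0 td sd.
  by rewrite ler_norml => /andP[_]; lra.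
have d2 : `|d / 2| < d by rewrite gtr0_norm; lra.
have d20 : d / 2 != 0 by lra.
have supA : has_sup A.
  by split; [exists (q (d / 2) - K * `|d / 2|), (d / 2)|
             exists (q (d / 2) + K * `|d / 2|); exact: ub].
exists (sup A) => t t0 td; rewrite ler_norml; apply/andP; split.
  have : sup A <= q t + K * `|t| by apply: sup_le_ub (ub t t0 td); exact: supA.1.
  by lra.
have : q t - K * `|t| <= sup A by apply: sup_upper_bound => //; exists t.
by lra.
Qed.

Lemma diff_quot_approx l t g v x eps : t != 0 -> `|g x - v x| <= eps ->
  `|g (x + t *: e l) - v (x + t *: e l)| <= eps ->
  `|diff_quot l t g x - diff_quot l t v x| <= 2 / `|t| * eps.
Proof.
move=> t0 h1 h2; rewrite /diff_quot -mulrBr normrM normfV -mulrA mulrCA.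
rewrite ler_pM2l ?invr_gt0 ?normr_gt0//.
rewrite (_ : _ - _ = (g (x + t *: e l) - v (x + t *: e l)) - (g x - v x)); last ring.
by rewrite (le_trans (ler_normB _ _))//; lra.
Qed.

Lemma bounded_approx a r g v M eps : bounded_by a r g M ->
  (forall x, cube a r x -> `|g x - v x| <= eps) -> bounded_by a r v (M + eps).
Proof.
move=> gM gv x ax; rewrite -(subrK (g x) (v x)) addrC.
by rewrite (le_trans (ler_normD _ _))// lerD ?gM// distrC gv.
Qed.

(** The rate of convergence of difference quotients of a harmonic function depends
only on its supremum, so it is inherited by uniform limits, where it yields
the existence of the derivative. *)
Lemma harmonic_limit_diff_quot_estimate a r M l g : 0 < r -> 0 < M -> harmonic_limit a r g ->
  bounded_by a r g M ->
  derivable g a (e l) /\ (forall t, t != 0 -> `|t| < r / 4 ->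
  `|diff_quot l t g a - 'D_(e l) g a| <= 8 * kappa ^+ 2 * M / r ^+ 2 * `|t|).
Proof.
move=> r0 M0 Ag gM; have k0 := @kappa_gt0 R n.
have aa : cube a (r / 4) a by apply: cube_center; lra.
have line s : `|s| < r / 4 -> cube a r (a + s *: e l).
  move=> st; apply: (sub_cube _ (cube_shift l aa (ltW st))); lra.
have ar : cube a r a by exact: cube_center.
pose K0 := 8 * kappa ^+ 2 / r ^+ 2.
have K00 : 0 <= K0 by rewrite divr_ge0 ?sqr_ge0// mulr_ge0// sqr_ge0.
have cauchy s t : s != 0 -> t != 0 -> `|s| < r / 4 -> `|t| < r / 4 ->
    `|diff_quot l s g a - diff_quot l t g a| <= K0 * M * (`|s| + `|t|).
  move=> s0 t0 sr tr.
  apply: (@le_addM_eps _ _ (K0 * (`|s| + `|t|) + 2 / `|s| + 2 / `|t|)).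
    have h1 := mulr_ge0 K00 (addr_ge0 (normr_ge0 s) (normr_ge0 t)).
    have h2 u : 0 <= 2 / `|u| by rewrite divr_ge0.
    by apply: addr_ge0 => //; exact: addr_ge0.
  move=> eps eps0; have [v Hv gv] := Ag _ eps0.
  have vM := bounded_approx gM gv.
  have Me : 0 < M + eps by rewrite addr_gt0.
  have := C2harmonic_diff_quot_estimate l r0 Me Hv vM s0 sr.
  have := C2harmonic_diff_quot_estimate l r0 Me Hv vM t0 tr.
  have := diff_quot_approx s0 (gv _ ar) (gv _ (line _ sr)).
  have := diff_quot_approx t0 (gv _ ar) (gv _ (line _ tr)).
  rewrite (_ : 8 * kappa ^+ 2 * (M + eps) / r ^+ 2 = K0 * (M + eps)); last first.
    by rewrite /K0; field; lra.
  move: (diff_quot l s g a) (diff_quot l t g a) (diff_quot l s v a) (diff_quot l t v a) ('D__ _ _).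
  move=> A B C D E.
  rewrite !ler_norml => /andP[? ?] /andP[? ?] /andP[? ?] /andP[? ?].
  by apply/andP; split; lra.
have [L hL] := diff_quot_cauchy_limit (ltac:(lra) : 0 < r / 4) cauchy.
have KE t : 8 * kappa ^+ 2 * M / r ^+ 2 * `|t| = K0 * M * `|t|.
  by rewrite /K0; field; lra.
have KM0 : 0 <= K0 * M by rewrite mulr_ge0// ltW.
have D : is_derive a (e l) g L.
  apply/is_derive_diff_quotP => eps eps0.
  exists (Num.min (r / 4) (eps / (K0 * M + 1))).
    by rewrite lt_min !divr_gt0//; lra.
  move=> t t0; rewrite lt_min => /andP[tr te].
  apply: (le_trans (hL t t0 tr)).
  move: te; rewrite ltr_pdivlMr; last lra.
  by have := normr_ge0 t; nra.
have [D1 D2] := D; split => // t t0 tr; rewrite KE D2.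
exact: hL.
Qed.

Lemma harmonic_limit_sub a r b s g : cube b s `<=` cube a r -> harmonic_limit a r g -> harmonic_limit b s g.
Proof.
move=> sub Ag eps /Ag[v Hv gv]; exists v; first exact: (C2harmonic_sub sub Hv).
by move=> x /sub; exact: gv.
Qed.

Lemma bounded_sub a r b s g M : cube b s `<=` cube a r ->
  bounded_by a r g M -> bounded_by b s g M.
Proof. by move=> sub gM x /sub; exact: gM. Qed.

(** A derivative is within O(t) of its difference quotient, for g as for the
approximating v, and the quotients for a fixed t are as close as g and v are. *)
Lemma harmonic_limit_gradient_estimate a r M l g : 0 < r -> 0 < M -> harmonic_limit a r g ->
  bounded_by a r g M -> `|'D_(e l) g a| <= kappa * M / r.
Proof.
move=> r0 M0 Ag gM; have k0 := @kappa_gt0 R n.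
have aa : cube a (r / 4) a by apply: cube_center; lra.
have ar : cube a r a by exact: cube_center.
pose K0 := 8 * kappa ^+ 2 / r ^+ 2.
have K00 : 0 <= K0 by rewrite divr_ge0 ?sqr_ge0// mulr_ge0// sqr_ge0.
have step t : 0 < t -> t < r / 4 ->
    `|'D_(e l) g a| <= kappa * M / r + 2 * K0 * M * t.
  move=> t0 tr; have tn : t != 0 by rewrite gt_eqF.
  have nt : `|t| = t by exact: gtr0_norm.
  have at' : cube a r (a + t *: e l).
    by apply: (sub_cube _ (cube_shift l aa (lexx _))); lra.
  apply: (@le_addM_eps _ _ (kappa / r + 2 / t + K0 * t)).
    have h1 := mulr_ge0 K00 (ltW t0).
    have h2 : 0 <= 2 / t by rewrite divr_ge0// ltW.
    have h3 : 0 <= kappa / r by rewrite divr_ge0// ltW.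
    by apply: addr_ge0 => //; exact: addr_ge0.
  move=> eps eps0; have [v Hv gv] := Ag _ eps0.
  have vM := bounded_approx gM gv.
  have Me : 0 < M + eps by rewrite addr_gt0.
  have tr' : `|t| < r / 4 by rewrite nt.
  have := C2harmonic_diff_quot_estimate l r0 Me Hv vM tn tr'.
  have := (harmonic_limit_diff_quot_estimate l r0 M0 Ag gM).2 t tn tr'.
  have := diff_quot_approx tn (gv _ ar) (gv _ at').
  have := gradient_estimate l Me r0 Hv vM.
  rewrite nt.
  rewrite (_ : 8 * kappa ^+ 2 * (M + eps) / r ^+ 2 = K0 * (M + eps)); last first.
    by rewrite /K0; field; lra.
  rewrite (_ : 8 * kappa ^+ 2 * M / r ^+ 2 = K0 * M); last first.
    by rewrite /K0; field; lra.
  rewrite (_ : kappa * (M + eps) / r = kappa * M / r + kappa / r * eps); last first.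
    by field; lra.
  move: (diff_quot l t g a) (diff_quot l t v a) ('D__ g _) ('D__ v _).
  move=> A B C D.
  rewrite !ler_norml => /andP[? ?] /andP[? ?] /andP[? ?] /andP[? ?].
  by apply/andP; split; lra.
apply/ler_addgt0Pr => eps eps0.
pose t := Num.min (r / 8) (eps / (2 * K0 * M + 1)).
have KM : 0 <= K0 * M by rewrite mulr_ge0// ltW.
have t0 : 0 < t by rewrite lt_min !divr_gt0//; lra.
have tr : t < r / 4 by rewrite /t gt_min; apply/orP; left; lra.
apply: (le_trans (step t t0 tr)); rewrite lerD2l.
have : t <= eps / (2 * K0 * M + 1) by rewrite ge_min lexx orbT.
rewrite ler_pdivlMr; last lra.
by nra.
Qed.

End UniformLimits.

(** * Locally harmonic functions *)

Section LocallyHarmonic.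
Context {R : realType} {n : nat}.
Implicit Types (a b x p : 'rV[R]_n) (r s t M eps : R) (l k : 'I_n).
Implicit Types (U : set 'rV[R]_n) (f g v w : 'rV[R]_n -> R).
Notation e := unit_vec.
Notation kappa := (@kappa R n).
#[local] Opaque derive derivable.

(** The derivative is uniformly close to the difference quotient of step t, which
is itself approximated by the quotients of harmonic functions. *)
Lemma harmonic_limit_derive a r M l g : 0 < r -> 0 < M -> harmonic_limit a r g ->
  bounded_by a r g M ->
  harmonic_limit a (r / 2) ('D_(e l) g) /\
  bounded_by a (r / 2) ('D_(e l) g) (kappa * M / (r / 2)).
Proof.
move=> r0 M0 Ag gM; have k0 := @kappa_gt0 R n.
have rec b : cube a (r / 2) b -> cube b (r / 2) `<=` cube a r.
  by move=> ab; apply: (cube_recenter ab); lra.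
split; last first.
  move=> b ab; apply: harmonic_limit_gradient_estimate => //; first lra.
    exact: harmonic_limit_sub (rec b ab) Ag.
  exact: bounded_sub (rec b ab) gM.
pose K := 8 * kappa ^+ 2 * M / (r / 2) ^+ 2.
have K0 : 0 <= K by rewrite divr_ge0 ?sqr_ge0// !mulr_ge0// ltW.
move=> eps eps0.
(* The step t makes the quotient within eps / 2 of the derivative; replacing g by v
   in the quotient costs 2 / t times their distance, hence the precision eps t / 4. *)
pose t := Num.min (r / 16) (eps / (2 * K + 1)).
have t0 : 0 < t by rewrite lt_min !divr_gt0//; lra.
have tr : t <= r / 16 by rewrite ge_min lexx.
have tn : t != 0 by rewrite gt_eqF.
have nt : `|t| = t by exact: gtr0_norm.
have Kt : K * t <= eps / 2.
  have : t <= eps / (2 * K + 1) by rewrite ge_min lexx orbT.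
  by rewrite ler_pdivlMr; [nra|lra].
have e4 : 0 < eps * t / 4 by rewrite divr_gt0// mulr_gt0.
have [v Hv gv] := Ag _ e4.
exists (diff_quot l t v).
  by apply: (@C2harmonic_quot _ _ a r) => //; rewrite ?nt; lra.
move=> b ab.
have r2 : 0 < r / 2 by lra.
have tr' : `|t| < r / 2 / 4 by rewrite nt; lra.
have [_ /(_ t tn tr')] := harmonic_limit_diff_quot_estimate l r2 M0 (harmonic_limit_sub (rec b ab) Ag)
  (bounded_sub (rec b ab) gM).
rewrite -/K nt => h1.
have ab' : cube a r b by apply: sub_cube ab; lra.
have bt : cube a r (b + t *: e l).
  by apply: (sub_cube _ (cube_shift l ab (lexx _))); rewrite nt; lra.
have := diff_quot_approx tn (gv _ ab') (gv _ bt).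
rewrite nt (_ : 2 / t * (eps * t / 4) = eps / 2); last by field; rewrite gt_eqF.
move: h1; move: (diff_quot l t g b) (diff_quot l t v b) ('D__ g _) => A B C.
rewrite !ler_norml => /andP[? ?] /andP[? ?].
by apply/andP; split; lra.
Qed.

Lemma harmonic_limit_continuous a r g x : 0 < r -> harmonic_limit a r g -> cube a r x ->
  {for x, continuous g}.
Proof.
move=> r0 Ag ax; have FF : Filter (nbhs x) := nbhs_filter x.
apply/cvgrPdist_le => eps eps0.
have e3 : 0 < eps / 3 by rewrite divr_gt0.
have [v Hv gv] := Ag _ e3; have [cv _ _] := Hv x ax.
have near1 := near_cube r0 ax.
have near2 := proj1 (@cvgrPdist_le _ _ _ _ FF v (v x)) cv _ e3.
move: near1 near2; apply: (@filterS2 _ _ FF) => y ay vy.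
have := gv _ ax; have := gv _ ay; move: vy.
rewrite !ler_norml => /andP[? ?] /andP[? ?] /andP[? ?].
by apply/andP; split; lra.
Qed.

Lemma harmonic_limit_lin a r c d f g : 0 < r -> harmonic_limit a r f -> harmonic_limit a r g ->
  harmonic_limit a r (fun x => c * f x + d * g x).
Proof.
move=> r0 Af Ag eps eps0.
pose K := `|c| + `|d| + 1.
have K0 : 0 < K by have := normr_ge0 c; have := normr_ge0 d; rewrite /K; lra.
have [v Hv fv] := Af _ (divr_gt0 eps0 K0).
have [w Hw gw] := Ag _ (divr_gt0 eps0 K0).
exists (fun x => c * v x + d * w x); first exact: (C2harmonic_lin _ _ (@cube_open _ _ a r r0)).
move=> x ax.
rewrite (_ : _ - _ = c * (f x - v x) + d * (g x - w x)); last by ring.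
rewrite (le_trans (ler_normD _ _))// !normrM.
have h1 := ler_wpM2l (normr_ge0 c) (fv x ax).
have h2 := ler_wpM2l (normr_ge0 d) (gw x ax).
have E : eps = (`|c| + `|d|) * (eps / K) + eps / K by rewrite /K; field; exact: lt0r_neq0.
have : 0 < eps / K by rewrite divr_gt0.
by lra.
Qed.

Lemma bounded_lin a r c d f g M N : bounded_by a r f M -> bounded_by a r g N ->
  bounded_by a r (fun x => c * f x + d * g x) (`|c| * M + `|d| * N).
Proof.
move=> fM gN x ax; rewrite (le_trans (ler_normD _ _))// !normrM.
by rewrite lerD// ler_wpM2l// ?fM ?gN.
Qed.

Lemma harmonic_limit_shift a r s t l g : s + `|t| <= r -> harmonic_limit a r g ->
  harmonic_limit a s (fun x => g (x + t *: e l)).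
Proof.
move=> str Ag eps /Ag[v Hv gv]; exists (fun x => v (x + t *: e l)).
  apply: (C2harmonic_sub _ (@C2harmonic_shift _ _ _ (t *: e l) _ Hv)) => x ax /=.
  exact: (sub_cube str (cube_shift l ax (lexx _))).
by move=> x ax; exact/gv/(sub_cube str (cube_shift l ax (lexx _))).
Qed.

(** Being a uniform limit of harmonic functions is stable under differentiation
by construction, which is why it replaces harmonicity; [loc_harmonic_laplacian]
shows that both notions agree. *)
Definition loc_harmonic a g := exists r M, [/\ 0 < r, 0 < M, harmonic_limit a r g & bounded_by a r g M].

Lemma loc_harmonic_derive a l g : loc_harmonic a g -> loc_harmonic a ('D_(e l) g).
Proof.
move=> [r [M [r0 M0 Ag gM]]]; have [A1 A2] := harmonic_limit_derive l r0 M0 Ag gM.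
have k0 := @kappa_gt0 R n.
exists (r / 2), (kappa * M / (r / 2)); split => //; first lra.
by rewrite divr_gt0 ?mulr_gt0//; lra.
Qed.

Lemma loc_harmonic_derivable a l g : loc_harmonic a g -> derivable g a (e l).
Proof.
by move=> [r [M [r0 M0 Ag gM]]]; have [] := harmonic_limit_diff_quot_estimate l r0 M0 Ag gM.
Qed.

Lemma loc_harmonic_continuous a g : loc_harmonic a g -> {for a, continuous g}.
Proof.
by move=> [r [M [r0 M0 Ag gM]]]; apply: (harmonic_limit_continuous r0 Ag); exact: cube_center.
Qed.

Lemma loc_harmonic_shrink a g r : loc_harmonic a g -> 0 < r -> exists s M,
  [/\ 0 < s <= r, 0 < M, harmonic_limit a s g & bounded_by a s g M].
Proof.
move=> [q [M [q0 M0 Ag gM]]] r0; exists (Num.min q r), M.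
have sub : cube a (Num.min q r) `<=` cube a q by apply: sub_cube; rewrite ge_min lexx.
split => //; first by rewrite lt_min q0 r0 ge_min lexx orbT.
  exact: harmonic_limit_sub sub Ag.
exact: bounded_sub sub gM.
Qed.

Lemma loc_harmonic_near a g : loc_harmonic a g -> exists2 r, 0 < r & forall x, cube a r x -> loc_harmonic x g.
Proof.
move=> [r [M [r0 M0 Ag gM]]]; exists (r / 2); first lra.
move=> x ax; have sub : cube x (r / 2) `<=` cube a r by apply: (cube_recenter ax); lra.
exists (r / 2), M; split => //; first lra.
  exact: harmonic_limit_sub sub Ag.
exact: bounded_sub sub gM.
Qed.

Lemma loc_harmonic_lin a c d f g : loc_harmonic a f -> loc_harmonic a g ->
  loc_harmonic a (fun x => c * f x + d * g x).
Proof.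
move=> [r [M [r0 M0 Af fM]]] /loc_harmonic_shrink/(_ r0)[s [N [/andP[s0 sr] N0 Ag gN]]].
have sub : cube a s `<=` cube a r by exact: sub_cube.
exists s, (`|c| * M + `|d| * N + 1); split => //.
- have := mulr_ge0 (normr_ge0 c) (ltW M0).
  by have := mulr_ge0 (normr_ge0 d) (ltW N0); lra.
- exact: (harmonic_limit_lin _ _ s0 (harmonic_limit_sub sub Af) Ag).
- move=> x ax.
  by have := bounded_lin c d (bounded_sub sub fM) gN ax; lra.
Qed.

Lemma loc_harmonic_eq a r f g : 0 < r -> (forall x, cube a r x -> f x = g x) ->
  loc_harmonic a f -> loc_harmonic a g.
Proof.
move=> r0 fg /loc_harmonic_shrink/(_ r0)[s [M [/andP[s0 sr] M0 Af fM]]].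
have fg' x : cube a s x -> f x = g x by move=> ax; apply: fg; exact: sub_cube ax.
exists s, M; split => //; last by move=> x ax; rewrite -fg'//; exact: fM.
move=> eps /Af[v Hv fv]; exists v => // x ax; rewrite -fg'//; exact: fv.
Qed.

Lemma sum_sub0 (A B W : 'I_n -> R) : (forall l, W l = 1 * A l + -1 * B l) ->
  \sum_l B l = 0 -> \sum_l A l = \sum_l W l.
Proof.
move=> WE B0; rewrite (eq_bigr _ (fun l _ => WE l)) big_split/= -!mulr_sumr B0.
by rewrite mul1r mulr0 addr0.
Qed.

(** If v is harmonic and within eps of g, then w = g - v is again a limit of
harmonic functions, and two gradient estimates bound its second derivatives by
a multiple of eps. *)
Lemma loc_harmonic_laplacian a g : loc_harmonic a g -> \sum_l 'D_(e l) ('D_(e l) g) a = 0.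
Proof.
move=> [r [M [r0 M0 Ag gM]]]; have k0 := @kappa_gt0 R n.
have r2 : 0 < r / 2 by lra.
apply/eqP; rewrite -normr_le0.
pose K := kappa * (kappa / (r / 2)) / (r / 2).
have K0 : 0 <= K by rewrite !(divr_ge0, mulr_ge0)// ltW.
apply: (@le_addM_eps _ _ _ (n%:R * K)); first by rewrite mulr_ge0.
move=> eps eps0; rewrite add0r.
have [v Hv gv] := Ag _ eps0.
have oU := @cube_open _ _ a _ r2.
have sub : cube a (r / 2) `<=` cube a r by apply: sub_cube; lra.
pose w x := 1 * g x + -1 * v x.
have Av : harmonic_limit a r v.
  by move=> d d0; exists v => // x ax; rewrite subrr normr0 ltW.
have Aw : harmonic_limit a r w := harmonic_limit_lin 1 (-1) r0 Ag Av.
have wM : bounded_by a r w eps.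
  by move=> x ax; rewrite /w mul1r mulN1r; exact: gv.
have dg x l : cube a (r / 2) x -> derivable g x (e l).
  move=> ax; have sx : cube x (r / 2) `<=` cube a r by apply: (cube_recenter ax); lra.
  by have [] := harmonic_limit_diff_quot_estimate l r2 M0 (harmonic_limit_sub sx Ag) (bounded_sub sx gM).
have aa : cube a (r / 2) a by exact: cube_center.
have dw l : 'D_(e l) ('D_(e l) w) a =
    1 * 'D_(e l) ('D_(e l) g) a + -1 * 'D_(e l) ('D_(e l) v) a.
  have E x : cube a (r / 2) x -> 'D_(e l) w x = 1 * 'D_(e l) g x + -1 * 'D_(e l) v x.
    move=> ax; have [_ ->//] := derive_lin 1 (-1) (dg x l ax)
      (C2harmonic_derivable (l := l) Hv (sub _ ax)).
  rewrite (derive_eq_on _ oU aa E).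
  have [A1 A2] := harmonic_limit_derive l r0 M0 Ag gM.
  have kM : 0 < kappa * M / (r / 2) by rewrite divr_gt0 ?mulr_gt0.
  have [d1 _] := harmonic_limit_diff_quot_estimate l r2 kM A1 A2.
  have [_ dv _] := Hv a (sub _ aa).
  by have [_ ->] := derive_lin 1 (-1) d1 (dv l).2.
have H l : `|'D_(e l) ('D_(e l) w) a| <= K * eps.
  have [A1 A2] := harmonic_limit_derive l r0 eps0 Aw wM.
  have kM : 0 < kappa * eps / (r / 2) by rewrite divr_gt0 ?mulr_gt0.
  have := harmonic_limit_gradient_estimate l r2 kM A1 A2.
  by move=> /le_trans; apply; rewrite /K le_eqVlt; apply/orP; left; apply/eqP; field; lra.
have -> : \sum_l 'D_(e l) ('D_(e l) g) a = \sum_l 'D_(e l) ('D_(e l) w) a.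
  have [_ _ Lv] := Hv a (sub _ aa).
  exact: sum_sub0 dw Lv.
rewrite (le_trans (ler_norm_sum _ _ _))//.
rewrite (le_trans (ler_sum _ (fun l _ => H l)))//.
by rewrite sumr_const card_ord -[_ *+ n]mulr_natl mulrA.
Qed.

Lemma loc_harmonic_C2harmonic U g : (forall x, U x -> loc_harmonic x g) -> C2harmonic U g.
Proof.
move=> Hg x /Hg gx; split; first exact: loc_harmonic_continuous.
  by move=> l; split; apply: loc_harmonic_derivable => //; exact: loc_harmonic_derive.
exact: loc_harmonic_laplacian.
Qed.

(** The difference quotients in the direction l converge to D_l g at the rate |t|
uniformly near a, so by the gradient estimate their derivatives in the
direction k, which are difference quotients of D_k g, converge as well. *)
Lemma loc_harmonic_schwarz a l k g : loc_harmonic a g ->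
  'D_(e k) ('D_(e l) g) a = 'D_(e l) ('D_(e k) g) a.
Proof.
move=> [r [M [r0 M0 Ag gM]]]; have k0 := @kappa_gt0 R n.
have r2 : 0 < r / 2 by lra.
have r4 : 0 < r / 4 by lra.
have aa : cube a (r / 4) a by exact: cube_center.
have sub : cube a (r / 2) `<=` cube a r by apply: sub_cube; lra.
have sub4 : cube a (r / 4) `<=` cube a (r / 2) by apply: sub_cube; lra.
have rec x : cube a (r / 2) x -> cube x (r / 2) `<=` cube a r.
  by move=> ax; apply: (cube_recenter ax); lra.
have dg x i : cube a (r / 2) x -> derivable g x (e i).
  move=> /rec sx.
  by have [] := harmonic_limit_diff_quot_estimate i r2 M0 (harmonic_limit_sub sx Ag) (bounded_sub sx gM).
have [A1 A2] := harmonic_limit_derive l r0 M0 Ag gM.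
pose K := 8 * kappa ^+ 2 * M / (r / 2) ^+ 2.
have K0 : 0 <= K by rewrite divr_ge0 ?sqr_ge0// !mulr_ge0// ltW.
suff [_ -> //] : is_derive a (e l) ('D_(e k) g) ('D_(e k) ('D_(e l) g) a).
apply/is_derive_diff_quotP => eps eps0.
pose C := kappa * (K + 1) / (r / 4).
have C0 : 0 < C by rewrite divr_gt0 ?mulr_gt0//; lra.
exists (Num.min (r / 8) (eps / C)); first by rewrite lt_min; apply/andP; split; [lra|exact: divr_gt0].
move=> t t0; rewrite lt_min => /andP[tr te].
have nt0 : 0 < `|t| by rewrite normr_gt0.
pose q x := t^-1 * g (x + t *: e l) + - t^-1 * g x.
pose w x := 1 * q x + -1 * 'D_(e l) g x.
have qE x : q x = diff_quot l t g x by rewrite /q /diff_quot; ring.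
have Aq : harmonic_limit a (r / 4) q.
  apply: harmonic_limit_lin => //; first by apply: harmonic_limit_shift Ag; lra.
  by apply: harmonic_limit_sub Ag => x ax; exact/sub/sub4.
have Aw : harmonic_limit a (r / 4) w by apply: harmonic_limit_lin => //; exact: harmonic_limit_sub sub4 A1.
have wM : bounded_by a (r / 4) w ((K + 1) * `|t|).
  move=> x /sub4/rec ax; rewrite /w qE mul1r mulN1r.
  have tr' : `|t| < r / 2 / 4 by lra.
  have := (harmonic_limit_diff_quot_estimate l r2 M0 (harmonic_limit_sub ax Ag) (bounded_sub ax gM)).2 t t0 tr'.
  by rewrite -/K; lra.
have := harmonic_limit_gradient_estimate k r4 (mulr_gt0 (ltac:(lra) : 0 < K + 1) nt0) Aw wM.
have at' : cube a (r / 2) (a + t *: e l).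
  by apply: (sub_cube _ (cube_shift l aa (lexx _))); lra.
have d1 := derivable_shift_arg (dg _ k at').
have [d2 e2] := derive_lin t^-1 (- t^-1) d1 (dg a k (sub4 _ aa)).
have kM : 0 < kappa * M / (r / 2) by rewrite divr_gt0 ?mulr_gt0.
have [d3 _] := harmonic_limit_diff_quot_estimate k r2 kM A1 A2.
have [_ ->] := derive_lin 1 (-1) d2 d3.
rewrite e2 (congr1 (@^~ a) (derive_shift_arg g (t *: e l) (e k))).
rewrite mul1r mulN1r mulNr -mulrBr => /le_trans; apply.
have CE (c : R) : kappa * (c * `|t|) / (r / 4) = kappa * c / (r / 4) * `|t|.
  by field; lra.
rewrite CE -/C.
by move: te; rewrite ltr_pdivlMr// mulrC => /ltW.
Qed.

End LocallyHarmonic.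

(** * Averages over an interval *)

Section Average.
Context {R : realType}.
Notation mu := (@lebesgue_measure R).
Implicit Types (c d h s t L : R) (g f : R -> R).
#[local] Opaque derive derivable.

Definition avg h g : R := h^-1 * (\int[mu]_(t in `[0, h]) g t).

Definition cont_on (i : interval R) g := forall t, t \in i -> {for t, continuous g}.

Lemma cont_on_within i g : cont_on i g -> {within [set` i], continuous g}.
Proof.
by move=> cg; apply: continuous_in_subspaceT => t; rewrite inE => /cg.
Qed.

Lemma cont_on_integrable (a b : R) g : cont_on `[a, b] g ->
  mu.-integrable `[a, b] (EFin \o g).
Proof.
move=> cg; apply: continuous_compact_integrable; first exact: segment_compact.
exact: cont_on_within.
Qed.

Lemma avg_lin h c d f g : cont_on `[0, h] f -> cont_on `[0, h] g ->
  avg h (fun t => c * f t + d * g t) = c * avg h f + d * avg h g.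
Proof.
move=> cf cg; rewrite /avg.
have If := cont_on_integrable cf; have Ig := cont_on_integrable cg.
have cst_cont (k : R) u : cont_on `[0, h] u -> cont_on `[0, h] (fun t => k * u t).
  by move=> cu t th; exact: (cvgM (cvg_cst k) (cu t th)).
rewrite RintegralD//; last 2 first.
- exact: cont_on_integrable (cst_cont c _ cf).
- exact: cont_on_integrable (cst_cont d _ cg).
by rewrite !RintegralZl//; ring.
Qed.

Lemma avg_cst h c : 0 < h -> avg h (fun=> c) = c.
Proof.
move=> h0; rewrite /avg Rintegral_cst//= lebesgue_measure_itv/= lte_fin h0/=.
by rewrite subr0 mulrCA mulVf ?mulr1// gt_eqF.
Qed.

Lemma avg_close h g c d : 0 < h -> cont_on `[0, h] g ->
  (forall t, t \in `[0, h] -> `|g t - c| <= d) -> `|avg h g - c| <= d.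
Proof.
move=> h0 cg gc.
have cc (k : R) : cont_on `[0, h] (fun=> k) by move=> t _; exact: cvg_cst.
have -> : avg h g - c = avg h (fun t => g t - c).
  transitivity (1 * avg h g + -1 * avg h (fun=> c)).
    by rewrite avg_cst// mul1r mulN1r.
  rewrite -(avg_lin _ _ cg (cc c)).
  by congr avg; apply/funext => t; rewrite mul1r mulN1r.
have cgc : cont_on `[0, h] (fun t => g t - c).
  by move=> t th; exact: (cvgB (cg t th) (cvg_cst c)).
have hi : `|h^-1| = h^-1 by rewrite ger0_norm ?invr_ge0 ?ltW.
rewrite /avg normrM hi ler_pdivrMl//.
apply: (le_trans (le_normr_Rintegral _ (cont_on_integrable cgc))) => //.
have E : h * d = \int[mu]_(t in `[0, h]) d.
  by rewrite Rintegral_cst//= lebesgue_measure_itv/= lte_fin h0/= subr0 mulrC.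
rewrite E; apply: le_Rintegral => //.
- apply: cont_on_integrable => t th.
  exact: (continuous_comp (cgc t th) (@norm_continuous _ _ _)).
- exact: cont_on_integrable.
Qed.

Lemma avg_FTC2 h g (G : R -> R) : 0 < h -> cont_on `[0, h] g ->
  (forall t, t \in `[0, h] -> is_derive t (1:R) G (g t)) ->
  avg h g = h^-1 * (G h - G 0).
Proof.
move=> h0 cg dG; rewrite /avg; congr (_ * _).
have cG t : t \in `[0, h] -> {for t, continuous G}.
  by move=> /dG[dGt _]; apply/differentiable_continuous/derivable1_diffP.
have H : derivable_oo_LRcontinuous G 0 h.
  split.
  - by move=> t th; have [] := dG t (subset_itv_oo_cc th).
  - by apply: cvg_at_right_filter; apply: cG; rewrite in_itv/= lexx ltW.
  - by apply: cvg_at_left_filter; apply: cG; rewrite in_itv/= lexx ltW.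
rewrite /Rintegral (@continuous_FTC2 _ g G 0 h h0 (cont_on_within cg) H)//.
by move=> t th; rewrite derive1E; have [_] := dG t (subset_itv_oo_cc th).
Qed.

Lemma primitive (a b : R) g : a < b -> cont_on `[a, b] g ->
  exists G : R -> R, forall t, t \in `]a, b[ -> is_derive t (1:R) G (g t).
Proof.
move=> ab cg; exists (fun x => \int[mu]_(t in `[a, x]) g t) => t.
rewrite in_itv/= => /andP[at' tb].
have [D1 D2] := @continuous_FTC1_closed _ g a t b tb (cont_on_integrable cg) at'
  (cg t ltac:(by rewrite in_itv/= !ltW)).
by split; [exact: D1|rewrite -derive1E].
Qed.

(** For a primitive G of g the average is the difference quotient
(G (s + h) - G s) / h. *)
Lemma avg_translate h d g : 0 < h -> 0 < d -> cont_on `[- d, h + d] g ->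
  is_derive (0:R) (1:R) (fun s => avg h (fun t => g (s + t))) (h^-1 * (g h - g 0)).
Proof.
move=> h0 d0 cg.
have [G dG] := primitive (ltac:(lra) : - d < h + d) cg.
have dGs s t : `|s| < d -> t \in `[0, h] -> is_derive (s + t) (1:R) G (g (s + t)).
  rewrite ltr_norml => /andP[s1 s2]; rewrite in_itv/= => /andP[t1 t2].
  by apply: dG; rewrite in_itv/=; apply/andP; split; lra.
have E s : `|s| < d -> h^-1 * (G (s + h) - G s) = avg h (fun t => g (s + t)).
  move=> sd.
  have C1 : cont_on `[0, h] (fun t => g (s + t)).
    move=> t th; apply: (@continuous_comp _ _ _ (fun t => s + t) g).
      exact: (cvgD (cvg_cst s) cvg_id).
    move: sd th; rewrite ltr_norml in_itv/= => /andP[s1 s2] /andP[t1 t2].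
    by apply: cg; rewrite in_itv/=; apply/andP; split; lra.
  have C2 t : t \in `[0, h] -> is_derive t (1:R) (fun t => G (s + t)) (g (s + t)).
    move=> th; have dGst := dGs s t sd th.
    have d0' : is_derive t (1:R) (fun t => s + t) 1.
      rewrite -[X in is_derive _ _ _ X]add0r.
      exact: (is_deriveD (is_derive_cst _ _ _) (is_derive_id _ _)).
    have := @is_derive1_comp _ G (fun t => s + t) t _ 1 dGst d0'; rewrite mulr1; exact.
  by rewrite (avg_FTC2 h0 C1 C2) addr0.
pose I : set R := [set s | `|s| < d].
have oI : open I.
  rewrite (_ : I = ball (0:R) d); first exact: ball_open.
  by apply/seteqP; split => t; rewrite /I/ball/= sub0r normrN.
have I0 : I 0 by rewrite /I/= normr0.
suff H : is_derive (0:R) (1:R) (fun s => h^-1 * (G (s + h) - G s)) (h^-1 * (g h - g 0)).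
  apply: near_eq_is_derive H.
  by have := open_nbhs_nbhs (conj oI I0); apply: filterS => s; exact: E.
have d1 : is_derive (0 + h) (1:R) G (g h).
  have h1 : h \in `[0, h] by rewrite in_itv/= lexx ltW.
  by have := dGs 0 h I0 h1; rewrite add0r.
have d2 : is_derive (0:R) (1:R) G (g 0).
  have h1 : 0 \in `[0, h] by rewrite in_itv/= lexx ltW.
  by have := dGs 0 0 I0 h1; rewrite add0r.
have d3 : is_derive (0:R) (1:R) (fun s => G (s + h)) (g h).
  have d0' : is_derive (0:R) (1:R) (fun s => s + h) 1.
    rewrite -[X in is_derive _ _ _ X]addr0.
    exact: (is_deriveD (is_derive_id _ _) (is_derive_cst _ _ _)).
  have := @is_derive1_comp _ G (fun s => s + h) 0 (g h) 1 d1 d0'; rewrite mulr1; exact.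
exact: (is_deriveZ h^-1 (is_deriveB d3 d2)).
Qed.

Lemma avg_param_derive h d L (f df : R -> R -> R) : 0 < h -> 0 < d -> 0 <= L ->
  (forall s, `|s| < d -> cont_on `[0, h] (f s)) ->
  (forall s t, `|s| < d -> t \in `[0, h] ->
     is_derive s (1:R) (f ^~ t) (df s t) /\ `|df s t| <= L) ->
  is_derive (0:R) (1:R) (fun s => avg h (f s)) (avg h (df 0)).
Proof.
move=> h0 d0 L0 cf ddf.
have Id s : (`]-d, d[%classic : set R) s -> `|s| < d by rewrite /= in_itv/= -ltr_norml.
have I0 : (`]-d, d[%classic : set R) 0 by rewrite /= in_itv/=; apply/andP; split; lra.
have E s t : `|s| < d -> t \in `[0, h] -> derive1 (f ^~ t) s = df s t.
  by move=> sd th; rewrite derive1E; have [[_ ->]] := ddf s t sd th.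
have H1 := @derivable_under_integral _ _ _ mu f `[0, h]%classic
  (measurable_itv _) 0 (- d) d I0 (fun s si => cont_on_integrable (cf s (Id s si)))
  (fun s t si th => let: conj (DeriveDef a _) _ := ddf s t (Id s si) th in a)
  (fun=> L) (fun=> L0).
have H2 := @differentiation_under_integral _ _ _ mu f `[0, h]%classic
  (measurable_itv _) 0 (- d) d I0 (fun s si => cont_on_integrable (cf s (Id s si)))
  (fun s t si th => let: conj (DeriveDef a _) _ := ddf s t (Id s si) th in a)
  (fun=> L) (fun=> L0).
have iL : mu.-integrable `[0, h] (EFin \o (fun=> L)).
  by apply: cont_on_integrable => t _; exact: cvg_cst.
have bL s t : (`]-d, d[%classic : set R) s -> (`[0, h]%classic : set R) t ->
    `|partial1of2 f s t| <= L.
  by move=> /Id sd th; rewrite /partial1of2 E//; have [_] := ddf s t sd th.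
have {}H1 := H1 iL bL; have {}H2 := H2 iL bL.
have D : is_derive (0:R) (1:R) (fun s => \int[mu]_(t in `[0, h]) f s t)
    (\int[mu]_(t in `[0, h]) df 0 t).
  split; first exact: H1.
  rewrite -derive1E H2; apply: eq_Rintegral => t /set_mem th.
  by rewrite /partial1of2 E// normr0.
exact: (is_deriveZ h^-1 D).
Qed.

Lemma avg_param_continuous h d L (f : R -> R -> R) : 0 < h -> 0 < d ->
  (forall s, `|s| < d -> cont_on `[0, h] (f s)) ->
  (forall s t, `|s| < d -> t \in `[0, h] ->
     {for s, continuous (f ^~ t)} /\ `|f s t| <= L) ->
  {for 0, continuous (fun s => avg h (f s))}.
Proof.
move=> h0 d0 cf cs.
have Id s : (`]-d, d[%classic : set R) s -> `|s| < d by rewrite /= in_itv/= -ltr_norml.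
have I0 : 0 \in (`]-d, d[%classic : set R) by rewrite inE/= in_itv/=; apply/andP; split; lra.
have iL : mu.-integrable `[0, h] (EFin \o (fun=> L)).
  by apply: cont_on_integrable => t _; exact: cvg_cst.
have H := @continuity_under_integral _ _ _ mu f `[0, h]%classic
  (measurable_itv _) (- d) d (fun s si => cont_on_integrable (cf s (Id s si))).
apply: (cvgM (cvg_cst _)); apply: (H _ (fun=> L)) => //.
- by apply: aeW => t th s /set_mem/Id sd; have [] := cs s t sd th.
- by move=> s /Id sd; apply: aeW => t th; have [] := cs s t sd th.
Qed.

End Average.

(** * Steklov averages *)

Section Lipschitz.
Context {R : realType} {n : nat}.
Implicit Types (a x y : 'rV[R]_n) (g : 'rV[R]_n -> R).
Notation e := unit_vec.
#[local] Opaque derive derivable.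

(** Moving from x to y one coordinate at a time stays in the cube, which is
convex, and each step is along an axis. *)
Lemma lipschitz_cube a (r L : R) g : 0 <= L ->
  (forall x l, cube a r x -> derivable g x (e l) /\ `|'D_(e l) g x| <= L) ->
  forall x y d, cube a r x -> cube a r y -> (forall i, `|y 0 i - x 0 i| <= d) ->
  `|g y - g x| <= n%:R * (L * d).
Proof.
move=> L0 dg x y d ax ay xyd.
(* The path from x to y that has changed the first k coordinates. *)
pose z k : 'rV[R]_n := \row_i (if (i < k)%N then y 0 i else x 0 i).
have az k : cube a r (z k) by move=> i; rewrite mxE; case: ifP.
have zS (k : 'I_n) : z k.+1 = z k + (y 0 k - x 0 k) *: e k.
  apply/rowP => i; rewrite coordDe !mxE ltnS leq_eqVlt.
  case: (eqVneq i k) => [->|ik]; first by rewrite ltnn eqxx /=; ring.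
  have -> : (i == k :> nat) = false by apply/negbTE.
  by rewrite mulr0 addr0.
have step (k : 'I_n) : `|g (z k.+1) - g (z k)| <= L * d.
  have zc c : 0 <= c <= 1 -> cube a r (z k + (c * (y 0 k - x 0 k)) *: e k).
    move=> /andP[c0 c1] i.
    rewrite coordDe; have [->|ik] := eqVneq i k; last by rewrite mulr0 addr0; exact: az.
    rewrite mulr1 mxE ltnn; have := ax k; have := ay k.
    rewrite !ltr_norml => /andP[h1 h2] /andP[h3 h4].
    have P (A B : R) : 0 < A -> 0 < B -> 0 < (1 - c) * A + c * B.
      by move=> A0 B0; have [c2|c2] := leP c (1 / 2); nra.
    apply/andP; split.
      by have := P _ _ (ltac:(lra) : 0 < x 0 k - a 0 k + r) (ltac:(lra) : 0 < y 0 k - a 0 k + r); lra.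
    by have := P _ _ (ltac:(lra) : 0 < r - (x 0 k - a 0 k)) (ltac:(lra) : 0 < r - (y 0 k - a 0 k)); lra.
  have [c cI E] := MVT_convex (fun c cI => (dg _ k (zc c cI)).1).
  rewrite zS E normrM mulrC.
  by apply: ler_pM => //; have [_] := dg _ k (zc c cI).
have -> : g y - g x = \sum_(0 <= k < n) (g (z k.+1) - g (z k)).
  rewrite telescope_sumr//.
  have -> : z n = y by apply/rowP => i; rewrite mxE ltn_ord.
  by have -> : z 0%N = x by apply/rowP => i; rewrite mxE.
rewrite big_mkord (le_trans (ler_norm_sum _ _ _))//.
rewrite (le_trans (ler_sum _ (fun k _ => step k)))//.
by rewrite sumr_const card_ord -[_ *+ n]mulr_natl.
Qed.

Lemma bounded_derive_continuous a (r L : R) g x : 0 < r -> 0 <= L ->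
  (forall x l, cube a r x -> derivable g x (e l) /\ `|'D_(e l) g x| <= L) ->
  cube a r x -> {for x, continuous g}.
Proof.
move=> r0 L0 dg ax; have FF : Filter (nbhs x) := nbhs_filter x.
apply/cvgrPdist_le => eps eps0.
pose d := eps / (n%:R * L + 1).
have nL : 0 <= n%:R * L by rewrite mulr_ge0.
have d0 : 0 < d by rewrite divr_gt0//; lra.
move: (near_cube r0 ax) (near_cube d0 (cube_center x d0)).
apply: filterS2 => y ay xy.
rewrite distrC (le_trans (lipschitz_cube L0 dg ax ay (fun i => ltW (xy i))))//.
have dE : d * (n%:R * L + 1) = eps by rewrite divfK// gt_eqF//; lra.
by rewrite mulrA; lra.
Qed.

End Lipschitz.

Section Steklov.
Context {R : realType} {n : nat}.
Implicit Types (a x y : 'rV[R]_n) (h L r : R) (k l : 'I_n).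
Implicit Types (f g p : 'rV[R]_n -> R).
Notation e := unit_vec.
#[local] Opaque derive derivable.

(** The one-sided Steklov average in the direction l. *)
Definition mean l h g x : R := avg h (fun t => g (x + t *: e l)).

(** Continuity along the lines of direction l, which is all that averaging in the
direction l requires and which a derivative in this direction ensures. *)
Definition line_cont a r l g := forall x, cube a r x ->
  {for (0:R), continuous (fun t : R => g (x + t *: e l))}.

Lemma line_cont_for a r l g x t : line_cont a r l g ->
  cube a r (x + t *: e l) -> {for t, continuous (fun t : R => g (x + t *: e l))}.
Proof.
move=> cg axt.
have E : (fun s : R => g (x + s *: e l)) =
    (fun s : R => g (x + t *: e l + s *: e l)) \o (fun s : R => s - t).
  by apply/funext => s /=; rewrite -addrA -scalerDl addrCA subrr addr0.
rewrite E; apply: continuous_comp.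
  exact: (cvgB cvg_id (cvg_cst t)).
by rewrite /= subrr; exact: cg.
Qed.

Lemma derivable_line_cont a r l g :
  (forall x, cube a r x -> derivable g x (e l)) -> line_cont a r l g.
Proof.
move=> dg x ax; apply/differentiable_continuous/derivable1_diffP.
by apply/derivable_line; rewrite scale0r addr0; exact: dg.
Qed.

Lemma continuous_line_cont a r l g :
  (forall x, cube a r x -> {for x, continuous g}) -> line_cont a r l g.
Proof.
move=> cg x ax; apply: (@continuous_comp _ _ _ (fun t : R => x + t *: e l) g).
  exact: (cvgD (cvg_cst x) (cvgZ cvg_id (cvg_cst (e l)))).
by rewrite scale0r addr0; exact: cg.
Qed.

Variables (a : 'rV[R]_n) (r h : R).
Hypotheses (r0 : 0 < r) (h0 : 0 < h).

Let shift2 x t l : cube a r x -> `|t| <= 2 * h -> cube a (r + 2 * h) (x + t *: e l).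
Proof. by move=> ax th; exact: cube_shift. Qed.

Let shift11 x s t k l : cube a r x -> `|s| <= h -> `|t| <= h ->
  cube a (r + 2 * h) (x + s *: e k + t *: e l).
Proof.
move=> ax sh th; have := cube_shift l (cube_shift k ax sh) th.
by rewrite -addrA (_ : h + h = 2 * h)//; ring.
Qed.

Let itv_norm t : t \in `[0, h] -> `|t| <= h.
Proof. by rewrite in_itv/= => /andP[t0 th]; rewrite ger0_norm. Qed.

Lemma mean_cont_on l g x : line_cont a (r + 2 * h) l g -> cube a r x ->
  cont_on `[0, h] (fun t : R => g (x + t *: e l)).
Proof.
move=> cg ax t /itv_norm th; apply: (line_cont_for cg).
by apply: shift2 => //; move: h0; lra.
Qed.

Lemma mean_FTC1 l g x : line_cont a (r + 2 * h) l g -> cube a r x ->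
  is_derive x (e l) (mean l h g) (diff_quot l h g x).
Proof.
move=> cg ax; apply/is_derive_line0.
have cg' : cont_on `[- h, h + h] (fun t => g (x + t *: e l)).
  move=> t; rewrite in_itv/= => /andP[t1 t2]; apply: (line_cont_for cg).
  by apply: shift2 => //; rewrite ler_norml; apply/andP; split; move: h0; lra.
have := avg_translate h0 h0 cg'; rewrite scale0r addr0.
congr (is_derive _ _ _ _); apply/funext => s; rewrite /mean; congr avg.
by apply/funext => t; rewrite -addrA -scalerDl.
Qed.

Lemma mean_FTC2 l g p x : line_cont a (r + 2 * h) l p ->
  (forall y, cube a (r + 2 * h) y -> is_derive y (e l) g (p y)) ->
  cube a r x -> mean l h p x = diff_quot l h g x.
Proof.
move=> cp dg ax; have dG t : t \in `[0, h] -> is_derive t (1:R) (fun t : R => g (x + t *: e l))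
    (p (x + t *: e l)).
  move=> /itv_norm th; apply/is_derive_line; apply: dg.
  by apply: shift2 => //; move: h0; lra.
by rewrite /mean (avg_FTC2 h0 (mean_cont_on cp ax) dG) scale0r addr0.
Qed.

(** Averaging commutes with the derivatives, which are bounded: differentiation
under the integral sign. *)
Lemma mean_param l k L g p x : 0 <= L -> line_cont a (r + 2 * h) l g ->
  (forall y, cube a (r + 2 * h) y -> is_derive y (e k) g (p y) /\ `|p y| <= L) ->
  cube a r x -> is_derive x (e k) (mean l h g) (mean l h p x).
Proof.
move=> L0 cg dg ax; apply/is_derive_line0.
have := @avg_param_derive _ h h L (fun s t => g (x + s *: e k + t *: e l))
  (fun s t => p (x + s *: e k + t *: e l)) h0 h0 L0 _ _.
rewrite scale0r addr0; apply.
  move=> s sh t /itv_norm th; apply: (line_cont_for cg).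
  by apply: shift11 => //; exact: ltW.
move=> s t sh /itv_norm th.
have axst := shift11 k l ax (ltW sh) th.
have [d1 p1] := dg _ axst; split => //.
have -> : (fun s : R => g (x + s *: e k + t *: e l)) =
    (fun s : R => g (x + t *: e l + s *: e k)).
  by apply/funext => s'; rewrite addrAC.
by apply/is_derive_line; rewrite addrAC.
Qed.

Lemma mean_line_cont l k L g : line_cont a (r + 2 * h) l g ->
  line_cont a (r + 2 * h) k g ->
  (forall y, cube a (r + 2 * h) y -> `|g y| <= L) ->
  line_cont a r k (mean l h g).
Proof.
move=> cl ck gL x ax; rewrite /mean.
apply: (@avg_param_continuous _ h h L (fun s t => g (x + s *: e k + t *: e l)) h0 h0).
  move=> s sh t /itv_norm th; apply: (line_cont_for cl).
  by apply: shift11 => //; exact: ltW.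
move=> s t sh /itv_norm th.
have axst := shift11 k l ax (ltW sh) th; split; last exact: gL.
have -> : (fun s : R => g (x + s *: e k + t *: e l)) =
    (fun s : R => g (x + t *: e l + s *: e k)).
  by apply/funext => s'; rewrite addrAC.
by apply: (line_cont_for ck); rewrite addrAC.
Qed.

Lemma mean_close l g x c d : line_cont a (r + 2 * h) l g -> cube a r x ->
  (forall t, 0 <= t <= h -> `|g (x + t *: e l) - c| <= d) ->
  `|mean l h g x - c| <= d.
Proof.
move=> cg ax gc; apply: (avg_close h0 (mean_cont_on cg ax)).
by move=> t; rewrite in_itv; exact: gc.
Qed.

Lemma mean_eq l f g x : (forall y, cube a (r + 2 * h) y -> f y = g y) ->
  cube a r x -> mean l h f x = mean l h g x.
Proof.
move=> fg ax; rewrite /mean /avg; congr (_ * _); apply: eq_Rintegral => t.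
rewrite inE => /itv_norm th; apply: fg.
by apply: shift2 => //; move: h0; lra.
Qed.

Lemma mean_lin (I : finType) l (f : I -> 'rV[R]_n -> R) (c : I -> R) x :
  (forall d, line_cont a (r + 2 * h) l (f d)) -> cube a r x ->
  mean l h (fun y => \sum_d f d y * c d) x = \sum_d mean l h (f d) x * c d.
Proof.
move=> cf ax; rewrite /mean.
have H (s : seq I) : cont_on `[0, h] (fun t => \sum_(d <- s) f d (x + t *: e l) * c d) /\
   avg h (fun t => \sum_(d <- s) f d (x + t *: e l) * c d) =
   \sum_(d <- s) avg h (fun t => f d (x + t *: e l)) * c d.
  elim: s => [|d s [IH1 IH2]].
    have E : (fun t => \sum_(d <- [::]) f d (x + t *: e l) * c d) = (fun=> 0).
      by apply/funext => t; rewrite big_nil.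
    by rewrite E big_nil avg_cst//; split => // t _; exact: cvg_cst.
  have cd : cont_on `[0, h] (fun t => f d (x + t *: e l)) by exact: mean_cont_on.
  have E : (fun t => \sum_(d <- d :: s) f d (x + t *: e l) * c d) =
     (fun t => c d * f d (x + t *: e l) + 1 * \sum_(d <- s) f d (x + t *: e l) * c d).
    by apply/funext => t; rewrite big_cons mul1r mulrC.
  rewrite E; split.
    move=> t th.
    exact: (cvgD (cvgM (cvg_cst (c d)) (cd t th)) (cvgM (cvg_cst (1:R)) (IH1 t th))).
  by rewrite avg_lin// big_cons mul1r IH2 mulrC.
by have [_] := H (index_enum _).
Qed.

End Steklov.

(** * Steklov averages of a first-order system *)

Section Quotients.
Context {R : realType} {n : nat}.
Notation e := unit_vec.
#[local] Opaque derive derivable.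

Lemma diff_quot_bound l (h L : R) (g : 'rV[R]_n -> R) x : 0 < h -> `|g x| <= L ->
  `|g (x + h *: e l)| <= L -> `|diff_quot l h g x| <= 2 / h * L.
Proof.
move=> h0 g1 g2; have hi : `|h^-1| = h^-1 by rewrite ger0_norm ?invr_ge0 ?ltW.
rewrite /diff_quot normrM hi.
rewrite (_ : 2 / h * L = h^-1 * (2 * L)); last by ring.
rewrite ler_pM2l ?invr_gt0//.
by rewrite (le_trans (ler_normB _ _))//; lra.
Qed.

Lemma is_derive_diff_quot l k (h : R) (g p : 'rV[R]_n -> R) x :
  is_derive x (e k) g (p x) ->
  is_derive (x + h *: e l) (e k) g (p (x + h *: e l)) ->
  is_derive x (e k) (diff_quot l h g) (diff_quot l h p x).
Proof.
move=> d1 d2.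
have d3 : is_derive x (e k) (fun x => g (x + h *: e l)) (p (x + h *: e l)).
  have [h1 h2] := d2; split; first exact: (derivable_shift_arg h1).
  by rewrite -h2; exact: (congr1 (@^~ x) (derive_shift_arg g _ _)).
exact: (is_deriveZ h^-1 (is_deriveB d3 d1)).
Qed.

Lemma diff_quot_sum (I : finType) l (h : R) (f : I -> 'rV[R]_n -> R) (c : I -> R) g x :
  g x = \sum_i f i x * c i ->
  g (x + h *: e l) = \sum_i f i (x + h *: e l) * c i ->
  diff_quot l h g x = \sum_i diff_quot l h (f i) x * c i.
Proof.
move=> E1 E2; rewrite /diff_quot E1 E2 -sumrB mulr_sumr; apply: eq_bigr => i _.
by rewrite -mulrBl mulrA.
Qed.

Lemma sum3 (V : zmodType) (F : 'I_3 -> V) : \sum_l F l = F 0 + F 1 + F 2.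
Proof.
rewrite !big_ord_recl big_ord0 addr0 addrA.
by congr (F _ + F _ + F _); exact/val_inj.
Qed.

Lemma ord3 (l : 'I_3) : [\/ l = 0, l = 1 | l = 2].
Proof.
by case: l => -[|[|[|//]]] i; [apply: Or31|apply: Or32|apply: Or33]; exact/val_inj.
Qed.

End Quotients.

Section SteklovMonogenic.
Context {R : realType} {m : nat}.
Notation V := 'rV[R]_3.
Notation e := unit_vec.
#[local] Opaque derive derivable.
Variables (A B : 'M[R]_m).
Hypotheses (AA : A *m A = - 1%:M) (BB : B *m B = - 1%:M)
  (AB : A *m B + B *m A = 0).

(** The equation p_2 = p_0 A + p_1 B is a sum over pairs of a boolean, which
selects the matrix, and a row index. *)
Definition coef (i : bool * 'I_m) (c : 'I_m) : R := (if i.1 then B else A) i.2 c.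

Lemma sum_coef (t : bool * 'I_m -> R) c : \sum_i t i * coef i c =
  ((\row_d t (false, d)) *m A + (\row_d t (true, d)) *m B) 0 c.
Proof.
rewrite (eq_bigr (fun i => t (i.1, i.2) * coef (i.1, i.2) c)); last by move=> [].
rewrite -(pair_bigA _ (fun b d => t (b, d) * coef (b, d) c))/= big_bool/= addrC !mxE.
by congr (_ + _); apply: eq_bigr => d _; rewrite mxE.
Qed.

(** With X, Y, Z in the role of the second derivatives d_00 u, d_01 u and d_11 u,
this is the formal computation of d_22 u: the squares give - X - Z and the
mixed terms cancel because A and B anticommute. *)
Lemma coef_square (X Y Z : 'I_m -> R) c :
  \sum_i (\sum_(j : bool * 'I_m)
     (if i.1 then if j.1 then Z j.2 else Y j.2
      else if j.1 then Y j.2 else X j.2) * coef j i.2) * coef i c = - X c - Z c.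
Proof.
rewrite sum_coef.
set x := \row_d X d; set y := \row_d Y d; set z := \row_d Z d.
have -> : (\row_d \sum_(j : bool * 'I_m) (if j.1 then Y j.2 else X j.2) * coef j d) =
    x *m A + y *m B by apply/rowP => d; rewrite mxE sum_coef.
have -> : (\row_d \sum_(j : bool * 'I_m) (if j.1 then Z j.2 else Y j.2) * coef j d) =
    y *m A + z *m B by apply/rowP => d; rewrite mxE sum_coef.
have H : y *m (B *m A) + y *m (A *m B) = 0.
  by rewrite -mulmxDr addrC AB mulmx0.
rewrite !mulmxDl -!mulmxA AA BB addrA -(addrA (x *m _)) H addr0.
by rewrite !mulmxN !mulmx1 !mxE.
Qed.

Variables (u : 'I_m -> V -> R) (p : 'I_3 -> 'I_m -> V -> R).
Variables (a : V) (r h L : R).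
Hypotheses (r0 : 0 < r) (h0 : 0 < h) (L0 : 0 <= L).
Let r1 := r + 2 * h.
Let r2 := r1 + 2 * h.
Hypothesis up : forall x l c, cube a r2 x -> is_derive x (e l) (u c) (p l c x).
Hypothesis pL : forall x l c, cube a r2 x -> `|p l c x| <= L.
Hypothesis pc : forall x l c, cube a r2 x -> {for x, continuous (p l c)}.
Hypothesis system : forall x c, cube a r2 x ->
  p 2 c x = \sum_(i : bool * 'I_m) p (if i.1 then 1 else 0) i.2 x * coef i c.

(* The function p l c is the derivative of u c along l.  The averages w of u and v
   of w have derivatives q and P, the averages of p.  Each average in the
   direction l is differentiable along l, with a difference quotient as derivative:
   this gives the second derivatives of v. *)
Let w c := mean 1 h (u c).
Let v c := mean 0 h (w c).
Let q k c := mean 1 h (p k c).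
Let P k c := mean 0 h (q k c).

Let r10 : 0 < r1. Proof. by rewrite /r1; move: r0 h0; lra. Qed.
Let C12 : cube a r1 `<=` cube a r2.
Proof. by apply: sub_cube; rewrite /r2; move: h0; lra. Qed.
Let C01 : cube a r `<=` cube a r1.
Proof. by apply: sub_cube; rewrite /r1; move: h0; lra. Qed.
Let oC0 := @cube_open _ _ a r r0.
Let oC1 := @cube_open _ _ a r1 r10.

Let shift12 x l : cube a r1 x -> cube a r2 (x + h *: e l).
Proof.
move=> ax; apply: (sub_cube _ (cube_shift l ax (lexx _))).
by rewrite gtr0_norm// /r2; move: h0; lra.
Qed.
Let shift01 x l : cube a r x -> cube a r1 (x + h *: e l).
Proof.
move=> ax; apply: (sub_cube _ (cube_shift l ax (lexx _))).
by rewrite gtr0_norm// /r1; move: h0; lra.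
Qed.

Let u_lc l c : line_cont a r2 l (u c).
Proof. by apply: derivable_line_cont => x /up h'; have [] := h' l c. Qed.

Let p_lc l k c : line_cont a r2 l (p k c).
Proof. by apply: continuous_line_cont => x /pc. Qed.

Let w1 c x : cube a r1 x -> is_derive x (e 1) (w c) (diff_quot 1 h (u c) x).
Proof. exact: (mean_FTC1 h0 (@u_lc 1 c)). Qed.

Let wk k c x : cube a r1 x -> is_derive x (e k) (w c) (q k c x).
Proof.
apply: (mean_param h0 L0 (@u_lc 1 c)) => y ay; split; [exact: up|exact: pL].
Qed.

Let q1E c x : cube a r1 x -> q 1 c x = diff_quot 1 h (u c) x.
Proof. by move=> ax; have [_ <-] := wk 1 c ax; have [_ <-] := w1 c ax. Qed.

Let q_bound k c x : cube a r1 x -> `|q k c x| <= L.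
Proof.
move=> ax; rewrite -[q k c x]subr0; apply: (mean_close h0 (@p_lc 1 k c) ax).
move=> t /andP[t0 th]; rewrite subr0; apply: pL.
apply: (sub_cube _ (cube_shift 1 ax (lexx _))).
by rewrite ger0_norm// /r2; move: h0; lra.
Qed.

Let q_lc l k c : line_cont a r1 l (q k c).
Proof.
by apply: (mean_line_cont h0 (@p_lc 1 k c) (@p_lc l k c)) => y /pL.
Qed.

Let w_lc l c : line_cont a r1 l (w c).
Proof. by apply: derivable_line_cont => x /wk h'; have [] := h' l c. Qed.

Let v0 c x : cube a r x -> is_derive x (e 0) (v c) (diff_quot 0 h (w c) x).
Proof. exact: (mean_FTC1 h0 (@w_lc 0 c)). Qed.

Let vk k c x : cube a r x -> is_derive x (e k) (v c) (P k c x).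
Proof.
apply: (mean_param h0 L0 (@w_lc 0 c)) => y ay; split; [exact: wk|exact: q_bound].
Qed.

Let P0E c x : cube a r x -> P 0 c x = diff_quot 0 h (w c) x.
Proof. by move=> ax; have [_ <-] := vk 0 c ax; have [_ <-] := v0 c ax. Qed.

Let P_bound k c x : cube a r x -> `|P k c x| <= L.
Proof.
move=> ax; rewrite -[P k c x]subr0; apply: (mean_close h0 (@q_lc 0 k c) ax).
move=> t /andP[t0 th]; rewrite subr0; apply: q_bound.
apply: (sub_cube _ (cube_shift 0 ax (lexx _))).
by rewrite ger0_norm// /r1; move: h0; lra.
Qed.

(* X, Y and Z are the second derivatives of v along the pairs of axes (0, 0),
   (0, 1) and (1, 1). *)
Let X c := diff_quot 0 h (q 0 c).
Let Y c := diff_quot 0 h (diff_quot 1 h (u c)).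
Let Z c := mean 0 h (diff_quot 1 h (p 1 c)).

Let DP0 c x : cube a r x -> is_derive x (e 0) (P 0 c) (X c x).
Proof. exact: (mean_FTC1 h0 (@q_lc 0 0 c)). Qed.

Let diff_quot_p_bound k c x : cube a r1 x -> `|diff_quot 1 h (p k c) x| <= 2 / h * L.
Proof.
by move=> ax; apply: diff_quot_bound => //; apply: pL; [exact: C12|exact: shift12].
Qed.

Let L2 : 0 <= 2 / h * L.
Proof. by rewrite mulr_ge0// divr_ge0// ltW. Qed.

Let DP1 c x : cube a r x -> is_derive x (e 1) (P 1 c) (Z c x).
Proof.
apply: (mean_param h0 L2 (@q_lc 0 1 c)) => y ay; split; last exact: diff_quot_p_bound.
exact: (mean_FTC1 h0 (@p_lc 1 1 c)).
Qed.

Let Dquot k c x : cube a r1 x ->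
  is_derive x (e k) (diff_quot 1 h (u c)) (diff_quot 1 h (p k c) x).
Proof. by move=> ax; apply: is_derive_diff_quot; apply: up; [exact: C12|exact: shift12]. Qed.

Let D2P0 c x : cube a r x -> is_derive x (e 2) (P 0 c) (diff_quot 0 h (q 2 c) x).
Proof.
move=> ax; have d : is_derive x (e 2) (diff_quot 0 h (w c)) (diff_quot 0 h (q 2 c) x).
  by apply: is_derive_diff_quot; apply: wk; [exact: C01|exact: shift01].
have E y : cube a r y -> diff_quot 0 h (w c) y = P 0 c y by move=> ay; rewrite P0E.
by have [d1 <-] := d; split; [exact: derivable_eq_on oC0 ax E d1|
  exact: esym (derive_eq_on _ oC0 ax E)].
Qed.

Let D2P1 c x : cube a r x ->
  is_derive x (e 2) (P 1 c) (mean 0 h (diff_quot 1 h (p 2 c)) x).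
Proof.
apply: (mean_param h0 L2 (@q_lc 0 1 c)) => y ay; split; last exact: diff_quot_p_bound.
have E y' : cube a r1 y' -> diff_quot 1 h (u c) y' = q 1 c y' by move=> ay'; rewrite q1E.
have [d1 <-] := Dquot 2 c ay; split; first exact: derivable_eq_on oC1 ay E d1.
exact: esym (derive_eq_on _ oC1 ay E).
Qed.

Let q2E c x : cube a r1 x ->
  q 2 c x = \sum_(i : bool * 'I_m) q (if i.1 then 1 else 0) i.2 x * coef i c.
Proof.
move=> ax; rewrite /q (mean_eq h0 1 (fun y ay => system c ay) ax).
exact: (mean_lin h0 (fun i => coef i c) (fun i => @p_lc 1 (if i.1 then 1 else 0) i.2) ax).
Qed.

Let P2E c x : cube a r x ->
  P 2 c x = \sum_(i : bool * 'I_m) P (if i.1 then 1 else 0) i.2 x * coef i c.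
Proof.
move=> ax; rewrite /P (mean_eq h0 0 (fun y ay => q2E c ay) ax).
exact: (mean_lin h0 (fun i => coef i c) (fun i => @q_lc 0 (if i.1 then 1 else 0) i.2) ax).
Qed.

Let D2P0E c x : cube a r x -> diff_quot 0 h (q 2 c) x =
  \sum_(j : bool * 'I_m) (if j.1 then Y j.2 x else X j.2 x) * coef j c.
Proof.
move=> ax; have ax1 := C01 ax; have ah := shift01 0 ax.
apply: (etrans (diff_quot_sum (f := fun i => q (if i.1 then 1 else 0) i.2)
  (q2E c ax1) (q2E c ah))).
apply: eq_bigr => -[[] d] _ //=; congr (_ * _).
by rewrite /Y {1}/diff_quot !q1E.
Qed.

Let diff_quot_p_lc l k c : line_cont a r1 l (diff_quot 1 h (p k c)).
Proof.
move=> x ax; have c1 := @p_lc l k c _ (C12 ax); have c2 := @p_lc l k c _ (shift12 1 ax).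
have E : (fun t : R => diff_quot 1 h (p k c) (x + t *: e l)) =
   (fun t : R => h^-1 * (p k c (x + h *: e 1 + t *: e l) - p k c (x + t *: e l))).
  by apply/funext => t; rewrite /diff_quot addrAC.
rewrite E; exact: (cvgM (cvg_cst _) (cvgB c2 c1)).
Qed.

Let D2P1E c x : cube a r x -> mean 0 h (diff_quot 1 h (p 2 c)) x =
  \sum_(j : bool * 'I_m) (if j.1 then Z j.2 x else Y j.2 x) * coef j c.
Proof.
move=> ax.
have E y : cube a r1 y -> diff_quot 1 h (p 2 c) y =
    \sum_(j : bool * 'I_m) diff_quot 1 h (p (if j.1 then 1 else 0) j.2) y * coef j c.
  move=> ay; exact: (diff_quot_sum (f := fun j => p (if j.1 then 1 else 0) j.2)
    (system c (C12 ay)) (system c (shift12 1 ay))).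
rewrite (mean_eq h0 0 E ax).
have -> := mean_lin h0 (fun i => coef i c)
  (fun i => @diff_quot_p_lc 0 (if i.1 then 1 else 0) i.2) ax.
apply: eq_bigr => -[[] d] _ //=; congr (_ * _).
by apply: (mean_FTC2 h0 (@diff_quot_p_lc 0 0 d)) => // y; exact: Dquot.
Qed.

Let DP2 c x : cube a r x -> is_derive x (e 2) (P 2 c) (- X c x - Z c x).
Proof.
move=> ax.
have E y : cube a r y ->
  \sum_(i : bool * 'I_m) P (if i.1 then 1 else 0) i.2 y * coef i c = P 2 c y.
  by move=> ay; rewrite P2E.
have H (s : seq (bool * 'I_m)) : is_derive x (e 2)
    (fun y => \sum_(i <- s) P (if i.1 then 1 else 0) i.2 y * coef i c)
    (\sum_(i <- s) (if i.1 then mean 0 h (diff_quot 1 h (p 2 i.2)) x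
       else diff_quot 0 h (q 2 i.2) x) * coef i c).
  elim: s => [|i s IH].
    have E0 : (fun y => \sum_(i <- [::]) P (if i.1 then 1 else 0) i.2 y * coef i c)
        = (fun=> 0 : R) by apply/funext => y; exact: big_nil.
    by rewrite E0 big_nil; exact: is_derive_cst.
  have E1 : (fun y => \sum_(i <- i :: s) P (if i.1 then 1 else 0) i.2 y * coef i c) =
     (fun y => coef i c * P (if i.1 then 1 else 0) i.2 y +
        \sum_(i <- s) P (if i.1 then 1 else 0) i.2 y * coef i c).
    by apply/funext => y; rewrite big_cons; congr (_ + _); exact: mulrC.
  have Di : is_derive x (e 2) (P (if i.1 then 1 else 0) i.2)
      (if i.1 then mean 0 h (diff_quot 1 h (p 2 i.2)) x else diff_quot 0 h (q 2 i.2) x).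
    by case: i {E1} => -[] d /=; [exact: D2P1|exact: D2P0].
  rewrite E1 big_cons [_ * coef i c]mulrC.
  exact: (is_deriveD (is_deriveZ (coef i c) Di) IH).
have [d1 d2] := H (index_enum _); split; first exact: derivable_eq_on oC0 ax E d1.
apply: (etrans (esym (derive_eq_on _ oC0 ax E))); apply: (etrans d2).
rewrite -(coef_square (X^~ x) (Y^~ x) (Z^~ x) c); apply: eq_bigr => -[[] d] _ /=;
  congr (_ * _); by [rewrite D2P1E|rewrite D2P0E].
Qed.

Let DPE k c x : cube a r x -> 'D_(e k) (v c) x = P k c x.
Proof. by move=> ax; have [_] := vk k c ax. Qed.

(** The second derivatives of v in the directions 0, 1, 2 are X, Z and - X - Z. *)
Lemma steklov_harmonic c : C2harmonic (cube a r) (v c).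
Proof.
have D2 k x d : cube a r x -> is_derive x (e k) (P k c) d ->
    is_derive x (e k) ('D_(e k) (v c)) d.
  move=> ax [d1 <-].
  have E y : cube a r y -> P k c y = 'D_(e k) (v c) y by move=> ay; rewrite DPE.
  split; first exact: derivable_eq_on oC0 ax E d1.
  exact: esym (derive_eq_on _ oC0 ax E).
move=> x ax.
have S0 := D2 0 x _ ax (DP0 c ax); have S1 := D2 1 x _ ax (DP1 c ax).
have S2 := D2 2 x _ ax (DP2 c ax); split.
- apply: (bounded_derive_continuous r0 L0 _ ax) => y l ay.
  by have [d ->] := vk l c ay; split => //; exact: P_bound.
- move=> l; split; first by have [] := vk l c ax.
  have [d0 _] := S0; have [d1 _] := S1; have [d2 _] := S2.
  by case: (ord3 l) => ->; [exact: d0|exact: d1|exact: d2].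
- have [_ E0] := S0; have [_ E1'] := S1; have [_ E2] := S2.
  apply: (etrans (sum3 (fun l => 'D_(e l) ('D_(e l) (v c)) x))).
  apply: (etrans (congr2 +%R (congr2 +%R E0 E1') E2)).
  by rewrite -opprD subrr.
Qed.

(** Averaging over a segment of length h moves a function by at most h times the
bound of its derivative; this is done twice. *)
Lemma steklov_close c x : cube a r x -> `|u c x - v c x| <= 2 * (L * h).
Proof.
move=> ax.
have wu y : cube a r1 y -> `|w c y - u c y| <= L * h.
  move=> ay; apply: (mean_close h0 (@u_lc 1 c) ay) => t /andP[t0 th].
  have seg s : `|s| <= `|t| -> cube a r2 (y + s *: e 1).
    move=> st; apply: (sub_cube _ (cube_shift 1 ay st)).
    by rewrite ger0_norm// /r2; move: h0; lra.
  have [s st ->] := MVT_line (fun s st => @ex_derive _ _ _ _ _ _ _ (up 1 c (seg s st))).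
  have [_ ->] := up 1 c (seg s st).
  rewrite normrM mulrC (ger0_norm t0); apply: ler_pM => //; exact: pL (seg s st).
have vw : `|v c x - w c x| <= L * h.
  apply: (mean_close h0 (@w_lc 0 c) ax) => t /andP[t0 th].
  have seg s : `|s| <= `|t| -> cube a r1 (x + s *: e 0).
    move=> st; apply: (sub_cube _ (cube_shift 0 ax st)).
    by rewrite ger0_norm// /r1; move: h0; lra.
  have [s st ->] := MVT_line (fun s st => @ex_derive _ _ _ _ _ _ _ (wk 0 c (seg s st))).
  have [_ ->] := wk 0 c (seg s st).
  rewrite normrM mulrC (ger0_norm t0); apply: ler_pM => //; exact: q_bound (seg s st).
have := wu x (C01 ax); move: vw; rewrite !ler_norml => /andP[? ?] /andP[? ?].
by apply/andP; split; lra.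
Qed.

End SteklovMonogenic.

(** * Monogenic functions are harmonic *)

Section RowDerivatives.
Context {R : realType} {V : normedModType R} {m : nat}.
Implicit Types (u : V -> 'rV[R]_m) (x v : V).

Lemma is_derive_coord u x v (d : 'rV[R]_m) (c : 'I_m) : is_derive x v u d ->
  is_derive x v (fun y => u y 0 c) (d 0 c).
Proof.
move=> [du <-]; split; first by move/derivable_mxP : du; exact.
by rewrite derive_mx// mxE.
Qed.

Lemma is_derive_rV u x v (d : 'rV[R]_m) : (forall c, is_derive x v (fun y => u y 0 c) (d 0 c)) ->
  is_derive x v u d.
Proof.
move=> h; have du : derivable u x v.
  by apply/derivable_mxP => i c; rewrite (ord1 i); have [] := h c.
split => //; rewrite derive_mx//; apply/rowP => c; rewrite mxE.
by have [_] := h c.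
Qed.

End RowDerivatives.

Section MonogenicHarmonic.
Context {R : realType} {m : nat}.
Notation V := 'rV[R]_3.
Notation e := unit_vec.
#[local] Opaque derive derivable.

Lemma coord_le_norm (M : 'rV[R]_m) c : `|M 0 c| <= `|M|.
Proof.
rewrite /Num.Def.normr/= mx_normrE.
exact: (le_bigmax _ (fun i : 'I_1 * 'I_m => `|M i.1 i.2|) (0, c)).
Qed.

(** A C^1 function is, near each point, the uniform limit of its Steklov averages
as the step tends to 0. *)
Theorem monogenic_loc_harmonic (A B : 'M[R]_m) (U : set V) (u : V -> 'rV[R]_m) :
  A *m A = - 1%:M -> B *m B = - 1%:M -> A *m B + B *m A = 0 -> open U ->
  (forall x l, U x -> derivable u x (e l) /\ {for x, continuous ('D_(e l) u)}) ->
  (forall x, U x -> 'D_(e 2) u x = 'D_(e 0) u x *m A + 'D_(e 1) u x *m B) ->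
  forall x c, U x -> loc_harmonic x (fun y => u y 0 c).
Proof.
move=> AA BB AB oU C1u system a c Ua.
have [rho [L [rho0 L0 HU HL]]] : exists rho L : R, [/\ 0 < rho, 0 <= L,
    cube a rho `<=` U & forall x l, cube a rho x -> `|'D_(e l) u x| <= L].
  pose L := \sum_l (`|'D_(e l) u a| + 1).
  have FF : Filter (nbhs a) := nbhs_filter a.
  have near_l l : \forall x \near a, `|'D_(e l) u x| <= L.
    have [_ cl] := C1u a l Ua.
    have := proj1 (@cvgrPdist_le _ _ _ _ FF ('D_(e l) u) ('D_(e l) u a)) cl _ ltr01.
    apply: filterS => x xa.
    apply: (@le_trans _ _ (`|'D_(e l) u a| + 1)).
      rewrite -(subrK ('D_(e l) u a) ('D_(e l) u x)) addrC.
      by rewrite (le_trans (ler_normD _ _))// lerD2l distrC.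
    rewrite /L (bigD1 l)//= lerDl; apply: sumr_ge0 => i _.
    by rewrite addr_ge0.
  have near_all := @filterI _ _ FF _ _ (@filterI _ _ FF _ _ (near_l 0) (near_l 1)) (near_l 2).
  have [rho rho0 hrho] := nbhs_cube
    (@filterI _ _ FF _ _ near_all (open_nbhs_nbhs (conj oU Ua))).
  exists rho, L; split => //.
  - by apply: sumr_ge0 => i _; rewrite addr_ge0.
  - by move=> x /hrho[].
  - by move=> x l /hrho[[[h0 h1] h2] _]; case: (ord3 l) => ->.
pose p l c x := 'D_(e l) u x 0 c.
have up x l d : cube a rho x -> is_derive x (e l) (fun y => u y 0 d) (p l d x).
  by move=> /HU Ux; apply: is_derive_coord; have [du _] := C1u x l Ux; exact: derivableP.
have pL x l d : cube a rho x -> `|p l d x| <= L.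
  by move=> ax; rewrite (le_trans (coord_le_norm _ _))// HL.
have pc x l d : cube a rho x -> {for x, continuous (p l d)}.
  move=> /HU Ux; have [_ cl] := C1u x l Ux.
  exact: (continuous_comp cl (@coord_continuous _ _ _ 0 d _)).
have sys x d : cube a rho x -> p 2 d x =
    \sum_(i : bool * 'I_m) p (if i.1 then 1 else 0) i.2 x * coef A B i d.
  move=> /HU Ux; rewrite sum_coef /p (system x Ux) !mxE.
  by congr (_ + _); apply: eq_bigr => i _; rewrite !mxE.
have rho2 : 0 < rho / 2 by lra.
have sub : cube a (rho / 2) `<=` cube a rho by apply: sub_cube; lra.
exists (rho / 2), (`|u a 0 c| + 3%:R * (L * rho) + 1); split => //.
- have := mulr_ge0 L0 (ltW rho0); have := normr_ge0 (u a 0 c).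
  by set q := L * rho; lra.
- move=> eps eps0.
    (* The averages use values at distance up to 4 h, which must stay in the cube. *)
pose h := Num.min (rho / 8) (eps / (2 * L + 1)).
  have h0 : 0 < h by rewrite lt_min !divr_gt0//; lra.
  have hr : h <= rho / 8 by rewrite ge_min lexx.
  have he : L * h <= eps / 2.
    have : h <= eps / (2 * L + 1) by rewrite ge_min lexx orbT.
    by rewrite ler_pdivlMr; [nra|lra].
  have sub2 : cube a (rho / 2 + 2 * h + 2 * h) `<=` cube a rho.
    by apply: sub_cube; lra.
  exists (mean 0 h (mean 1 h (fun y => u y 0 c))).
    exact: (steklov_harmonic AA BB AB rho2 h0 L0
      (fun x l d ax => up x l d (sub2 x ax)) (fun x l d ax => pL x l d (sub2 x ax))
      (fun x l d ax => pc x l d (sub2 x ax)) (fun x d ax => sys x d (sub2 x ax))).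
  move=> x ax.
  have := steklov_close h0 L0
      (fun x l d ax => up x l d (sub2 x ax)) (fun x l d ax => pL x l d (sub2 x ax))
      (fun x l d ax => pc x l d (sub2 x ax)) c ax; rewrite /=.
  by move=> /le_trans; apply; lra.
- move=> x ax.
  have dg y l : cube a rho y -> derivable (fun y => u y 0 c) y (e l) /\
      `|'D_(e l) (fun y => u y 0 c) y| <= L.
    by move=> ay; have [d1 ->] := up y l c ay; split => //; exact: pL.
  have aa : cube a rho a by exact: cube_center.
  have := lipschitz_cube L0 dg aa (sub x ax) (fun i => ltW (sub x ax i)).
  rewrite -{2}(subrK (u a 0 c) (u x 0 c)) => h1.
  by rewrite (le_trans (ler_normD _ _))//; set q := L * rho in h1 *; lra.
Qed.

End MonogenicHarmonic.

(** * Cauchy estimates *)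

Section CauchyEstimates.
Context {R : realType} {n : nat}.
Implicit Types (a x : 'rV[R]_n) (r C : R) (l : 'I_n) (w : seq 'I_n).
Implicit Types (g : 'rV[R]_n -> R).
Notation e := unit_vec.
Notation kappa := (@kappa R n).
#[local] Opaque derive derivable.

(** Iterated partial derivatives, the last letter of the word being the first
derivative taken.  A word records the derivatives in the order in which they
arise. *)
Definition dword w g : 'rV[R]_n -> R := foldr (fun l f => 'D_(e l) f) g w.

Lemma dword_cat w1 w2 g : dword (w1 ++ w2) g = dword w1 (dword w2 g).
Proof. exact: foldr_cat. Qed.

Lemma dword_eq_on (U : set 'rV[R]_n) f g w : open U ->
  (forall x, U x -> f x = g x) -> forall x, U x -> dword w f x = dword w g x.
Proof.
move=> oU fg; elim: w => [|l w IH] x Ux /=; first exact: fg.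
exact: derive_eq_on oU Ux IH.
Qed.

Lemma loc_harmonic_dword a w g : loc_harmonic a g -> loc_harmonic a (dword w g).
Proof. by move=> gH; elim: w => //= l w IH; exact: loc_harmonic_derive. Qed.

Definition smooth_on (U : set 'rV[R]_n) g :=
  forall w x l, U x -> derivable (dword w g) x (e l).

(** Analyticity at a in the form of bounds, uniform near a, on all derivatives. *)
Definition cauchy_bounds a g := exists r C, [/\ 0 < r, 1 <= C,
  smooth_on (cube a r) g &
  forall w x, cube a r x -> `|dword w g x| <= C ^+ (size w).+1 * (size w)`!%:R].

Lemma bin_le_exp2 p q : ('C(p, q) <= 2 ^ p)%N.
Proof.
have [pq|qp] := ltnP p q; first by rewrite bin_small.
rewrite -[2%N]/(1 + 1)%N expnDn (bigD1 (Ordinal (qp : (q < p.+1)%N)))//=.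
by rewrite !exp1n !muln1 leq_addr.
Qed.

Lemma fact_add_le p q : ((p + q)`! <= 2 ^ (p + q) * (p`! * q`!))%N.
Proof.
rewrite -(@bin_fact (p + q) p) ?leq_addr// addKn.
by rewrite leq_mul2r bin_le_exp2 orbT.
Qed.

Lemma expnn_le_fact k : (k ^ k <= 4 ^ k * k`!)%N.
Proof.
have h j i : (j ^ i <= (j + i) ^_ i)%N.
  elim: i => // i IH; rewrite expnS addnS ffactSS leq_mul// -addnS leq_addr.
  by [].
apply: (leq_trans (h k k)); rewrite -bin_ffact leq_mul2r.
by rewrite -[4%N]/(2 ^ 2)%N -expnM mul2n -addnn bin_le_exp2 orbT.
Qed.

(** Each derivative is estimated on a cube of radius r / (2 N), so that N of them
use up half of the radius r. *)
Lemma iterated_gradient_estimate a r M (N : nat) g : 0 < r -> 0 < M ->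
  (forall x, cube a r x -> loc_harmonic x g) ->
  (forall x, cube a r x -> `|g x| <= M) -> (0 < N)%N ->
  forall w x, (size w <= N)%N -> cube a (r - (size w)%:R * (r / 2 / N%:R)) x ->
  `|dword w g x| <= (kappa * N%:R / (r / 2)) ^+ size w * M.
Proof.
move=> r0 M0 Hg gM N0; have k0 := @kappa_gt0 R n.
have N0' : 0 < N%:R :> R by rewrite ltr0n.
pose d := r / 2 / N%:R; have d0 : 0 < d by rewrite !divr_gt0.
elim=> [|l w IH] x; first by rewrite mul0r subr0 expr0 mul1r => _; exact: gM.
rewrite /= => wN ax.
have Nd : N%:R * d = r / 2 by rewrite /d mulrC divfK ?gt_eqF.
have wd : (size w)%:R * d <= r / 2.
  by rewrite -Nd ler_pM2r// ler_nat ltnW.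
have sub : cube x d `<=` cube a (r - (size w)%:R * d).
  by apply: (cube_recenter ax); rewrite -/d -natr1; lra.
have subr : cube a (r - (size w)%:R * d) `<=` cube a r.
  apply: sub_cube; have : 0 <= (size w)%:R * d by rewrite mulr_ge0// ltW.
  by lra.
have M'0 : 0 < (kappa * N%:R / (r / 2)) ^+ size w * M.
  by rewrite mulr_gt0// exprn_gt0// divr_gt0 ?mulr_gt0//; lra.
have HC : C2harmonic (cube x d) (dword w g).
  by apply: loc_harmonic_C2harmonic => y /sub/subr ay; apply: loc_harmonic_dword; exact: Hg.
have := gradient_estimate l M'0 d0 HC (fun y yd => IH y (ltnW wN) (sub y yd)).
move=> /le_trans; apply; rewrite le_eqVlt; apply/orP; left; apply/eqP.
rewrite exprS /d; set E := (kappa * _ / _) ^+ _.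
by field; rewrite !gt_eqF//; lra.
Qed.

(** Taking N equal to the number of derivatives gives a factor N^N, which is at
most 4^N N!. *)
Lemma loc_harmonic_cauchy_bounds a g : loc_harmonic a g -> cauchy_bounds a g.
Proof.
move=> Hg; have k0 := @kappa_gt0 R n.
have [r [M [r0 M0 Hgr gM]]] : exists r M : R, [/\ 0 < r, 0 < M,
    forall x, cube a r x -> loc_harmonic x g & forall x, cube a r x -> `|g x| <= M].
  have [s s0 Hs] := loc_harmonic_near Hg.
  have [r [M [/andP[r0 rs] M0 _ gM]]] := loc_harmonic_shrink Hg s0.
  by exists r, M; split => // x ax; apply: Hs; exact: sub_cube ax.
pose C := 4 * kappa / (r / 2) + M + 1.
have K0 : 0 < 4 * kappa / (r / 2) by rewrite divr_gt0 ?mulr_gt0//; lra.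
have C1 : 1 <= C by rewrite /C; lra.
have sub : cube a (r / 2) `<=` cube a r by apply: sub_cube; lra.
exists (r / 2), C; split => //; first lra.
  by move=> w x l /sub/Hgr Hx; apply: loc_harmonic_derivable; exact: loc_harmonic_dword.
move=> w x ax; have [/size0nil->|w0] := posnP (size w).
  by rewrite /= fact0 expr1 mulr1 (le_trans (gM x (sub x ax)))// /C; lra.
set N := size w in w0 *.
have Nn : N%:R != 0 :> R by rewrite pnatr_eq0 -lt0n.
have aN : cube a (r - N%:R * (r / 2 / N%:R)) x.
  have E : N%:R * (r / 2 / N%:R) = r / 2 by rewrite mulrC divfK.
  by apply: sub_cube ax; rewrite E; lra.
apply: (le_trans (iterated_gradient_estimate r0 M0 Hgr gM w0 (leqnn _) aN)).
rewrite -/N.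
have E : kappa * N%:R / (r / 2) = kappa / (r / 2) * N%:R by ring.
rewrite E exprMn -mulrA.
apply: (@le_trans _ _ ((kappa / (r / 2)) ^+ N * ((4 ^ N * N`!)%N%:R * M))).
  rewrite ler_pM2l; last by rewrite exprn_gt0// divr_gt0//; lra.
  by rewrite ler_pM2r// -natrX ler_nat expnn_le_fact.
have E2 : 4 * (kappa / (r / 2)) = 4 * kappa / (r / 2) by ring.
rewrite natrM natrX -mulrA mulrA -exprMn (mulrC _ 4) E2 exprSr -(mulrA (C ^+ N)).
have K0' := ltW K0; have C0 : 0 <= C by lra.
apply: ler_pM; [exact: exprn_ge0|by apply: mulr_ge0; [exact: ler0n|exact: ltW]| |].
  by apply: lerXn2r; rewrite ?nnegrE// /C; lra.
by rewrite mulrC ler_wpM2r// /C; lra.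
Qed.

End CauchyEstimates.

(** * Taylor polynomials in several variables *)

Section Taylor1.
Context {R : realType}.
Implicit Types (F : nat -> R -> R) (M s z : R).
#[local] Opaque derive derivable.

Definition taylor_poly (c : nat -> R) N s : R := \sum_(j < N) c j * (s ^+ j / j`!%:R).

Lemma is_derive_taylor_poly c N s :
  is_derive s (1:R) (taylor_poly c N.+1) (taylor_poly (fun j => c j.+1) N s).
Proof.
elim: N => [|N IH].
  have -> : taylor_poly c 1 = cst (c 0%N).
    by apply/funext => t; rewrite /taylor_poly big_ord1 expr0 fact0 divr1 mulr1.
  by rewrite /taylor_poly big_ord0; exact: is_derive_cst.
have -> : taylor_poly c N.+2 = taylor_poly c N.+1 +
    (fun t => c N.+1 * (t ^+ N.+1 / N.+1`!%:R)).
  by apply/funext => t; rewrite /taylor_poly big_ord_recr.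
rewrite {2}/taylor_poly big_ord_recr -/(taylor_poly _ N s)/=.
have D : is_derive s (1:R) (fun t : R => t ^+ N.+1) (N.+1%:R * s ^+ N).
  by split; [exact: exprn_derivable|rewrite exp_derive /GRing.scale/= mulr1].
have D2 := is_deriveZ (c N.+1 / N.+1`!%:R) D.
apply: (is_deriveD IH).
have E1 : (c N.+1 / N.+1`!%:R) \*: (fun t : R => t ^+ N.+1) =
    (fun t => c N.+1 * (t ^+ N.+1 / N.+1`!%:R)).
  by apply/funext => t; rewrite /= /GRing.scale/=; ring.
have E2 : (c N.+1 / N.+1`!%:R) *: (N.+1%:R * s ^+ N) = c N.+1 * (s ^+ N / N`!%:R).
  have f0 : N`!%:R != 0 :> R by rewrite pnatr_eq0 -lt0n fact_gt0.
  have s0 : N.+1%:R != 0 :> R by rewrite pnatr_eq0.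
  rewrite /GRing.scale/= factS natrM; move: f0 s0 (s ^+ N) (c N.+1).
  by move: N`!%:R N.+1%:R => p q p0 q0 u v; field; rewrite p0 q0.
by rewrite -E2; rewrite E1 in D2.
Qed.

Lemma nonneg_of_derive (h dh : R -> R) s : 0 <= s <= 1 ->
  (forall t : R, 0 <= t <= 1 -> is_derive t (1:R) h (dh t)) ->
  (forall t : R, 0 <= t <= 1 -> 0 <= dh t) -> h 0 = 0 -> 0 <= h s.
Proof.
move=> /andP[s0 s1] Dh dh0 h0.
have sub (t : R) : t \in `[0, s] -> 0 <= t <= 1.
  by rewrite in_itv/= => /andP[-> ts]; rewrite (le_trans ts).
have Dh' (t : R) : t \in `]0, s[ -> is_derive t (1:R) h (dh t).
  by move=> /subset_itv_oo_cc/sub/Dh.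
have ch : {within `[0, s], continuous h}.
  by apply: derivable_within_continuous => t /sub/Dh[].
have [c cs] := MVT_segment s0 Dh' ch; rewrite h0 !subr0 => ->.
by apply: mulr_ge0 => //; exact/dh0/sub.
Qed.

(** Taylor's formula for a function with derivatives F 0, F 1, ... on [0, 1].  The
remainder and its bound have derivatives ordered by the induction hypothesis,
and both vanish at 0. *)
Lemma taylor01 (N : nat) F M :
  (forall j (s : R), 0 <= s <= 1 -> is_derive s (1:R) (F j) (F j.+1 s)) ->
  (forall s : R, 0 <= s <= 1 -> `|F N s| <= M) ->
  forall s : R, 0 <= s <= 1 ->
  `|F 0%N s - taylor_poly (fun j => F j 0) N s| <= M * (s ^+ N / N`!%:R).
Proof.
elim: N F => [|N IH] F DF FM s s01.
  by rewrite /taylor_poly big_ord0 subr0 expr0 fact0 divr1 mulr1; exact: FM.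
have {}IH := IH (fun j => F j.+1) (fun j => DF j.+1) FM.
pose psi t := F 0%N t - taylor_poly (fun j => F j 0) N.+1 t.
pose dpsi t := F 1%N t - taylor_poly (fun j => F j.+1 0) N t.
have Dpsi (t : R) : 0 <= t <= 1 -> is_derive t (1:R) psi (dpsi t).
  by move=> t01; exact: (is_deriveB (DF 0%N t t01) (is_derive_taylor_poly _ _ _)).
have psi0 : psi 0 = 0.
  rewrite /psi /taylor_poly big_ord_recl expr0 fact0 divr1 mulr1 big1 ?addr0 ?subrr//.
  by move=> j _; rewrite /= expr0n mul0r mulr0.
pose bnd t := M * (t ^+ N.+1 / N.+1`!%:R).
have Dbnd (t : R) : is_derive t (1:R) bnd (M * (t ^+ N / N`!%:R)).
  have := is_derive_taylor_poly (fun j => if j == N.+1 then M else 0) N.+1 t.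
  have -> : taylor_poly (fun j => if j == N.+1 then M else 0) N.+2 = bnd.
    apply/funext => t'; rewrite /taylor_poly big_ord_recr/= eqxx big1/=.
      by rewrite add0r.
    by move=> j _; rewrite ltn_eqF ?mul0r.
  rewrite {1}/taylor_poly big_ord_recr/= eqxx big1/=; first by rewrite add0r.
  by move=> j _; rewrite eqSS ltn_eqF ?mul0r.
have bnd0 : bnd 0 = 0 by rewrite /bnd expr0n mul0r mulr0.
have h1 : 0 <= (bnd - psi) s.
  apply: (@nonneg_of_derive (bnd - psi) (fun t => M * (t ^+ N / N`!%:R) - dpsi t)).
  - exact: s01.
  - by move=> t t01; exact: (is_deriveB (Dbnd t) (Dpsi t t01)).
  - by move=> t /IH; rewrite -/(dpsi t) ler_norml => /andP[_]; lra.
  - by rewrite !fctE bnd0 psi0 subrr.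
have h2 : 0 <= (bnd + psi) s.
  apply: (@nonneg_of_derive (bnd + psi) (fun t => M * (t ^+ N / N`!%:R) + dpsi t)).
  - exact: s01.
  - by move=> t t01; exact: (is_deriveD (Dbnd t) (Dpsi t t01)).
  - by move=> t /IH; rewrite -/(dpsi t) ler_norml => /andP[]; lra.
  - by rewrite !fctE bnd0 psi0 addr0.
move: h1 h2; rewrite !fctE => h1 h2; rewrite ler_norml -/(psi s) -/(bnd s).
by apply/andP; split; lra.
Qed.

Lemma sum_geometric_le2 N z : 0 <= z <= 1 / 2 -> \sum_(j < N) z ^+ j <= 2.
Proof.
move=> /andP[z0 z2].
suff : \sum_(j < N) z ^+ j <= 2 - 2 * (1 / 2) ^+ N.
  move=> /le_trans; apply; rewrite gerBl mulr_ge0// exprn_ge0//; lra.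
elim: N => [|N IH]; first by rewrite big_ord0 expr0; lra.
rewrite big_ord_recr /= exprS.
have : z ^+ N <= (1 / 2) ^+ N by rewrite lerXn2r// nnegrE; lra.
lra.
Qed.

Lemma cvg_of_dist (u e : nat -> R) (y : R) : e @ \oo --> (0:R) ->
  (forall N, `|y - u N| <= e N) -> u @ \oo --> y.
Proof.
move=> e0 ue; apply/cvgrPdist_le => eps eps0.
have /cvgrPdist_le/(_ _ eps0) := e0; apply: filterS => N.
rewrite sub0r normrN => h; apply: (le_trans (ue N)).
exact: le_trans (ler_norm _) h.
Qed.

End Taylor1.

Section TaylorBox.
Context {R : realType} {n : nat}.
Implicit Types (a x : 'rV[R]_n) (r C M : R) (l k : 'I_n) (w rs : seq 'I_n).
Implicit Types (f g : 'rV[R]_n -> R) (y : 'I_n -> R).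
Notation e := unit_vec.
#[local] Opaque derive derivable.

(** The Taylor polynomial at a of degree less than N in each coordinate of rs,
expanded in one coordinate after the other; the remaining coordinates are those
of a. *)
Fixpoint taylor a N y rs g : R :=
  if rs is k :: rs' then
    \sum_(j < N) y k ^+ j / j`!%:R * taylor a N y rs' (dword (nseq j k) g)
  else g a.

Definition update a x rs : 'rV[R]_n := \row_i (if i \in rs then x 0 i else a 0 i).

Lemma update_cons a x k rs : k \notin rs ->
  update a x (k :: rs) = update a x rs + (x 0 k - a 0 k) *: e k.
Proof.
move=> krs; apply/rowP => i; rewrite coordDe !mxE inE.
have [->|ik] := eqVneq i k; last by rewrite mulr0 addr0.
by rewrite (negbTE krs)/=; ring.
Qed.

Lemma taylor_line (N : nat) M f z k t :
  (forall j (c : R), 0 <= c <= 1 ->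
     derivable (dword (nseq j k) f) (z + (c * t) *: e k) (e k)) ->
  (forall c : R, 0 <= c <= 1 -> `|dword (nseq N k) f (z + (c * t) *: e k)| <= M) ->
  `|f (z + t *: e k) - \sum_(j < N) t ^+ j / j`!%:R * dword (nseq j k) f z| <=
    M * (`|t| ^+ N / N`!%:R).
Proof.
move=> df fM.
(* The derivatives of c |-> f (z + c t e_k) on [0, 1]. *)
pose F j c := t ^+ j * dword (nseq j k) f (z + (c * t) *: e k).
have DF j (c : R) : 0 <= c <= 1 -> is_derive c (1:R) (F j) (F j.+1 c).
  move=> c01; pose g := dword (nseq j k) f.
  have d1 : is_derive (c * t) (1:R) (fun s : R => g (z + s *: e k))
      ('D_(e k) g (z + (c * t) *: e k)).
    by apply/is_derive_line; exact/derivableP/df.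
  have d2 : is_derive c (1:R) (fun s : R => s * t) t.
    by apply: is_derive_eq; rewrite /GRing.scale/=; ring.
  have d3 := is_deriveZ (t ^+ j) (@is_derive1_comp _ (fun s : R => g (z + s *: e k))
    (fun s : R => s * t) c _ t d1 d2).
  suff -> : F j.+1 c = t ^+ j *: ('D_(e k) g (z + (c * t) *: e k) * t) by [].
  by rewrite /F exprS /g /GRing.scale/=; ring.
have FM (c : R) : 0 <= c <= 1 -> `|F N c| <= `|t| ^+ N * M.
  by move=> c01; rewrite /F normrM normrX ler_wpM2l ?exprn_ge0// fM.
have := taylor01 DF FM (ltac:(lra) : 0 <= (1:R) <= 1).
rewrite expr1n /F /taylor_poly expr0 !mul1r /=.
set S1 := \sum_(j < N) _; set S2 := \sum_(j < N) _.
have -> : S1 = S2.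
  by apply: eq_bigr => j _; rewrite mul0r scale0r addr0 expr1n; ring.
by rewrite [ `|t| ^+ N * M]mulrC -mulrA.
Qed.

Lemma update_cube a x r rs : 0 < r -> cube a r x -> cube a r (update a x rs).
Proof.
by move=> r0 ax i; rewrite mxE; case: ifP => _; [exact: ax|rewrite subrr normr0].
Qed.

Lemma update_line_cube a x r k rs c : 0 < r -> cube a r x -> k \notin rs ->
  0 <= c <= 1 -> cube a r (update a x rs + (c * (x 0 k - a 0 k)) *: e k).
Proof.
move=> r0 ax krs /andP[c0 c1] i; rewrite coordDe.
have [->|ik] := eqVneq i k; last first.
  by rewrite mulr0 addr0; exact: update_cube.
rewrite mxE (negbTE krs) mulr1 addrAC subrr add0r normrM ger0_norm//.
by rewrite (le_lt_trans _ (ax k))// ler_piMl.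
Qed.

(** Induction on the coordinates: the error is the Taylor remainder in the first
coordinate, plus the Taylor series in this coordinate of the errors of its
coefficients, which are derivatives of f.  For this the statement covers all
derivatives of f at once; the factorials of (j + size w)! are split at the cost
of a power of 2, one factor for each coordinate already treated. *)
Lemma taylor_error a (r C rho : R) f x N : 0 < rho -> rho <= r -> 1 <= C ->
  8 * 2 ^+ n * C * rho <= 1 ->
  smooth_on (cube a r) f ->
  (forall w x, cube a r x -> `|dword w f x| <= C ^+ (size w).+1 * (size w)`!%:R) ->
  cube a rho x -> forall rs, uniq rs -> forall w,
  `|dword w f (update a x rs) -
    taylor a N (fun l => x 0 l - a 0 l) rs (dword w f)| <=
  C * 4 ^+ size rs * (2 * C * rho) ^+ N *
    ((size w)`!%:R * (2 ^+ size rs * (2 * C)) ^+ size w).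
Proof.
move=> rho0 rr C1 small sf fC ax; have C0 : 0 < C by lra.
have sub : cube a rho `<=` cube a r by exact: sub_cube.
elim=> [|k rs IH] /=.
  move=> _ w; have -> : update a x [::] = a by apply/rowP => i; rewrite mxE.
  rewrite subrr normr0 !mulr_ge0// ?exprn_ge0// ?mulr_ge0//; lra.
move=> /andP[krs urs] w; have {}IH := IH urs.
set y := x 0 k - a 0 k; set z := update a x rs.
have yr : `|y| <= rho by exact/ltW/ax.
set i := size w; set s := size rs; set q := (2 * C * rho) ^+ N.
have szrs : (s < n)%N.
  have : uniq (k :: rs) by rewrite /= krs.
  by move=> /card_uniqP/= <-; rewrite -[X in (_ <= X)%N]card_ord max_card.
pose D := 2 ^+ s * (2 * C).
have D0 : 0 < D by rewrite mulr_gt0 ?exprn_gt0//; lra.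
have q0 : 0 <= q by rewrite exprn_ge0// !mulr_ge0//; lra.
have DC : 2 * C <= D.
  by rewrite ler_peMl ?exprn_ege1//; lra.
have i0 : 0 <= i`!%:R :> R by [].
have cubeL c : 0 <= c <= 1 -> cube a r (z + (c * y) *: e k).
  by move=> c01; apply/sub/update_line_cube.
have rem : `|dword w f (z + y *: e k) -
    \sum_(j < N) y ^+ j / j`!%:R * dword (nseq j k) (dword w f) z| <=
    C * q * (i`!%:R * (2 * D) ^+ i).
  have df j c : 0 <= c <= 1 ->
     derivable (dword (nseq j k) (dword w f)) (z + (c * y) *: e k) (e k).
    by move=> c01; rewrite -dword_cat; exact/sf/cubeL.
  have fM c : 0 <= c <= 1 -> `|dword (nseq N k) (dword w f) (z + (c * y) *: e k)| <=
      C ^+ (N + i).+1 * (N + i)`!%:R.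
    move=> c01; rewrite -dword_cat; have := fC (nseq N k ++ w) _ (cubeL c c01).
    by rewrite size_cat size_nseq.
  apply: (le_trans (taylor_line df fM)).
  have f1 : (N + i)`!%:R <= 2 ^+ (N + i) * (N`!%:R * i`!%:R) :> R.
    by rewrite -natrM -natrX -natrM ler_nat fact_add_le.
  have N0 : 0 < N`!%:R :> R by rewrite ltr0n fact_gt0.
  apply: (@le_trans _ _ (C ^+ (N + i).+1 * (2 ^+ (N + i) * (N`!%:R * i`!%:R)) *
      (rho ^+ N / N`!%:R))).
    apply: ler_pM.
    - by rewrite mulr_ge0// exprn_ge0// ltW.
    - by rewrite divr_ge0// exprn_ge0.
    - by rewrite ler_wpM2l// exprn_ge0// ltW.
    - by rewrite ler_wpM2r ?invr_ge0// lerXn2r// nnegrE// ltW.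
  have -> : C ^+ (N + i).+1 * (2 ^+ (N + i) * (N`!%:R * i`!%:R)) *
      (rho ^+ N / N`!%:R) = C * q * (i`!%:R * (2 * C) ^+ i).
    by rewrite /q exprS !exprD !exprMn; field; rewrite gt_eqF.
  rewrite ler_wpM2l ?mulr_ge0//; first lra.
  by rewrite ler_wpM2l// lerXn2r// ?nnegrE; lra.
rewrite (update_cons a x krs) -/z -/y.
have tail : `|\sum_(j < N) y ^+ j / j`!%:R * dword (nseq j k) (dword w f) z -
    \sum_(j < N) y ^+ j / j`!%:R * taylor a N (fun l => x 0 l - a 0 l) rs
       (dword (nseq j k) (dword w f))| <=
    2 * (C * 4 ^+ s * q * (i`!%:R * (2 * D) ^+ i)).
  rewrite -sumrB (le_trans (ler_norm_sum _ _ _))//.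
  set E := C * 4 ^+ s * q.
  have E0 : 0 <= E.
    by apply: mulr_ge0 => //; apply: mulr_ge0; [lra|rewrite exprn_ge0].
  apply: (@le_trans _ _ (\sum_(j < N) E * (i`!%:R * (2 * D) ^+ i) * (2 * D * rho) ^+ j)).
    apply: ler_sum => j _; rewrite -mulrBr normrM.
    have := IH (nseq j k ++ w); rewrite dword_cat size_cat size_nseq -/s -/i -/z -/D -/q -/E.
    move=> IHj.
    have f1 : (j + i)`!%:R <= 2 ^+ (j + i) * (j`!%:R * i`!%:R) :> R.
      by rewrite -natrM -natrX -natrM ler_nat fact_add_le.
    have j0 : 0 < j`!%:R :> R by rewrite ltr0n fact_gt0.
    apply: (@le_trans _ _ (rho ^+ j / j`!%:R *
      (E * ((2 ^+ (j + i) * (j`!%:R * i`!%:R)) * D ^+ (j + i))))).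
      apply: ler_pM => //.
      - by rewrite normrM normrX normfV (gtr0_norm j0) ler_wpM2r ?invr_ge0//
          lerXn2r// nnegrE// ltW.
      - apply: (le_trans IHj); rewrite ler_wpM2l// ler_wpM2r//.
        by rewrite exprn_ge0// ltW.
    rewrite le_eqVlt; apply/orP; left; apply/eqP.
    by rewrite !exprD !exprMn; field; rewrite gt_eqF.
  rewrite -mulr_sumr mulrC; apply: ler_wpM2r.
    have P0 : 0 <= (2 * D) ^+ i by rewrite exprn_ge0//; lra.
    by apply: mulr_ge0 => //; exact: mulr_ge0.
  apply: sum_geometric_le2; apply/andP; split.
    by have := mulr_ge0 (ltW D0) (ltW rho0); lra.
  have : 2 ^+ s <= 2 ^+ n / 2 :> R.
    by rewrite ler_pdivlMr// -exprSr ler_eXn2l// ltr1n.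
  rewrite /D => s2.
  have : 2 ^+ s * (C * rho) <= 2 ^+ n / 2 * (C * rho).
    by rewrite ler_wpM2r// mulr_ge0//; lra.
  by lra.
set A := dword w f _ in rem *; set S1 := \sum_(j < N) _ in rem tail.
set S2 := \sum_(j < N) _ in tail *.
have -> : A - S2 = (A - S1) + (S1 - S2) by ring.
apply: (le_trans (ler_normD _ _)); apply: (le_trans (lerD rem tail)).
have -> : 2 ^+ s.+1 * (2 * C) = 2 * D by rewrite exprS /D; ring.
set T := i`!%:R * _.
have T0 : 0 <= T by apply: mulr_ge0 => //; rewrite exprn_ge0//; lra.
have -> : C * q * T + 2 * (C * 4 ^+ s * q * T) = (C * q * T) * (1 + 2 * 4 ^+ s) by ring.
have -> : C * 4 ^+ s.+1 * q * T = (C * q * T) * (4 * 4 ^+ s) by rewrite exprS; ring.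
apply: ler_wpM2l; first by apply: mulr_ge0 => //; apply: mulr_ge0 => //; lra.
have : 1 <= 4 ^+ s :> R by rewrite exprn_ege1// ler1n.
lra.
Qed.

End TaylorBox.

(** * Power series *)

Section PowerSeries.
Context {R : realType} {n : nat}.
Implicit Types (a x : 'rV[R]_n) (r C M : R) (l k : 'I_n) (w rs : seq 'I_n).
Implicit Types (f g : 'rV[R]_n -> R).
Notation multi := {ffun 'I_n -> nat}.
Notation e := unit_vec.
#[local] Opaque derive derivable.

Definition mdeg (m : multi) : nat := \sum_l m l.

Definition box_sum (c : multi -> R) (y : 'rV[R]_n) N : R :=
  \sum_(m : {ffun 'I_n -> 'I_N}) monomial (box_index m) y * c (box_index m).

(** The geometric growth of the coefficients gives absolute convergence near a; it
is kept separate because it is stable under substitution. *)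
Definition power_series_at f a := exists c, exists K A r : R,
  [/\ 0 <= K, 1 <= A, 0 < r, forall m, `|c m| <= K * A ^+ mdeg m &
   forall x, cube a r x -> box_sum c (x - a) @ \oo --> f x].

(** The derivatives are taken coordinate by coordinate, and rs lists the
coordinates from the first to the last one to be differentiated. *)
Fixpoint mword rs (m : 'I_n -> nat) : seq 'I_n :=
  if rs is k :: rs' then mword rs' m ++ nseq (m k) k else [::].

Lemma size_mword rs m : size (mword rs m) = \sum_(l <- rs) m l.
Proof.
elim: rs => [|k rs IH] /=; first by rewrite big_nil.
by rewrite big_cons size_cat size_nseq IH addnC.
Qed.

Lemma eq_mword rs m m' : (forall l, l \in rs -> m l = m' l) ->
  mword rs m = mword rs m'.
Proof.
elim: rs => //= k rs IH h; rewrite (h k (mem_head _ _)) IH// => l lrs.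
by apply: h; rewrite inE lrs orbT.
Qed.

(** Expanding the nested sums: the multi-indices of the box run over the
coordinates of rs, and are pinned to those of b elsewhere. *)
Lemma taylor_box a N (y : 'I_n -> R) rs g (b : {ffun 'I_n -> 'I_N}) : uniq rs ->
  taylor a N y rs g =
  \sum_(m : {ffun 'I_n -> 'I_N} | [forall l, (l \notin rs) ==> (m l == b l)])
    (\prod_(l <- rs) (y l ^+ m l / (m l)`!%:R)) *
      dword (mword rs (fun l => m l)) g a.
Proof.
elim: rs g b => [|k rs IH] g b /=.
  move=> _; rewrite (big_pred1 b); first by rewrite big_nil mul1r.
  move=> m; rewrite /= -[RHS]/(m == b).
  apply/idP/idP => [/forallP h|/eqP->].
    by apply/eqP/ffunP => l; exact/eqP/h.
  by apply/forallP.
move=> /andP[krs urs].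
rewrite (partition_big (fun m : {ffun 'I_n -> 'I_N} => m k) xpredT)//=.
apply: eq_bigr => j _.
pose bj : {ffun 'I_n -> 'I_N} := [ffun l => if l == k then j else b l].
rewrite (IH _ bj urs) mulr_sumr; apply: eq_big => m.
  apply/forallP/andP => [h|[/forallP h /eqP mk] l].
    split.
      apply/forallP => l; apply/implyP; rewrite inE negb_or => /andP[lk lrs].
      by have := implyP (h l) lrs; rewrite ffunE (negbTE lk).
    by have := implyP (h k) krs; rewrite ffunE eqxx.
  apply/implyP => lrs; rewrite ffunE; have [->|lk] := eqVneq l k; first exact/eqP.
  by apply: (implyP (h l)); rewrite inE negb_or lk.
move=> /forallP h; have /eqP mk := implyP (h k) krs.
rewrite ffunE eqxx in mk.
by rewrite big_cons mk mulrA dword_cat.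
Qed.

(** Multinomial coefficients grow at most geometrically, so the factorial of the
degree can be replaced by the product of factorials. *)
Lemma mfact_le rs (m : 'I_n -> nat) :
  ((\sum_(l <- rs) m l)`! <= 2 ^ (size rs * \sum_(l <- rs) m l) * \prod_(l <- rs) (m l)`!)%N.
Proof.
elim: rs => [|k rs IH]; first by rewrite !big_nil.
rewrite !big_cons; set S := (\sum_(l <- rs) m l)%N in IH *.
apply: (leq_trans (fact_add_le _ _)).
set P := (\prod_(l <- rs) (m l)`!)%N in IH *.
apply: (@leq_trans (2 ^ (m k + S) * ((m k)`! * (2 ^ (size rs * S) * P)))%N).
  by rewrite !leq_mul2l IH !orbT.
rewrite [X in (_ * X <= _)%N]mulnCA mulnA leq_mul2r; apply/orP; right.
by rewrite -expnD leq_exp2l//= mulSn leq_add2l leq_mul2l leq_addl orbT.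
Qed.

Definition taylor_coef g a (m : multi) : R :=
  (\prod_l ((m l)`!%:R)^-1) * dword (mword (enum 'I_n) m) g a.

(** The radius is chosen so small that 2 C rho <= 1 / 4, which makes the errors of
the box Taylor polynomials tend to 0 geometrically. *)
Lemma cauchy_bounds_taylor a f : cauchy_bounds a f -> exists K A r : R,
  [/\ 0 <= K, 1 <= A, 0 < r, forall m, `|taylor_coef f a m| <= K * A ^+ mdeg m &
   forall x, cube a r x -> box_sum (taylor_coef f a) (x - a) @ \oo --> f x].
Proof.
move=> [r [C [r0 C1 sf fC]]]; have C0 : 0 < C by lra.
have p2 : 0 < 2 ^+ n :> R by rewrite exprn_gt0.
pose rho := Num.min r (8 * 2 ^+ n * C)^-1.
have D0 : 0 < 8 * 2 ^+ n * C by rewrite !mulr_gt0.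
have rho0 : 0 < rho by rewrite lt_min r0 invr_gt0.
have rr : rho <= r by rewrite ge_min lexx.
have small : 8 * 2 ^+ n * C * rho <= 1.
  rewrite -[leRHS](mulfV (lt0r_neq0 D0)).
  by apply: ler_wpM2l; [exact: ltW|rewrite ge_min lexx orbT].
have p1 : 1 <= 2 ^+ n :> R by rewrite exprn_ege1// ler1n.
exists C, (2 ^+ n * C), rho; split => //; first exact: ltW.
- by nra.
- move=> m; rewrite /taylor_coef.
  have sz : size (mword (enum 'I_n) m) = mdeg m by rewrite size_mword big_enum.
  rewrite normrM.
  have F0 : 0 < \prod_l ((m l)`!%:R) :> R.
    by apply: prodr_gt0 => l _; rewrite ltr0n fact_gt0.
  rewrite prodfV normfV (gtr0_norm F0) ler_pdivrMl//.
  apply: (le_trans (fC _ _ (cube_center a r0))); rewrite sz.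
  have h : (mdeg m)`!%:R <= 2 ^+ (n * mdeg m) * \prod_l ((m l)`!%:R) :> R.
    have := mfact_le (enum 'I_n) m; rewrite !big_enum -cardE card_ord /=.
    by rewrite -natrX -natr_prod -natrM ler_nat.
  apply: (le_trans (ler_wpM2l (exprn_ge0 _ (ltW C0)) h)).
  by rewrite exprMn -exprM exprS; lra.
(* The box with N = 0 is empty and has no multi-index b to start from. *)
- move=> x ax; rewrite -(cvg_shiftS (box_sum _ _)) /=.
  pose K := C * 4 ^+ n; pose q := 2 * C * rho.
  have q0 : 0 <= q by rewrite /q !mulr_ge0// ltW.
  have q1 : q <= 1 / 4.
    have : 0 < C * rho by rewrite mulr_gt0.
    by rewrite /q; move: small; nra.
  apply: (@cvg_of_dist _ _ (fun N => K * q ^+ N.+1)).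
    rewrite (_ : (fun N => K * q ^+ N.+1) = geometric (K * q) q); last first.
      by apply/funext => N; rewrite /= exprS mulrA.
    by apply: cvg_geometric; rewrite ger0_norm//; lra.
  move=> N; have := taylor_error N.+1 rho0 rr C1 small sf fC ax (enum_uniq 'I_n) [::].
  rewrite /= mulr1 mulr1 size_enum_ord -/K -/q.
  have -> : update a x (enum 'I_n) = x by apply/rowP => i; rewrite mxE mem_enum.
  suff -> : taylor a N.+1 (fun l => x 0 l - a 0 l) (enum 'I_n) f =
      box_sum (taylor_coef f a) (x - a) N.+1 by [].
  rewrite (taylor_box _ _ _ [ffun=> ord0] (enum_uniq _)) /box_sum.
  apply: eq_big => [m|m _].
    by apply/forallP => l; rewrite mem_enum.
  rewrite /monomial /taylor_coef big_enum /= big_split/= -mulrA.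
  congr (_ * (_ * _)).
  - by apply: eq_bigr => l _; rewrite !mxE ffunE.
  - by apply: eq_bigr => l _; rewrite ffunE.
  - by congr dword; apply: eq_mword => l _; rewrite ffunE.
Qed.

Lemma cauchy_bounds_power_series a f : cauchy_bounds a f -> power_series_at f a.
Proof. by move=> /cauchy_bounds_taylor; exists (taylor_coef f a). Qed.

End PowerSeries.

Section PowerSeriesSum.
Context {R : realType} {n : nat}.
Notation multi := {ffun 'I_n -> nat}.
Implicit Types (a x y : 'rV[R]_n) (f g : 'rV[R]_n -> R) (m : multi).

Lemma power_seriesD a f g : power_series_at f a -> power_series_at g a ->
  power_series_at (fun x => f x + g x) a.
Proof.
move=> [c [K [A [r [K0 A1 r0 cK cf]]]]] [d [L [B [s [L0 B1 s0 dL dg]]]]].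
exists (fun m => c m + d m), (K + L), (A + B), (Num.min r s); split.
- exact: addr_ge0.
- by lra.
- by rewrite lt_min r0.
- move=> m; apply: (le_trans (ler_normD _ _)); rewrite mulrDl lerD//.
    apply: (le_trans (cK m)); rewrite ler_wpM2l// lerXn2r// ?nnegrE; lra.
  apply: (le_trans (dL m)); rewrite ler_wpM2l// lerXn2r// ?nnegrE; lra.
- move=> x ax; have ar : cube a r x by apply: sub_cube ax; rewrite ge_min lexx.
  have as' : cube a s x by apply: sub_cube ax; rewrite ge_min lexx orbT.
  have -> : box_sum (fun m => c m + d m) (x - a) =
      box_sum c (x - a) + box_sum d (x - a).
    apply/funext => N; rewrite /box_sum !fctE -big_split/=.
    by apply: eq_bigr => i _; rewrite mulrDr.
  exact: (cvgD (cf x ar) (dg x as')).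
Qed.

Lemma monomial_bound y m q : (forall l, `|y 0 l| <= q) -> 0 <= q ->
  `|monomial m y| <= q ^+ mdeg m.
Proof.
move=> yq q0; rewrite /monomial normr_prod /mdeg -prodrXr.
apply: ler_prod => l _; rewrite normr_ge0 normrX lerXn2r ?nnegrE//.
Qed.

Lemma box_sum_geometric N (q : R) : 0 <= q <= 1 / 2 ->
  \sum_(m : {ffun 'I_n -> 'I_N}) q ^+ mdeg (box_index m) <= 2 ^+ n.
Proof.
move=> q01.
have -> : \sum_(m : {ffun 'I_n -> 'I_N}) q ^+ mdeg (box_index m) =
    \prod_(l < n) \sum_(j < N) q ^+ j.
  rewrite bigA_distr_bigA; apply: eq_bigr => m _.
  by rewrite /mdeg -prodrXr; apply: eq_bigr => l _; rewrite ffunE.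
rewrite -[X in _ <= _ ^+ X]card_ord -prodr_const.
apply: ler_prod => l _; rewrite sum_geometric_le2// andbT.
by apply: sumr_ge0 => j _; rewrite exprn_ge0//; case/andP: q01.
Qed.

Lemma ler_sum_sub (T : eqType) (s t : seq T) (F : T -> R) : uniq s -> uniq t ->
  {subset s <= t} -> (forall i, 0 <= F i) ->
  \sum_(i <- s) F i <= \sum_(i <- t) F i.
Proof.
move=> us ut st F0.
rewrite (bigID (mem s) xpredT _ (r := t))/= -[leLHS]addr0 lerD//.
  rewrite -[leRHS]big_filter le_eqVlt; apply/orP; left; apply/eqP; apply: perm_big.
  apply: uniq_perm => //; first exact: filter_uniq.
  by move=> i; rewrite mem_filter; case: (boolP (i \in s)) => // /st ->.
by apply: sumr_ge0.
Qed.

(** Every finite set of multi-indices is contained in a box, and over a box the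
sum of q^|m| is a product of geometric sums. *)
Lemma summable_geometric (F : multi -> R) (K q : R) : 0 <= K -> 0 <= q <= 1 / 2 ->
  (forall m, 0 <= F m <= K * q ^+ mdeg m) ->
  summable [set: multi] (fun m => (F m)%:E).
Proof.
move=> K0 q01 FK; rewrite /summable; apply: (@le_lt_trans _ _ (K * 2 ^+ n)%:E);
  last exact: ltry.
apply: ge_ereal_sup => _ [X [finX _] <-].
rewrite fsbig_finite//=.
pose N := (\max_(m <- fset_set X) \max_l m l).+1.
have mN m l : m \in fset_set X -> (m l < N)%N.
  move=> mX; rewrite ltnS.
  apply: (leq_trans (leq_bigmax l)).
  exact: (leq_bigmax_seq m mX isT).
have -> : (\sum_(m <- fset_set X) `|(F m)%:E| = (\sum_(m <- fset_set X) F m)%:E)%E.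
  rewrite -sumEFin; apply: eq_bigr => m _; rewrite abse_EFin ger0_norm//.
  by case/andP: (FK m).
rewrite lee_fin.
pose t := [seq box_index m | m : {ffun 'I_n -> 'I_N}].
have box_inj : injective (@box_index n N).
  by move=> m m' /ffunP h; apply/ffunP => l; apply/val_inj; have := h l; rewrite !ffunE.
have ut : uniq t by rewrite map_inj_uniq// enum_uniq.
have st : {subset fset_set X <= t}.
  move=> m mX; apply/mapP; exists [ffun l => Ordinal (mN m l mX)].
    by rewrite mem_enum.
  by apply/ffunP => l; rewrite !ffunE.
apply: (le_trans (ler_sum_sub (fset_uniq _) ut st (fun m => (andP (FK m)).1))).
rewrite big_map big_enum/=.
apply: (@le_trans _ _ (\sum_(m : {ffun 'I_n -> 'I_N}) K * q ^+ mdeg (box_index m))).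
  by apply: ler_sum => m _; case/andP: (FK (box_index m)).
by rewrite -mulr_sumr ler_wpM2l// box_sum_geometric.
Qed.

Lemma power_series_real_analytic p (F : 'rV[R]_n -> 'rV[R]_p) a :
  (forall j, power_series_at (fun x => F x 0 j) a) -> real_analytic_at F a.
Proof.
move=> /choice[c /choice[K /choice[A /choice[r h]]]].
pose c' m := \row_j c j m.
pose K' := \sum_j K j; pose A' := 1 + \sum_j A j.
pose r' := Num.min (\big[Num.min/1]_j r j) (2 * A')^-1.
have K0 j : 0 <= K j by have [] := h j.
have A1 j : 1 <= A j by have [] := h j.
have A'1 : 1 <= A'.
  by rewrite lerDl; apply: sumr_ge0 => j _; rewrite (le_trans _ (A1 j)).
have AA j : A j <= A'.
  rewrite /A' (bigD1 j)//= addrCA lerDl addr_ge0//; apply: sumr_ge0 => i _.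
  by rewrite (le_trans _ (A1 i)).
have K'0 : 0 <= K' by exact: sumr_ge0.
have r'0 : 0 < r'.
  rewrite lt_min invr_gt0 mulr_gt0//; last lra.
  by rewrite andbT; apply: lt_bigmin => // j _; have [] := h j.
exists c', r' => // x; rewrite ball_cube// => ax; split.
  apply: (@summable_geometric _ K' (A' * r')) => //.
    rewrite mulr_ge0//; [|lra|exact: ltW]; rewrite /=.
    have : r' <= (2 * A')^-1 by rewrite ge_min lexx orbT.
    by rewrite -[_^-1]mul1r ler_pdivlMr; [lra|lra].
  move=> m; rewrite normr_ge0/= normrZ.
  have cm : `|c' m| <= K' * A' ^+ mdeg m.
    rewrite [leLHS]/Num.Def.normr/= mx_normrE bigmax_le//.
      by rewrite mulr_ge0// exprn_ge0//; lra.
    move=> [i j] _; rewrite mxE/=; have [_ _ _ cK _] := h j.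
    apply: (le_trans (cK m)); apply: ler_pM => //.
    - by rewrite exprn_ge0// (le_trans _ (A1 j)).
    - by rewrite /K' (bigD1 j)//= lerDl; exact: sumr_ge0.
    - by rewrite lerXn2r// nnegrE ?(le_trans _ (A1 j))//; lra.
  have mm : `|monomial m (x - a)| <= r' ^+ mdeg m.
    by apply: monomial_bound => [l|]; [rewrite !mxE ltW|exact: ltW].
  by rewrite exprMn mulrA [leRHS]mulrC; apply: ler_pM.
have E : (fun N => \sum_(m : {ffun 'I_n -> 'I_N})
    monomial (box_index m) (x - a) *: c' (box_index m)) =
  (fun N => \row_j box_sum (c j) (x - a) N).
  apply/funext => N; apply/rowP => j; rewrite summxE mxE.
  by apply: eq_bigr => m _; rewrite !mxE.
rewrite E; apply/cvgrPdist_le => eps eps0.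
have cj j : \forall N \near \oo, `|F x 0 j - box_sum (c j) (x - a) N| <= eps.
  have [_ _ _ _ hc] := h j.
  have ar : cube a (r j) x.
    apply: sub_cube ax; rewrite ge_min; apply/orP; left.
    exact: bigmin_le_cond.
  by have /cvgrPdist_le/(_ _ eps0) := hc x ar.
have : \forall N \near \oo, forall j, `|F x 0 j - box_sum (c j) (x - a) N| <= eps.
  exact: filter_forall.
apply: filterS => N hN.
rewrite [leLHS]/Num.Def.normr/= mx_normrE bigmax_le//; first exact: ltW.
by move=> [i j] _; rewrite !mxE/= (ord1 i).
Qed.

End PowerSeriesSum.

Lemma power_series_eq (R : realType) (n : nat) (a : 'rV[R]_n) (r : R)
    (f g : 'rV[R]_n -> R) : 0 < r ->
  (forall x, cube a r x -> f x = g x) -> power_series_at f a -> power_series_at g a.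
Proof.
move=> r0 fg [c [K [A [s [K0 A1 s0 cK cf]]]]].
exists c, K, A, (Num.min r s); split => //; first by rewrite lt_min r0.
move=> x ax; rewrite -fg; last by apply: sub_cube ax; rewrite ge_min lexx.
by apply: cf; apply: sub_cube ax; rewrite ge_min lexx orbT.
Qed.

(** * Derivatives given by a recursion *)

Section Recursion.
Context {R : realType} {n : nat}.
Implicit Types (x : 'rV[R]_n) (l : 'I_n) (v w : seq 'I_n).
Implicit Types (f g : 'rV[R]_n -> R) (U : set 'rV[R]_n).
Notation e := unit_vec.
#[local] Opaque derive derivable.

Definition smooth_upto N U f :=
  forall v x l, (size v <= N)%N -> U x -> derivable (dword v f) x (e l).

Lemma smooth_upto_lin N U c d f g : open U ->
  smooth_upto N U f -> smooth_upto N U g ->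
  smooth_upto N U (fun x => c * f x + d * g x) /\
  (forall v x, (size v <= N.+1)%N -> U x ->
    dword v (fun x => c * f x + d * g x) x = c * dword v f x + d * dword v g x).
Proof.
move=> oU sf sg.
have E v : (size v <= N.+1)%N -> forall x, U x ->
    dword v (fun x => c * f x + d * g x) x = c * dword v f x + d * dword v g x.
  elim: v => [|l v IH]//= vN x Ux.
  rewrite (derive_eq_on _ oU Ux (IH (ltnW vN))).
  by have [_ ->] := derive_lin c d (sf v x l vN Ux) (sg v x l vN Ux).
split; last by move=> v x vN; exact: E.
move=> v x l vN Ux.
have [d1 _] := derive_lin c d (sf v x l vN Ux) (sg v x l vN Ux).
apply: (derivable_eq_on oU Ux _ d1) => y Uy.
by rewrite E// ltnW.
Qed.

Lemma smooth_upto_eq N U f g : open U -> (forall x, U x -> f x = g x) ->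
  smooth_upto N U f -> smooth_upto N U g.
Proof.
move=> oU fg sf v x l vN Ux; apply: (derivable_eq_on oU Ux _ (sf v x l vN Ux)).
by move=> y Uy; exact: dword_eq_on oU fg _ Uy.
Qed.

Lemma smooth_upto_step N U f : (forall x l, U x -> derivable f x (e l)) ->
  (forall l, smooth_upto N U ('D_(e l) f)) -> smooth_upto N.+1 U f.
Proof.
move=> df sdf v x l; case: (lastP v) => [|v' k] vN Ux; first exact: df.
rewrite -cats1 dword_cat; apply: sdf => //.
by move: vN; rewrite size_rcons ltnS.
Qed.

Variables (I : Type) (U : set 'rV[R]_n) (T : I -> 'rV[R]_n -> R).
Variables (deg ord : I -> nat) (K C : R).
Hypotheses (oU : open U) (K1 : 1 <= K) (C1 : 1 <= C).

Let W (d o : nat) := K ^+ d * (C ^+ o.+1 * o`!%:R).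

Hypothesis T_bound : forall i x, U x -> `|T i x| <= W (deg i) (ord i).

(** The rule for differentiating the member T i of a family of functions.  The
number deg i bounds the powers of functions of size K in T i, and ord i is the
number of derivatives of the underlying function; the first two terms come from
differentiating the powers and only the third one differentiates the underlying
function. *)
Record derivation i l := Derivation {
  c1 : R; c2 : R; c3 : R; i1 : I; i2 : I; i3 : I;
  deg1 : (deg i1 <= deg i + 3)%N; deg2 : (deg i2 <= deg i + 3)%N;
  deg3 : (deg i3 <= deg i + 3)%N;
  ord1 : (ord i1 <= ord i)%N; ord2 : (ord i2 <= ord i)%N;
  ord3' : (ord i3 <= (ord i).+1)%N;
  c12 : `|c1| + `|c2| <= (deg i)%:R; c3le : `|c3| <= 1;
  T_derive : forall x, U x ->
     is_derive x (e l) (T i) (c1 * T i1 x + c2 * T i2 x + c3 * T i3 x)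
}.

Hypothesis deriv : forall i l, derivation i l.

Lemma recursion_smooth N i : smooth_upto N U (T i).
Proof.
elim: N i => [|N IH] i.
  move=> v x l; rewrite leqn0 size_eq0 => /eqP-> Ux /=.
  by have [] := T_derive (deriv i l) Ux.
apply: smooth_upto_step => [x l Ux|l].
  by have [] := T_derive (deriv i l) Ux.
have [a1 a2 a3 j1 j2 j3 _ _ _ _ _ _ _ _ D] := deriv i l.
have [s12 _] := smooth_upto_lin a1 a2 oU (IH j1) (IH j2).
have [s123 _] := smooth_upto_lin 1 a3 oU s12 (IH j3).
apply: (smooth_upto_eq oU _ s123) => x Ux.
by have [_ ->] := D x Ux; rewrite mul1r.
Qed.

Let W_mono d o d' o' : (d <= d')%N -> (o <= o')%N -> W d o <= W d' o'.
Proof.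
move=> dd oo; rewrite /W; apply: ler_pM.
- by rewrite exprn_ge0//; move: K1; lra.
- by rewrite mulr_ge0// exprn_ge0//; move: C1; lra.
- exact: ler_weXn2l.
- apply: ler_pM => //; first by rewrite exprn_ge0//; move: C1; lra.
    exact: ler_weXn2l.
  by rewrite ler_nat leq_fact.
Qed.

Let W_gt0 d o : 0 < W d o.
Proof.
by rewrite /W !mulr_gt0// ?exprn_gt0 ?ltr0n ?fact_gt0//; move: K1 C1; lra.
Qed.

(** Each derivative multiplies the bound by at most 4 K^3 C (k + 1), where k controls
both the number of derivatives and a third of the degree and grows by one: the
degree enters the coefficients only linearly, which is what turns a product of
N factors into (k + N)! / k! and not into a higher power of N!. *)
Lemma recursion_bound N : forall i k v x, (deg i <= 3 * k + 2)%N ->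
  (ord i <= k)%N -> size v = N -> U x ->
  `|dword v (T i) x| <=
    (4 * K ^+ 3 * C) ^+ N * W (deg i) (ord i) * ((k + N)`!%:R / k`!%:R).
Proof.
elim: N => [|N IH] i k v x dk ok.
  move=> /size0nil-> Ux; rewrite expr0 mul1r addn0 divff ?mulr1; first exact: T_bound.
  by rewrite pnatr_eq0 -lt0n fact_gt0.
case: (lastP v) => // v' l; rewrite size_rcons => -[vN] Ux.
rewrite -cats1 dword_cat /=.
have [a1 a2 a3 j1 j2 j3 d1 d2 d3 o1 o2 o3 a12 a3le D] := deriv i l.
have [s12 E12] := smooth_upto_lin a1 a2 oU (@recursion_smooth N j1) (@recursion_smooth N j2).
have [_ E123] := smooth_upto_lin 1 a3 oU s12 (@recursion_smooth N j3).
have vN1 : (size v' <= N.+1)%N by rewrite vN.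
have DT y : U y -> 'D_(e l) (T i) y = 1 * (a1 * T j1 y + a2 * T j2 y) + a3 * T j3 y.
  by move=> Uy; have [_ ->] := D y Uy; rewrite mul1r.
rewrite (dword_eq_on v' oU DT Ux) (E123 _ _ vN1 Ux) (E12 _ _ vN1 Ux) mul1r.
set Q := 4 * K ^+ 3 * C; set F := (k.+1 + N)`!%:R / k.+1`!%:R : R.
have K0 : 0 <= K by move: K1; lra.
have C0 : 0 <= C by move: C1; lra.
have Q0 : 0 <= Q ^+ N by rewrite exprn_ge0// /Q !mulr_ge0// exprn_ge0.
have F0 : 0 <= F by rewrite divr_ge0.
(* The degree has grown by at most 3 and the order by at most 1, so the induction
   hypothesis applies with k + 1. *)
have bound j o : (deg j <= deg i + 3)%N -> (ord j <= o)%N -> (o <= k.+1)%N ->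
    `|dword v' (T j) x| <= Q ^+ N * W (deg i + 3) o * F.
  move=> dj oj o_k; apply: (le_trans (IH j k.+1 v' x _ _ vN Ux)).
  - by apply: (leq_trans dj); rewrite mulnS addnC -addnA leq_add2l.
  - exact: leq_trans o_k.
  - by rewrite -/Q -/F ler_wpM2r// ler_wpM2l// W_mono.
have b1 := bound j1 (ord i) d1 o1 (leqW ok).
have b2 := bound j2 (ord i) d2 o2 (leqW ok).
have b3 := bound j3 (ord i).+1 d3 o3 ok.
set w := W (deg i) (ord i).
have w0 : 0 < w by exact: W_gt0.
have W1 : W (deg i + 3) (ord i) = K ^+ 3 * w by rewrite /w /W exprD; ring.
have W2 : W (deg i + 3) (ord i).+1 = K ^+ 3 * w * (C * (ord i).+1%:R).
  by rewrite /w /W exprD factS natrM (exprS C (ord i).+1); ring.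
rewrite W1 in b1 b2; rewrite W2 in b3.
pose B := Q ^+ N * (K ^+ 3 * w) * F.
have B0 : 0 <= B.
  by apply: mulr_ge0 => //; apply: mulr_ge0 => //; apply: mulr_ge0;
    [exact: exprn_ge0|exact: ltW].
have m1 : `|a1 * dword v' (T j1) x| <= `|a1| * B by rewrite normrM ler_wpM2l.
have m2 : `|a2 * dword v' (T j2) x| <= `|a2| * B by rewrite normrM ler_wpM2l.
have m3 : `|a3 * dword v' (T j3) x| <= B * (C * (ord i).+1%:R).
  rewrite normrM -[leRHS]mul1r; apply: ler_pM => //.
  by apply: (le_trans b3); rewrite /B le_eqVlt; apply/orP; left; apply/eqP; ring.
apply: (le_trans (ler_normD _ _)); apply: (le_trans (lerD (ler_normD _ _) (lexx _))).
apply: (le_trans (lerD (lerD m1 m2) m3)).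
have o1k : (ord i).+1%:R <= k.+1%:R :> R by rewrite ler_nat.
have dki : (deg i)%:R <= 3 * k.+1%:R :> R.
  by rewrite -natrM ler_nat (leq_trans dk)// mulnS addnC leq_add2r.
have kF : (k + N.+1)`!%:R / k`!%:R = F * k.+1%:R.
  rewrite /F addnS -addSn factS natrM.
  have k0 : k`!%:R != 0 :> R by rewrite pnatr_eq0 -lt0n fact_gt0.
  have k1 : k.+1%:R != 0 :> R by rewrite pnatr_eq0.
  by move: k0 k1 (_`!%:R); move: k`!%:R k.+1%:R => p q p0 q0 z; field; rewrite p0 q0.
have -> : Q ^+ N.+1 * w * ((k + N.+1)`!%:R / k`!%:R) = B * (C * (4 * k.+1%:R)).
  by rewrite kF /B exprSr {2}/Q; clearbody w F; move: (Q ^+ N) => Z; ring.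
have : `|a1| * B + `|a2| * B + B * (C * (ord i).+1%:R) =
  B * (`|a1| + `|a2| + C * (ord i).+1%:R) by ring.
move=> ->; apply: ler_wpM2l => //.
have k10 : 1 <= k.+1%:R :> R by rewrite ler1n.
have : C * (ord i).+1%:R <= C * k.+1%:R by rewrite ler_wpM2l.
have : 1 * (3 * k.+1%:R) <= C * (3 * k.+1%:R) by rewrite ler_wpM2r// mulr_ge0.
by move: a12 dki; lra.
Qed.

End Recursion.

(** * Cylindrical coordinates away from the axis *)

Section Cylindrical.
Context {R : realType}.
Implicit Types (y a : 'rV[R]_4) (G g : 'rV[R]_3 -> R) (w : seq 'I_3).
Notation e := unit_vec.
#[local] Opaque derive derivable.

Definition rho y : R := Num.sqrt (y 0 2 ^+ 2 + y 0 3 ^+ 2).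

Definition cyl y : 'rV[R]_3 := \row_(l < 3) nth 0 [:: y 0 0; y 0 1; rho y] l.

Lemma rho_eq0 y : rho y = 0 -> y 0 2 = 0 /\ y 0 3 = 0.
Proof.
move/eqP; rewrite /rho sqrtr_eq0 => h.
have : y 0 2 ^+ 2 + y 0 3 ^+ 2 == 0 by rewrite eq_le h addr_ge0// sqr_ge0.
by rewrite paddr_eq0 ?sqr_ge0// !sqrf_eq0 => /andP[/eqP-> /eqP->].
Qed.

Lemma is_derive_monomial4 (p q t : nat) (A B Z D : R -> R) (a b z d : R) :
  is_derive (0:R) (1:R) A a -> is_derive (0:R) (1:R) B b ->
  is_derive (0:R) (1:R) Z z -> is_derive (0:R) (1:R) D d -> Z 0 != 0 ->
  is_derive (0:R) (1:R) (fun s : R => A s ^+ p * B s ^+ q * (Z s)^-1 ^+ t * D s)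
    (p%:R * A 0 ^+ p.-1 * a * B 0 ^+ q * (Z 0)^-1 ^+ t * D 0 +
     q%:R * A 0 ^+ p * B 0 ^+ q.-1 * b * (Z 0)^-1 ^+ t * D 0 -
     t%:R * z * A 0 ^+ p * B 0 ^+ q * (Z 0)^-1 ^+ t.+1 * D 0 +
     A 0 ^+ p * B 0 ^+ q * (Z 0)^-1 ^+ t * d).
Proof.
move=> hA hB hZ hD Z0.
have hV := is_deriveV Z0 hZ.
have h := is_deriveM (is_deriveM (is_deriveM (is_deriveX p hA) (is_deriveX q hB))
  (is_deriveX t hV)) hD.
have -> : (fun s : R => A s ^+ p * B s ^+ q * (Z s)^-1 ^+ t * D s) =
  (A ^+ p * B ^+ q * (fun s => (Z s)^-1) ^+ t * D).
  by apply/funext => s; rewrite !fctE.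
apply: is_derive_eq h _; rewrite !fctE.
have E (c : R) : c *: (1:R) = c by rewrite /GRing.scale/= mulr1.
have S (c d' : R) : c *: d' = c * d' by [].
rewrite !S; set Ap := A 0 ^+ p; set Ap' := A 0 ^+ p.-1; set Bq := B 0 ^+ q.
set Bq' := B 0 ^+ q.-1; clearbody Ap Ap' Bq Bq'.
have -> : t%:R * (Z 0)^-1 ^+ t.-1 * (- Z 0 ^- 2 * z) = - (t%:R * z * (Z 0)^-1 ^+ t.+1).
  case: t => [|t]; first by rewrite !mul0r oppr0.
  by rewrite !exprS expr0 /=; move: (_^-1 ^+ t) => u; field.
by move: ((Z 0)^-1 ^+ t) ((Z 0)^-1 ^+ t.+1) => u u'; ring.
Qed.

(** The functions that arise from y |-> G (cyl y) and its products with the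
cosine and sine y_2 / rho and y_3 / rho on differentiating repeatedly. *)
Definition cyl_term G (i : nat * nat * nat * seq 'I_3) y : R :=
  let: (p, q, t, w) := i in
  y 0 2 ^+ p * y 0 3 ^+ q * (rho y)^-1 ^+ t * dword w G (cyl y).

Lemma rho_shift y (l : 'I_4) (s : R) : (l < 2)%N -> rho (y + s *: e l) = rho y.
Proof.
move=> l2; have h (c : 'I_4) : (2 <= c)%N -> (c == l) = false.
  by move=> c2; apply/eqP => E; move: l2; rewrite -E ltnNge c2.
by rewrite /rho !coordDe !h// !mulr0 !addr0.
Qed.

Lemma is_derive_coord_line y (l c : 'I_4) :
  is_derive (0:R) (1:R) (fun s : R => (y + s *: e l) 0 c) (c == l)%:R.
Proof.
have -> : (fun s : R => (y + s *: e l) 0 c) = cst (y 0 c) + id * cst (c == l)%:R.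
  by apply/funext => s; rewrite coordDe.
have h := is_deriveD (is_derive_cst (y 0 c) (0:R) (1:R))
  (is_deriveM (is_derive_id (0:R) (1:R)) (is_derive_cst ((c == l)%:R : R) (0:R) (1:R))).
by apply: is_derive_eq h _; rewrite /cst /= scaler0 !add0r /GRing.scale/= mulr1.
Qed.

Lemma is_derive_rho_line y (l : 'I_4) : 0 < rho y ->
  is_derive (0:R) (1:R) (fun s : R => rho (y + s *: e l))
    ((y 0 2 * (2 == l)%:R + y 0 3 * (3 == l)%:R) / rho y).
Proof.
move=> r0; pose N (s : R) := (y + s *: e l) 0 2 ^+ 2 + (y + s *: e l) 0 3 ^+ 2.
have N0 : N 0 = y 0 2 ^+ 2 + y 0 3 ^+ 2 by rewrite /N scale0r addr0.
have hN : is_derive (0:R) (1:R) N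
    (2 * (y 0 2 * (2 == l)%:R + y 0 3 * (3 == l)%:R)).
  have := is_deriveD (is_deriveX 2 (is_derive_coord_line y l 2))
     (is_deriveX 2 (is_derive_coord_line y l 3)).
  move=> h; apply: is_derive_eq h _.
  by rewrite scale0r addr0 /GRing.scale/= !expr1; ring.
have Npos : 0 < N 0 by rewrite N0; move: r0; rewrite /rho sqrtr_gt0.
have := is_derive1_comp (is_derive1_sqrt Npos) hN.
rewrite N0 -/(rho y) => h; apply: is_derive_eq h _.
by have := lt0r_neq0 r0; move: (rho y) => u u0; field.
Qed.

(** The derivatives of rho are y_2 / rho and y_3 / rho, so that a negative power
of rho contributes a term with exponent t + 2 and one more factor y_l. *)
Lemma is_derive_cyl_term G p q t w y (l : 'I_4) d : 0 < rho y ->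
  is_derive (0:R) (1:R) (fun s : R => dword w G (cyl (y + s *: e l))) d ->
  is_derive y (e l) (cyl_term G (p, q, t, w))
    (p%:R * (2 == l)%:R * cyl_term G (p.-1, q, t, w) y +
     q%:R * (3 == l)%:R * cyl_term G (p, q.-1, t, w) y -
     t%:R * (2 == l)%:R * cyl_term G (p.+1, q, t.+2, w) y -
     t%:R * (3 == l)%:R * cyl_term G (p, q.+1, t.+2, w) y +
     y 0 2 ^+ p * y 0 3 ^+ q * (rho y)^-1 ^+ t * d).
Proof.
move=> r0 hd; apply/is_derive_line0.
have y0 : y + 0 *: e l = y by rewrite scale0r addr0.
have h := is_derive_monomial4 p q t (is_derive_coord_line y l 2)
  (is_derive_coord_line y l 3) (is_derive_rho_line l r0) hd.
rewrite y0 in h; apply: is_derive_eq (h (lt0r_neq0 r0)) _.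
by rewrite /cyl_term !exprS; ring.
Qed.

Lemma cyl_shift y (l : 'I_4) (s : R) : (l < 2)%N ->
  cyl (y + s *: e l) = cyl y + s *: e (inord l).
Proof.
move=> l2; apply/rowP => c; rewrite coordDe !mxE rho_shift//.
case: l l2 => -[|[|//]] lt4 _; case: c => -[|[|[|//]]] lt3 /=;
  rewrite -?val_eqE /= ?inordK //= ?mulr0 ?mulr1 ?addr0 ?mxE//= ?addr0 ?mulr0 ?mulr1 ?addr0//.
Qed.

(** Moving in the plane of y_2 and y_3 changes only the last cylindrical
coordinate, which reduces the chain rule to one variable. *)
Lemma cyl_polar_shift y (l : 'I_4) (s : R) : (2 <= l)%N ->
  cyl (y + s *: e l) = cyl y + (rho (y + s *: e l) - rho y) *: e 2.
Proof.
move=> l2; apply/rowP => c; rewrite coordDe !mxE.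
have h (k : 'I_4) : (k < 2)%N -> (k == l) = false.
  by move=> k2; apply/eqP => E; move: k2; rewrite E ltnNge l2.
case: c => -[|[|[|//]]] lt3 /=;
  rewrite ?coordDe ?h//= -?val_eqE /= ?mulr0 ?mulr1 ?addr0 ?mxE//= ?addr0 ?h ?mulr0 ?addr0// subrKC//.
Qed.

Lemma is_derive_cyl_flat g y (l : 'I_4) : (l < 2)%N ->
  derivable g (cyl y) (e (inord l)) ->
  is_derive (0:R) (1:R) (fun s : R => g (cyl (y + s *: e l)))
    ('D_(e (inord l)) g (cyl y)).
Proof.
move=> l2 dg.
have -> : (fun s : R => g (cyl (y + s *: e l))) = (fun s => g (cyl y + s *: e (inord l))).
  by apply/funext => s; rewrite cyl_shift.
by apply/is_derive_line0; split.
Qed.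

Lemma is_derive_cyl_polar g y (l : 'I_4) : (2 <= l)%N -> 0 < rho y ->
  derivable g (cyl y) (e 2) ->
  is_derive (0:R) (1:R) (fun s : R => g (cyl (y + s *: e l)))
    (y 0 l / rho y * 'D_(e 2) g (cyl y)).
Proof.
move=> l2 r0 dg.
pose H (s : R) := g (cyl y + s *: e 2).
have dH : is_derive (0:R) (1:R) H ('D_(e 2) g (cyl y)).
  by apply/is_derive_line0; split.
pose Z (s : R) := rho (y + s *: e l) - rho y.
have Z0 : Z 0 = 0 by rewrite /Z scale0r addr0 subrr.
have dZ : is_derive (0:R) (1:R) Z (y 0 l / rho y).
  have -> : Z = (fun s : R => rho (y + s *: e l)) + cst (- rho y) by [].
  have h := is_deriveD (is_derive_rho_line l r0) (is_derive_cst (- rho y) (0:R) (1:R)).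
  apply: is_derive_eq h _; rewrite addr0; congr (_ / _).
  by case: l l2 {Z Z0} => -[|[|[|[|//]]]] lt4 //= _;
    rewrite -?val_eqE /= mulr0 mulr1 ?addr0 ?add0r; congr (y 0 _); exact: val_inj.
have -> : (fun s : R => g (cyl (y + s *: e l))) = H \o Z.
  by apply/funext => s /=; rewrite /H -cyl_polar_shift.
rewrite -{1}Z0 in dH.
by apply: is_derive_eq (is_derive1_comp dH dZ) _; rewrite mulrC.
Qed.

Let deg (i : nat * nat * nat * seq 'I_3) : nat := let: (p, q, t, w) := i in (p + q + t)%N.
Let ord (i : nat * nat * nat * seq 'I_3) : nat := let: (p, q, t, w) := i in size w.

Lemma cyl_derivation G (U : set 'rV[R]_4) (V : set 'rV[R]_3) :
  smooth_on V G -> (forall y, U y -> 0 < rho y /\ V (cyl y)) ->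
  forall i l, derivation U (cyl_term G) deg ord i l.
Proof.
move=> sG UV [[[p q] t] w] l.
have [l2|l2] := ltnP l 2.
  have l2f : (2 == l) = false by apply/eqP => E; move: l2; rewrite -E.
  have l3f : (3 == l) = false by apply/eqP => E; move: l2; rewrite -E.
  apply: (@Derivation _ _ _ U (cyl_term G) deg ord (p, q, t, w) l 0 0 1
    (p, q, t, w) (p, q, t, w) (p, q, t, inord l :: w)); rewrite /deg /ord ?leq_addr//.
  - by rewrite normr0 addr0.
  - by rewrite normr1.
  - move=> y Uy; have [r0 Vy] := UV y Uy.
    have h := is_derive_cyl_flat l2 (sG w _ (inord l) Vy).
    apply: is_derive_eq (is_derive_cyl_term p q t r0 h) _.
    by rewrite l2f l3f /cyl_term /=; ring.
have [E|E] : {2 = l} + {3 = l}.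
- case: l l2 => -[|[|[|[|//]]]] lt4 //= _; [left|right]; exact: val_inj.
- rewrite -E in l2 *.
  apply: (@Derivation _ _ _ U (cyl_term G) deg ord (p, q, t, w) 2 p%:R (- t%:R) 1
    (p.-1, q, t, w) (p.+1, q, t.+2, w) (p.+1, q, t.+1, (2 : 'I_3) :: w)); rewrite /deg /ord ?leq_addr//=.
  + by case: (p) => [|p']; lia.
  + lia.
  + lia.
  + by rewrite normrN !normr_nat -natrD ler_nat; lia.
  + by rewrite normr1.
  + move=> y Uy; have [r0 Vy] := UV y Uy.
    have h := is_derive_cyl_polar (l := 2) isT r0 (sG w _ 2 Vy).
    apply: is_derive_eq (is_derive_cyl_term p q t r0 h) _.
    by rewrite /cyl_term /= !exprS; ring.
- rewrite -E in l2 *.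
  apply: (@Derivation _ _ _ U (cyl_term G) deg ord (p, q, t, w) 3 q%:R (- t%:R) 1
    (p, q.-1, t, w) (p, q.+1, t.+2, w) (p, q.+1, t.+1, (2 : 'I_3) :: w)); rewrite /deg /ord ?leq_addr//=.
  + by case: (q) => [|q']; lia.
  + lia.
  + lia.
  + by rewrite normrN !normr_nat -natrD ler_nat; lia.
  + by rewrite normr1.
  + move=> y Uy; have [r0 Vy] := UV y Uy.
    have h := is_derive_cyl_polar (l := 3) isT r0 (sG w _ 2 Vy).
    apply: is_derive_eq (is_derive_cyl_term p q t r0 h) _.
    by rewrite /cyl_term /= !exprS; ring.
Qed.

End Cylindrical.

Section CylindricalBounds.
Context {R : realType}.
Implicit Types (y a : 'rV[R]_4) (G g : 'rV[R]_3 -> R) (w : seq 'I_3).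
Notation e := unit_vec.
#[local] Opaque derive derivable.

Lemma rho_continuous a : {for a, continuous (@rho R)}.
Proof.
apply: (@continuous_comp _ _ _ (fun y : 'rV[R]_4 => y 0 2 ^+ 2 + y 0 3 ^+ 2) Num.sqrt a).
  have -> : (fun y : 'rV[R]_4 => y 0 2 ^+ 2 + y 0 3 ^+ 2) =
    (fun y => y 0 2 * y 0 2 + y 0 3 * y 0 3) by apply/funext => y; rewrite !expr2.
  have c i : (fun y : 'rV[R]_4 => y 0 i) @ a --> a 0 i by exact: coord_continuous.
  have FF : Filter (nbhs a) := nbhs_filter a.
  exact: (cvgD (cvgM (c 2) (c 2)) (cvgM (c 3) (c 3))).
exact: sqrt_continuous.
Qed.

(** On a cube around a where rho is bounded below, all of y_2, y_3 and 1 / rho are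
bounded by one K, and (k + N)! / k! is at most 2^(k + N) N!. *)
Lemma cyl_cauchy_bounds G a p q t : 0 < rho a -> cauchy_bounds (cyl a) G ->
  cauchy_bounds a (cyl_term G (p, q, t, [::])).
Proof.
move=> r0 [r [C [r_gt0 C1 sG bG]]].
pose K := 1 + `|a 0 2| + `|a 0 3| + 2 / rho a.
have [d d0 dU] : exists2 d : R, 0 < d & forall y, cube a d y ->
    rho a / 2 < rho y /\ `|rho y - rho a| < r.
  have /nbhs_cube[d d0 dU] : \forall y \near a, `|rho a - rho y| < Num.min (rho a / 2) r.
    by move/cvgrPdist_lt : (@rho_continuous a); apply; rewrite lt_min divr_gt0.
  exists d => // y /dU /=; rewrite lt_min ltr_norml distrC => /andP[/andP[_ h] ->].
  by split=> //; move: h; lra.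
pose d' := Num.min d (Num.min 1 r).
have d'0 : 0 < d' by rewrite !lt_min d0 r_gt0 ltr01.
pose U := cube a d'.
have oU : open U by exact: cube_open.
have K1 : 1 <= K.
  have := normr_ge0 (a 0 2); have := normr_ge0 (a 0 3).
  have : 0 < 2 / rho a by rewrite divr_gt0.
  by rewrite /K; lra.
have UV y : U y -> [/\ 0 < rho y, cube (cyl a) r (cyl y), `|y 0 2| <= K,
    `|y 0 3| <= K & `|(rho y)^-1| <= K].
  move=> Uy; have yd : cube a d y by apply: sub_cube Uy; rewrite ge_min lexx.
  have [ry ryr] := dU _ yd.
  have ry0 : 0 < rho y by apply: lt_trans ry; rewrite divr_gt0.
  have yr i : `|y 0 i - a 0 i| < r.
    by apply: (lt_le_trans (Uy i)); rewrite !ge_min lexx !orbT.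
  have y1 i : `|y 0 i| <= 1 + `|a 0 i|.
    have : `|y 0 i - a 0 i| < 1.
      by apply: (lt_le_trans (Uy i)); rewrite !ge_min lexx !orbT.
    have := ler_normD (y 0 i - a 0 i) (a 0 i); rewrite subrK; lra.
  have p0 : 0 < 2 / rho a by rewrite divr_gt0.
  have n2 := normr_ge0 (a 0 2); have n3 := normr_ge0 (a 0 3).
  split=> //.
  - move=> -[[|[|[|//]]] lt3]; rewrite !mxE //=; exact: yr.
  - by have := y1 2; rewrite /K; lra.
  - by have := y1 3; rewrite /K; lra.
  - rewrite ger0_norm ?invr_ge0 ?(ltW ry0)//.
    have : (rho y)^-1 <= 2 / rho a.
      rewrite -[2 / rho a]invrK lef_pV2 ?posrE ?invr_gt0//.
      by rewrite invf_div ltW.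
    by rewrite /K; lra.
have K0 : 0 <= K by lra.
have C0 : 0 <= C by lra.
pose deg (i : nat * nat * nat * seq 'I_3) : nat := let: (p, q, t, w) := i in (p + q + t)%N.
pose ord (i : nat * nat * nat * seq 'I_3) : nat := let: (p, q, t, w) := i in size w.
have bT i y : U y -> `|cyl_term G i y| <= K ^+ deg i * (C ^+ (ord i).+1 * (ord i)`!%:R).
  move: i => [[[p' q'] t'] w] /UV[_ Vy y2 y3 yr] /=.
  rewrite !normrM !normrX !exprD.
  apply: ler_pM; [by rewrite !mulr_ge0// exprn_ge0|by []| |exact: bG].
  by do 2 (apply: ler_pM; [by rewrite ?mulr_ge0// exprn_ge0|by rewrite exprn_ge0| |
    by apply: lerXn2r; rewrite ?nnegrE]); apply: lerXn2r; rewrite ?nnegrE.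
have der : forall i l, derivation U (cyl_term G) deg ord i l.
  by apply: (cyl_derivation sG) => y /UV[].
pose i := (p, q, t, [::] : seq 'I_3).
have bnd := recursion_bound oU K1 C1 bT der.
pose k := (p + q + t)%N; pose Q := 2 * (4 * K ^+ 3 * C).
pose W := K ^+ k * C * 2 ^+ k.
have Q0 : 0 <= Q by rewrite /Q !mulr_ge0// exprn_ge0.
have W1 : 1 <= W.
  rewrite -[1]mulr1 /W; apply: ler_pM => //; last by apply: exprn_ege1; lra.
  rewrite -[1]mulr1; apply: ler_pM => //; exact: exprn_ege1.
exists d', (Q + W); split => //; first by lra.
  by move=> w y l Uy; exact: (recursion_smooth oU der (leqnn (size w)) Uy).
move=> w y Uy.
have degk : (deg i <= 3 * k + 2)%N by rewrite /deg /i /k; clear; lia.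
apply: (le_trans (bnd (size w) i k w y degk (leq0n k) erefl Uy)).
rewrite /ord /= /i expr1 mulr1.
have F0 m : 0 < m`!%:R :> R by rewrite ltr0n fact_gt0.
have fb : (k + size w)`!%:R / k`!%:R <= 2 ^+ (k + size w) * (size w)`!%:R :> R.
  rewrite ler_pdivrMr// -mulrA [_ * k`!%:R]mulrC -natrX -!natrM ler_nat.
  exact: fact_add_le.
apply: (@le_trans _ _ (Q ^+ size w * W * (size w)`!%:R)).
  have -> : Q ^+ size w * W * (size w)`!%:R =
    (4 * K ^+ 3 * C) ^+ size w * (K ^+ k * C) * (2 ^+ (k + size w) * (size w)`!%:R).
    by rewrite /Q /W exprD [(2 * _) ^+ _]exprMn; ring.
  apply: ler_wpM2l => //.
  by apply: mulr_ge0; [apply: exprn_ge0; rewrite !mulr_ge0// exprn_ge0|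
    rewrite mulr_ge0// exprn_ge0].
rewrite ler_wpM2r ?(ltW (F0 _))// exprSr.
apply: ler_pM; [exact: exprn_ge0|lra| |lra].
by apply: lerXn2r; rewrite ?nnegrE; lra.
Qed.

End CylindricalBounds.

(** * Cylindrical coordinates at the axis *)

Section PolarCoefficients.
Context {R : realType}.
Implicit Types (b c s : R) (p q n i j k : nat).

(** The coefficient of b^i c^j in b^p c^q (b^2 + c^2)^k, where 2 k = i + j - p - q. *)
Definition polar_coef p q i j : nat :=
  if [&& (p <= i)%N, (q <= j)%N, ~~ odd (i - p) & ~~ odd (j - q)]
  then 'C((i - p + (j - q))./2, (i - p)./2) else 0.

Definition polar_sum p q b c n : R :=
  \sum_(i < n.+1) b ^+ i * c ^+ (n - i) * (polar_coef p q i (n - i))%:R.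

Lemma polar_coef_le p q i j : (polar_coef p q i j <= 2 ^ (i + j))%N.
Proof.
rewrite /polar_coef; case: ifP => // /and4P[pi qj _ _].
apply: (leq_trans (bin_le_exp2 _ _)); rewrite leq_exp2l//.
by clear -pi qj; lia.
Qed.

Lemma polar_sumSl p q b c n : polar_sum p.+1 q b c n.+1 = b * polar_sum p q b c n.
Proof.
rewrite /polar_sum big_ord_recl /= mulr0 add0r mulr_sumr; apply: eq_bigr => i _.
by rewrite /bump add1n subSS exprS !mulrA.
Qed.

Lemma polar_sumSr p q b c n : polar_sum p q.+1 b c n.+1 = c * polar_sum p q b c n.
Proof.
rewrite /polar_sum big_ord_recr /= subnn.
have -> : polar_coef p q.+1 n.+1 0 = 0 by rewrite /polar_coef andbF.
rewrite mulr0 addr0 mulr_sumr; apply: eq_bigr => -[i /=]; rewrite ltnS => le_in _.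
by rewrite subSn// exprS; rewrite -!mulrA mulrCA.
Qed.

Lemma polar_sum0 p q b c n : (n < p + q)%N -> polar_sum p q b c n = 0.
Proof.
move=> npq; rewrite /polar_sum big1// => -[i /=]; rewrite ltnS => le_in _.
rewrite /polar_coef; case: ifP; last by rewrite mulr0.
by move=> /and4P[pi qj _ _]; exfalso; clear -npq le_in pi qj; lia.
Qed.

Lemma polar_sum00 b c n :
  polar_sum 0 0 b c n = if odd n then 0 else (b ^+ 2 + c ^+ 2) ^+ n./2.
Proof.
case: ifP => on.
  rewrite /polar_sum big1// => -[i /=]; rewrite ltnS => le_in _.
  rewrite /polar_coef; case: ifP; last by rewrite mulr0.
  by rewrite !leq0n !subn0 /= => /andP[oi oni]; exfalso; clear -on le_in oi oni; lia.
have {on} -> : n = n./2.*2 by clear -on; lia.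
move: n./2 => k; rewrite doubleK addrC exprDn.
have split_even (F : nat -> R) m :
    \sum_(i < m.*2.+1) (if odd i then 0 else F i./2) = \sum_(i < m.+1) F i.
  elim: m => [|m IH]; first by rewrite !big_ord_recr !big_ord0.
  by rewrite doubleS big_ord_recr big_ord_recr /= IH odd_double /= addr0
     [in RHS]big_ord_recr /= doubleK.
rewrite -(split_even (fun i => (c ^+ 2) ^+ (k - i) * (b ^+ 2) ^+ i *+ 'C(k, i))).
apply: eq_bigr => -[i /=]; rewrite ltnS => le_ik _.
rewrite /polar_coef !leq0n !subn0 /=; have [oi|ei] := boolP (odd i).
  by rewrite mulr0.
have ek : ~~ odd (k.*2 - i) by clear -le_ik ei; lia.
rewrite ek /= subnKC// doubleK -!exprM.
have -> : (2 * (k - i./2) = k.*2 - i)%N by clear -le_ik ei; lia.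
have -> : (2 * i./2 = i)%N by clear -ei; lia.
by rewrite mulr_natr [b ^+ _ * _]mulrC.
Qed.

Lemma polar_sumE p q b c s n : s ^+ 2 = b ^+ 2 + c ^+ 2 ->
  polar_sum p q b c n =
  if (p + q <= n)%N && ~~ odd (n - (p + q)) then b ^+ p * c ^+ q * s ^+ (n - (p + q))
  else 0.
Proof.
move=> sbc; have [npq|pqn] := ltnP n (p + q); first exact: polar_sum0.
elim: p n pqn => [|p IHp] n; last first.
  case: n => // n pqn; rewrite polar_sumSl IHp// addSn subSS exprS /=.
  by case: ifP => _; rewrite ?mulr0// !mulrA.
rewrite !add0n; elim: q n => [|q IHq] n; last first.
  case: n => // n pqn; rewrite polar_sumSr IHq// subSS exprS /=.
  by case: ifP => _; rewrite ?mulr0// expr0 !mul1r !mulrA.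
move=> _; rewrite polar_sum00 subn0 !expr0 !mul1r -sbc.
case: ifP => //= on; rewrite -exprM; congr (_ ^+ _).
by clear -on; lia.
Qed.

(** The right-hand side is b^p c^q s^(n - p - q) when n - p - q is even and zero
otherwise.  It is written with s and - s because it is applied to a function of
s and its reflection; the convention 1 / 0 = 0 makes it hold at s = 0. *)
Lemma polar_sum_parity p q b c s n : (p + q <= 1)%N -> s ^+ 2 = b ^+ 2 + c ^+ 2 ->
  polar_sum p q b c n =
  b ^+ p * c ^+ q * s^-1 ^+ (p + q) * ((s ^+ n + (-1) ^+ (p + q) * (- s) ^+ n) / 2).
Proof.
move=> pq sbc; rewrite (polar_sumE _ _ _ sbc) [(- s) ^+ n]exprNn [(-1) ^+ _ * (_ * _)]mulrA -exprD.
rewrite -{1}[s ^+ n]mul1r -mulrDl.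
have -> : 1 + (-1) ^+ (p + q + n) = (if odd (p + q + n) then 0 else 2) :> R.
  by rewrite -signr_odd; case: odd; rewrite ?expr0 ?expr1 ?subrr.
have [npq|pqn] /= := ltnP n (p + q).
  have -> : n = 0 by clear -npq pq; lia.
  have -> : (p + q = 1)%N by clear -npq pq; lia.
  by rewrite /= !mul0r mulr0.
rewrite oddB// addbC -oddD; case: ifP => [/negbTE->|/negbFE->]; last by rewrite !mul0r mulr0.
rewrite [2 * _]mulrC mulfK//; have [s0|s0] := eqVneq s 0; last first.
  have -> : s ^+ n = s ^+ (p + q) * s ^+ (n - (p + q)) by rewrite -exprD subnKC.
  by rewrite exprVn [RHS]mulrA divfK// expf_neq0.
have := sbc; rewrite s0 expr0n /= => /esym/eqP.
rewrite paddr_eq0 ?sqr_ge0// !sqrf_eq0 => /andP[/eqP-> /eqP->].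
case: p q pq pqn => [|[|p]] [|[|q]] // _ _; rewrite ?expr0 ?expr1 ?(mul0r, mulr0, mul1r) ?subn0//.
Qed.

End PolarCoefficients.

Section PolarSubstitution.
Context {R : realType}.
Implicit Types (i j k l N : nat).
Notation multi n := {ffun 'I_n -> nat}.

Definition multi3 i j k : multi 3 := [ffun t : 'I_3 => nth 0 [:: i; j; k] t].
Definition multi4 i j k l : multi 4 := [ffun t : 'I_4 => nth 0 [:: i; j; k; l] t].

Lemma sum_multi3 N (F : multi 3 -> R) :
  \sum_(m : {ffun 'I_3 -> 'I_N}) F (box_index m) =
  \sum_(i < N) \sum_(j < N) \sum_(k < N) F (multi3 i j k).
Proof.
rewrite pair_big pair_big /=.
pose h (u : 'I_N * 'I_N * 'I_N) : {ffun 'I_3 -> 'I_N} :=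
  [ffun l : 'I_3 => nth u.2 [:: u.1.1; u.1.2] l].
pose h' (m : {ffun 'I_3 -> 'I_N}) := ((m 0, m 1), m 2).
have hK : cancel h h' by move=> [[i j] k]; rewrite /h' !ffunE.
have h'K : cancel h' h.
  move=> m; apply/ffunP => -[[|[|[|//]]] lt3]; rewrite ffunE /=; congr (m _); exact: val_inj.
rewrite (reindex h) /=; last by exists h' => u _; [exact: hK|exact: h'K].
apply: eq_bigr => -[[i j] k] _; congr (F _); apply/ffunP => -[[|[|[|//]]] lt3];
  by rewrite !ffunE.
Qed.

Lemma sum_multi4 N (F : multi 4 -> R) :
  \sum_(m : {ffun 'I_4 -> 'I_N}) F (box_index m) =
  \sum_(i < N) \sum_(j < N) \sum_(k < N) \sum_(l < N) F (multi4 i j k l).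
Proof.
rewrite pair_big pair_big pair_big /=.
pose h (u : 'I_N * 'I_N * 'I_N * 'I_N) : {ffun 'I_4 -> 'I_N} :=
  [ffun l : 'I_4 => nth u.2 [:: u.1.1.1; u.1.1.2; u.1.2] l].
pose h' (m : {ffun 'I_4 -> 'I_N}) := (((m 0, m 1), m 2), m 3).
have hK : cancel h h' by move=> [[[i j] k] l]; rewrite /h' !ffunE.
have h'K : cancel h' h.
  move=> m; apply/ffunP => -[[|[|[|[|//]]]] lt3]; rewrite ffunE /=; congr (m _); exact: val_inj.
rewrite (reindex h) /=; last by exists h' => u _; [exact: hK|exact: h'K].
apply: eq_bigr => -[[[i j] k] l] _; congr (F _); apply/ffunP => -[[|[|[|[|//]]]] lt3];
  by rewrite !ffunE.
Qed.

Lemma monomial_multi3 i j k (z : 'rV[R]_3) :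
  monomial (multi3 i j k) z = z 0 0 ^+ i * z 0 1 ^+ j * z 0 2 ^+ k.
Proof.
rewrite /monomial !big_ord_recl big_ord0 !ffunE /= mulr1 mulrA.
by congr (z 0 _ ^+ _ * z 0 _ ^+ _ * z 0 _ ^+ _); exact: val_inj.
Qed.

Lemma monomial_multi4 i j k l (z : 'rV[R]_4) :
  monomial (multi4 i j k l) z = z 0 0 ^+ i * z 0 1 ^+ j * z 0 2 ^+ k * z 0 3 ^+ l.
Proof.
rewrite /monomial !big_ord_recl big_ord0 !ffunE /= mulr1 !mulrA.
by congr (z 0 _ ^+ _ * z 0 _ ^+ _ * z 0 _ ^+ _ * z 0 _ ^+ _); exact: val_inj.
Qed.

Lemma mdeg_multi3 i j k : mdeg (multi3 i j k) = (i + j + k)%N.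
Proof. by rewrite /mdeg !big_ord_recl big_ord0 !ffunE /= addn0 addnA. Qed.

Lemma mdeg_multi4 (m : multi 4) : mdeg m = (m 0%R + m 1%R + m 2%R + m 3%R)%N.
Proof.
rewrite /mdeg !big_ord_recl big_ord0 addn0 !addnA.
by congr (m _ + m _ + m _ + m _)%N; exact: val_inj.
Qed.

Lemma polar_sum_box N n p q (b c : R) : (n < N)%N ->
  polar_sum p q b c n =
  \sum_(i < N) \sum_(j < N | (i + j == n)%N) b ^+ i * c ^+ j * (polar_coef p q i j)%:R.
Proof.
move=> nN; rewrite /polar_sum.
rewrite (big_ord_widen _ (fun i => b ^+ i * c ^+ (n - i) * (polar_coef p q i (n - i))%:R) nN).
rewrite big_mkcond /=; apply: eq_bigr => i _; case: ifP => [|/negbT]; rewrite ltnS.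
  move=> le_in; have lt : (n - i < N)%N by apply: leq_ltn_trans nN; exact: leq_subr.
  rewrite (big_pred1 (Ordinal lt))// => j /=.
  by rewrite -val_eqE /=; clear -le_in; lia.
rewrite -ltnNge => lt_ni; rewrite big_pred0// => j; apply/eqP.
by clear -lt_ni; lia.
Qed.

(** The coefficients of the series in four variables obtained by substituting the
radius for the last variable of a series in three. *)
Definition polar_series p q (c : multi 3 -> R) (m : multi 4) : R :=
  c (multi3 (m 0) (m 1) (m 2 + m 3)) * (polar_coef p q (m 2) (m 3))%:R.

(** Substituting the radius in a box of the series in three variables gives only
the part of the box in four variables where m_2 + m_3 < N. *)
Lemma polar_box_sum p q c N (y : 'rV[R]_4) (z : 'rV[R]_3) : (p + q <= 1)%N ->
  z 0 0 = y 0 0 -> z 0 1 = y 0 1 -> z 0 2 ^+ 2 = y 0 2 ^+ 2 + y 0 3 ^+ 2 ->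
  y 0 2 ^+ p * y 0 3 ^+ q * (z 0 2)^-1 ^+ (p + q) *
    ((box_sum c z N + (-1) ^+ (p + q) * box_sum c (conj_beta z) N) / 2) =
  \sum_(m : {ffun 'I_4 -> 'I_N} | (m 2%R + m 3%R < N)%N)
    monomial (box_index m) y * polar_series p q c (box_index m).
Proof.
move=> pq z0 z1 z2.
pose F4 (m : multi 4) : R :=
  if (m 2%R + m 3%R < N)%N then monomial m y * polar_series p q c m else 0.
have -> : \sum_(m : {ffun 'I_4 -> 'I_N} | (m 2%R + m 3%R < N)%N)
    monomial (box_index m) y * polar_series p q c (box_index m) =
  \sum_(m : {ffun 'I_4 -> 'I_N}) F4 (box_index m).
  by rewrite big_mkcond /=; apply: eq_bigr => m _; rewrite /F4 !ffunE.
rewrite sum_multi4 /box_sum (sum_multi3 N (fun m => monomial m z * c m)).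
rewrite (sum_multi3 N (fun m => monomial m (conj_beta z) * c m)).
rewrite mulr_sumr -big_split /= mulr_suml mulr_sumr; apply: eq_bigr => i _.
rewrite mulr_sumr -big_split /= mulr_suml mulr_sumr; apply: eq_bigr => j _.
rewrite mulr_sumr -big_split /= mulr_suml mulr_sumr.
transitivity (\sum_(n < N) y 0 0 ^+ i * y 0 1 ^+ j * c (multi3 i j n) *
    polar_sum p q (y 0 2) (y 0 3) n).
  apply: eq_bigr => n _; rewrite !monomial_multi3 !mxE /= (polar_sum_parity n pq z2) z0 z1.
  set u := (z 0 2)^-1 ^+ _; set v := (-1) ^+ _; ring.
transitivity (\sum_(n < N) \sum_(k < N) \sum_(l < N | (k + l == n)%N)
    monomial (multi4 i j k l) y * polar_series p q c (multi4 i j k l)).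
  apply: eq_bigr => n _; rewrite (polar_sum_box _ _ _ _ (ltn_ord n)) mulr_sumr.
  apply: eq_bigr => k _; rewrite mulr_sumr; apply: eq_bigr => l /eqP kl.
  by rewrite monomial_multi4 /polar_series !ffunE /= kl; ring.
rewrite exchange_big /=; apply: eq_bigr => k _.
under eq_bigr do rewrite big_mkcond /=.
rewrite exchange_big /=; apply: eq_bigr => l _; rewrite /F4 !ffunE /=.
case: ifP => [kl|/negbT kl].
  rewrite (bigD1 (Ordinal kl)) //= eqxx big1 ?addr0// => n.
  by rewrite -val_eqE /= eq_sym => /negbTE->.
rewrite big1// => n _; case: eqP => // E; move: kl.
by rewrite E ltn_ord.
Qed.

End PolarSubstitution.

Section PolarCentre.
Context {R : realType}.
Implicit Types (G : 'rV[R]_3 -> R) (a y : 'rV[R]_4).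

Lemma rho_le y : rho y <= `|y 0 2| + `|y 0 3|.
Proof.
have s0 : 0 <= `|y 0 2| + `|y 0 3| by exact: addr_ge0.
rewrite /rho -[leRHS]ger0_norm// -sqrtr_sqr ler_wsqrtr//.
rewrite sqrrD !real_normK ?num_real// addrAC lerDl.
by rewrite mulrn_wge0// mulr_ge0.
Qed.

(** The part of the box that is missing in [polar_box_sum] consists of terms of
degree at least N, and by the choice of the radius its sum is at most a multiple
of 2^(- N). *)
Lemma cyl_power_series G a p q (s : R) : (p + q <= 1)%N -> rho a = 0 -> 0 < s ->
  (forall z, cube (cyl a) s z -> G (conj_beta z) = (-1) ^+ (p + q) * G z) ->
  power_series_at G (cyl a) -> power_series_at (cyl_term G (p, q, p + q, [::])%N) a.
Proof.
move=> pq ra s0 GC [c [K [A [r [K0 A1 r0 cK cG]]]]].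
have [a2 a3] := rho_eq0 ra.
have A0 : 0 < A by lra.
(* At distance at most 1 / (8 A) the term of index m is at most K (1 / 4)^|m|: half
   of this decay makes the sum over a box bounded, the other half makes the part
   with |m| >= N tend to 0. *)
pose r' := Num.min (Num.min (r / 2) (s / 2)) (8 * A)^-1.
have r'0 : 0 < r' by rewrite !lt_min !divr_gt0// invr_gt0 mulr_gt0.
have dK m : `|polar_series p q c m| <= K * (2 * A) ^+ mdeg m.
  rewrite /polar_series normrM normr_nat exprMn.
  have -> : K * (2 ^+ mdeg m * A ^+ mdeg m) = K * A ^+ mdeg m * 2 ^+ mdeg m by ring.
  apply: ler_pM => //.
    by apply: (le_trans (cK _)); rewrite mdeg_multi3 mdeg_multi4 addnA.
  rewrite -natrX ler_nat (leq_trans (polar_coef_le _ _ _ _))// leq_exp2l//.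
  by rewrite mdeg_multi4; clear; lia.
exists (polar_series p q c), K, (2 * A), r'; split => //; first by lra.
move=> y ay.
have yr i : `|y 0 i - a 0 i| < r / 2.
  by apply: (lt_le_trans (ay i)); rewrite !ge_min lexx.
have ys i : `|y 0 i - a 0 i| < s / 2.
  by apply: (lt_le_trans (ay i)); rewrite !ge_min lexx !orbT.
have yA i : `|y 0 i - a 0 i| < (8 * A)^-1.
  by apply: (lt_le_trans (ay i)); rewrite !ge_min lexx !orbT.
have near_cyl t : 0 < t -> (forall i, `|y 0 i - a 0 i| < t / 2) ->
    cube (cyl a) t (cyl y) /\ cube (cyl a) t (conj_beta (cyl y)).
  move=> t0 yt.
  have yt' i : `|y 0 i - a 0 i| < t by apply: (lt_trans (yt i)); lra.
  have rt : `|rho y| < t.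
    have := yt 2; have := yt 3; rewrite a2 a3 !subr0 => h3 h2.
    by rewrite ger0_norm ?sqrtr_ge0//; have := rho_le y; lra.
  by split=> -[[|[|[|//]]] lt3]; rewrite !mxE //= ?mxE /= ?ra ?subr0 ?normrN.
have [cr cr'] := near_cyl _ r0 yr.
have [cs _] := near_cyl _ s0 ys.
pose z := cyl y - cyl a.
pose Sin N := \sum_(m : {ffun 'I_4 -> 'I_N} | (m 2%R + m 3%R < N)%N)
    monomial (box_index m) (y - a) * polar_series p q c (box_index m).
pose Sout N := \sum_(m : {ffun 'I_4 -> 'I_N} | ~~ (m 2%R + m 3%R < N)%N)
    monomial (box_index m) (y - a) * polar_series p q c (box_index m).
have -> : box_sum (polar_series p q c) (y - a) = (fun N => Sin N + Sout N).
  apply/funext => N; rewrite /box_sum /Sin /Sout.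
  by rewrite (bigID (fun m : {ffun 'I_4 -> 'I_N} => (m 2%R + m 3%R < N)%N)).
rewrite -[cyl_term _ _ _]addr0; apply: cvgD; last first.
  apply: (@cvg_of_dist _ _ (geometric (K * 2 ^+ 4) (1 / 2))).
    by apply: cvg_geometric; rewrite ger0_norm; lra.
  move=> N; rewrite sub0r normrN /geometric /=.
  apply: (le_trans (ler_norm_sum _ _ _)).
  apply: (@le_trans _ _ (\sum_(m : {ffun 'I_4 -> 'I_N})
      K * (1 / 2) ^+ N * (1 / 2) ^+ mdeg (box_index m))).
    rewrite big_mkcond /=; apply: ler_sum => m _.
    have h0 : 0 <= K * (1 / 2) ^+ N * (1 / 2) ^+ mdeg (box_index m).
      by rewrite !mulr_ge0 // exprn_ge0//; lra.
    case: ifP => // mN; rewrite normrM.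
    have Nm : (N <= mdeg (box_index m))%N.
      by move: mN; rewrite mdeg_multi4 !ffunE; clear; lia.
    have q0 : 0 <= (8 * A)^-1 by rewrite invr_ge0 mulr_ge0// ltW.
    have mb : `|monomial (box_index m) (y - a)| <= (8 * A)^-1 ^+ mdeg (box_index m).
      by apply: monomial_bound => // l; rewrite !mxE ltW.
    apply: (@le_trans _ _ ((8 * A)^-1 ^+ mdeg (box_index m) * (K * (2 * A) ^+ mdeg (box_index m)))).
      exact: ler_pM.
    have -> : (8 * A)^-1 ^+ mdeg (box_index m) * (K * (2 * A) ^+ mdeg (box_index m)) =
        K * (1 / 2) ^+ mdeg (box_index m) * (1 / 2) ^+ mdeg (box_index m).
      rewrite mulrCA -exprMn -[RHS]mulrA -exprMn; congr (_ * _ ^+ _).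
      by move: A0 => /lt0r_neq0; clear; move=> A0; field.
    have E0 : 0 <= (1 / 2) ^+ mdeg (box_index m) :> R by apply: exprn_ge0; lra.
    apply: (ler_wpM2r E0); apply: (ler_wpM2l K0); apply: ler_wiXn2l => //; lra.
  have KN0 : 0 <= K * (1 / 2) ^+ N by apply: mulr_ge0 => //; apply: exprn_ge0; lra.
  have half01 : 0 <= (1 / 2 : R) <= 1 / 2 by apply/andP; split; lra.
  rewrite -mulr_sumr [leRHS]mulrAC.
  exact: (ler_wpM2l KN0 (box_sum_geometric N half01)).
have z2 : z 0 2 = rho y by rewrite !mxE /= ra subr0.
have zC : conj_beta z = conj_beta (cyl y) - cyl a.
  by apply/rowP => -[[|[|[|//]]] lt3]; rewrite !mxE //= ?mxE /= ra !subr0.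
have SinE N : Sin N = y 0 2 ^+ p * y 0 3 ^+ q * (rho y)^-1 ^+ (p + q) *
    ((box_sum c z N + (-1) ^+ (p + q) * box_sum c (conj_beta z) N) / 2).
  rewrite /Sin -(@polar_box_sum _ p q c N (y - a) z pq) ?z2 ?mxE ?a2 ?a3 ?subr0 //.
  by rewrite /rho sqr_sqrtr// addr_ge0// sqr_ge0.
rewrite (funext SinE).
have -> : cyl_term G (p, q, (p + q)%N, [::]) y = y 0 2 ^+ p * y 0 3 ^+ q * (rho y)^-1 ^+ (p + q) *
    ((G (cyl y) + (-1) ^+ (p + q) * G (conj_beta (cyl y))) / 2).
  rewrite /cyl_term /= (GC _ cs) [(-1) ^+ _ * (_ * _)]mulrA -exprD -signr_odd oddD addbb expr0 mul1r.
  by congr (_ * _); field.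
apply: cvgMr; apply: cvgMl; apply: cvgD; first exact: cG cr.
by apply: cvgMr; rewrite zC; exact: cG cr'.
Qed.

End PolarCentre.

(** * The identity theorem *)

Section IdentityTheorem.
Context {R : realType}.
Notation V := 'rV[R]_3.
Notation e := unit_vec.
Implicit Types (D : set V) (x y : V) (v : seq 'I_3).
#[local] Opaque derive derivable.

Lemma is_derive_sum_coef m (g h : 'I_m -> V -> R) (p q : 'I_m -> R) x (l : 'I_3) :
  (forall b, derivable (g b) x (e l)) -> (forall b, derivable (h b) x (e l)) ->
  is_derive x (e l) (fun y => \sum_b (g b y * p b + h b y * q b))
    (\sum_b ('D_(e l) (g b) x * p b + 'D_(e l) (h b) x * q b)).
Proof.
move=> dg dh.
have dsum b : is_derive x (e l) (fun y => p b * g b y + q b * h b y)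
    ('D_(e l) (g b) x * p b + 'D_(e l) (h b) x * q b).
  by have [d1 d2] := derive_lin (p b) (q b) (dg b) (dh b); split => //;
    rewrite d2; congr (_ + _); exact: mulrC.
have -> : (fun y => \sum_b (g b y * p b + h b y * q b)) =
    \sum_b (fun y => p b * g b y + q b * h b y).
  apply/funext => y; rewrite fct_sumE; apply: eq_bigr => b _.
  by congr (_ + _); exact: mulrC.
exact: is_derive_sum.
Qed.

Section FirstOrderSystem.
Variables (m : nat) (D : set V) (A B : 'I_m -> 'I_m -> R).
Hypothesis oD : open D.

(** Real systems of the form d_2 w = (d_0 w) A + (d_1 w) B, component by component. *)
Definition solves (w : 'I_m -> V -> R) :=
  (forall x c, D x -> loc_harmonic x (w c)) /\
  (forall x c, D x -> 'D_(e 2) (w c) x =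
     \sum_b ('D_(e 0) (w b) x * A b c + 'D_(e 1) (w b) x * B b c)).

(** The coefficients are constant, so derivatives of solutions are solutions. *)
Lemma solves_derive w l : solves w -> solves (fun c => 'D_(e l) (w c)).
Proof.
move=> [wH wS]; split=> [x c Dx|x c Dx]; first by apply: loc_harmonic_derive; exact: wH.
rewrite (@loc_harmonic_schwarz _ _ x l 2 _ (wH x c Dx)).
rewrite (derive_eq_on _ oD Dx (fun y Dy => wS y c Dy)).
have E k b : 'D_(e l) ('D_(e k) (w b)) x = 'D_(e k) ('D_(e l) (w b)) x.
  exact: (@loc_harmonic_schwarz _ _ x k l _ (wH x b Dx)).
have [_ S] := @is_derive_sum_coef m (fun b => 'D_(e 0) (w b))
  (fun b => 'D_(e 1) (w b)) (fun b => A b c) (fun b => B b c) x l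
  (fun b => @loc_harmonic_derivable _ _ x l _ (@loc_harmonic_derive _ _ x 0 _ (wH x b Dx)))
  (fun b => @loc_harmonic_derivable _ _ x l _ (@loc_harmonic_derive _ _ x 1 _ (wH x b Dx))).
apply: (etrans S).
exact: (eq_bigr _ (fun b _ => congr2 +%R
  (congr1 (fun z => z * A b c) (E 0 b)) (congr1 (fun z => z * B b c) (E 1 b)))).
Qed.

Definition vanishes (w : 'I_m -> V -> R) := forall x c, D x -> x 0 2 = 0 -> w c x = 0.

(** Derivatives in the directions 0 and 1 are tangent to the plane x_2 = 0, and the
system expresses the remaining one through them. *)
Lemma vanishes_derive w l : solves w -> vanishes w ->
  vanishes (fun c => 'D_(e l) (w c)).
Proof.
move=> [wH wS] w0.
have tangential (k : 'I_3) : (k < 2)%N -> vanishes (fun c => 'D_(e k) (w c)).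
  move=> k2 x c Dx x2.
  have k2' : ((2 : 'I_3) == k) = false by apply/eqP => E; move: k2; rewrite -E.
  have [d [d0 dD]] : exists d : R, 0 < d /\ cube x d `<=` D.
    by have /nbhs_cube[d d0 dD] := open_nbhs_nbhs (conj oD Dx); exists d.
  suff : is_derive x (e k) (w c) 0 by case.
  apply/is_derive_line0.
  have E (s : R) : ball (0 : R) d s -> cst 0 s = w c (x + s *: e k).
    rewrite /ball /= sub0r normrN => sd.
    rewrite w0 //; last by rewrite coordDe x2 k2' mulr0 addr0.
    apply: dD => i; rewrite coordDe addrAC subrr add0r normrM.
    by apply: le_lt_trans sd; rewrite ler_piMr// normr_nat lern1 leq_b1.
  have [h1 h2] := is_derive_cst (0 : R) (0 : R) (1 : R).
  have oB : open (ball (0 : R) d) by exact: ball_open.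
  have B0 : ball (0 : R) d 0 by exact: ballxx.
  split; first exact: derivable_eq_on oB B0 E h1.
  have h3 := derive_eq_on (1 : R) oB B0 E.
  by rewrite -h3 h2.
have [l2|l2] := ltnP l 2; first exact: tangential.
have -> : l = 2 by case: l l2 => -[|[|[|//]]] lt3 //= _; exact: val_inj.
move=> x c Dx x2; rewrite wS// big1// => b _.
by rewrite !tangential// !mul0r addr0.
Qed.

Lemma vanishes_dword w v : solves w -> vanishes w ->
  vanishes (fun c => dword v (w c)).
Proof.
elim/last_ind: v w => [//|v l IH] w ws w0 x c Dx x2.
rewrite -cats1 dword_cat /=.
by apply: (IH _ (solves_derive l ws) (vanishes_derive l ws w0)).
Qed.

Lemma dword_cst0 v x : dword v (fun=> 0 : R) x = 0.
Proof.
elim: v x => // l v IH x /=; rewrite (_ : dword v _ = cst 0); last exact/funext.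
by have [_] := is_derive_cst (0 : R) x (e l).
Qed.

(** The Taylor series converges to the function. *)
Lemma flat_eq0 x g : loc_harmonic x g -> (forall v, dword v g x = 0) ->
  exists2 r, 0 < r & forall y, cube x r y -> g y = 0.
Proof.
move=> gH g0; have [K [C [r [_ _ r0 _ gr]]]] := cauchy_bounds_taylor (loc_harmonic_cauchy_bounds gH).
exists r => // y xy; have := gr y xy.
rewrite (_ : box_sum _ _ = fun=> 0); last first.
  apply/funext => N; rewrite /box_sum big1// => m' _.
  by rewrite /taylor_coef g0 !mulr0.
by move=> h; apply/esym; apply: (cvg_unique _ (@cvg_cst _ 0 _ _ _) h).
Qed.

(** The set where all derivatives vanish is closed in D by continuity and open by
[flat_eq0], and it contains the points of D in the plane x_2 = 0. *)
Lemma identity_theorem w : connected D -> (exists2 x, D x & x 0 2 = 0) ->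
  solves w -> vanishes w -> forall x c, D x -> w c x = 0.
Proof.
move=> cD [x0 Dx0 x02] ws w0; have [wH wS] := ws.
pose Z := D `&` [set x | forall v c, dword v (w c) x = 0].
suff ZD : Z = D by move=> x c; rewrite -ZD => -[_ /(_ [::] c)].
apply: cD.
- by exists x0; split => // v c; exact: (vanishes_dword v ws w0).
- exists (interior Z); first exact: open_interior.
  apply/seteqP; split=> [x [Dx Zx]|x [Dx /interior_subset]//]; split => //.
  have near0 c : \forall y \near x, w c y = 0.
    have [r r0 h] := flat_eq0 (wH x c Dx) (fun v => Zx v c).
    by apply: filterS (near_cube r0 (cube_center x r0)).
  have [r r0 rw] : exists2 r, 0 < r & forall y, cube x r y -> D y /\ forall c, w c y = 0.
    have FF : Filter (nbhs x) := nbhs_filter x.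
    have /nbhs_cube[r r0 h] := @filterI _ _ FF _ _ (open_nbhs_nbhs (conj oD Dx))
      (@filter_forall _ _ _ _ FF near0).
    by exists r.
  have := near_cube r0 (cube_center x r0); apply: filterS => y xy.
  split=> [|v c]; first by have [] := rw y xy.
  have E z : cube x r z -> w c z = (fun=> 0) z by move=> /rw[_ /(_ c)].
  by rewrite (dword_eq_on v (cube_open r0) E xy) dword_cst0.
- exists (closure Z); first exact: closed_closure.
  apply/seteqP; split=> [x Zx|x [Dx Zx]]; first by split; [case: Zx|exact: subset_closure].
  split=> // v c; apply/eqP; rewrite -normr_le0; apply/ler_addgt0Pl => eps eps0.
  have ct : {for x, continuous (dword v (w c))}.
    by apply: loc_harmonic_continuous; apply: loc_harmonic_dword; exact: wH.
  move/cvgrPdist_le : ct => /(_ _ eps0) /Zx[y [[_ Zy] /=]].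
  by rewrite Zy subr0 addr0.
Qed.

End FirstOrderSystem.
End IdentityTheorem.

(** * Vector-valued harmonic functions and quaternions *)

Section HarmonicVectors.
Context {R : realType} {n m : nat}.
Notation e := unit_vec.
Implicit Types (D : set 'rV[R]_n) (F : 'rV[R]_n -> 'rV[R]_m) (x y : 'rV[R]_n).
#[local] Opaque derive derivable.

Definition loc_harmonic_on D F := forall x c, D x -> loc_harmonic x (fun y => F y 0 c).

Variables (D : set 'rV[R]_n) (F : 'rV[R]_n -> 'rV[R]_m).
Hypotheses (oD : open D) (HF : loc_harmonic_on D F).

Lemma loc_harmonic_on_is_derive x l : D x ->
  is_derive x (e l) F (\row_c 'D_(e l) (fun y => F y 0 c) x).
Proof.
move=> Dx; apply: is_derive_rV => c; rewrite mxE; split => //.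
exact: loc_harmonic_derivable (HF c Dx).
Qed.

Lemma loc_harmonic_on_derivable x l : D x -> derivable F x (e l).
Proof. by move=> /(@loc_harmonic_on_is_derive x l)[]. Qed.

Lemma loc_harmonic_on_coord x l c : D x ->
  'D_(e l) F x 0 c = 'D_(e l) (fun y => F y 0 c) x.
Proof. by move=> /(@loc_harmonic_on_is_derive x l)[_ ->]; rewrite mxE. Qed.

Lemma loc_harmonic_on_derive l : loc_harmonic_on D ('D_(e l) F).
Proof.
move=> x c Dx; have /nbhs_cube[r r0 rD] := open_nbhs_nbhs (conj oD Dx).
apply: (loc_harmonic_eq r0 _ (loc_harmonic_derive l (HF c Dx))) => y /rD Dy.
by rewrite loc_harmonic_on_coord.
Qed.

Lemma loc_harmonic_on_continuous x : D x -> {for x, continuous F}.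
Proof.
move=> Dx A /nbhs_ballP[eps /= eps0 epsA].
have FF : Filter (nbhs x) := nbhs_filter x.
have h c : \forall y \near x, `|F x 0 c - F y 0 c| < eps.
  have := loc_harmonic_continuous (HF c Dx).
  by move=> /(@cvgrPdist_lt _ _ _ _ FF) /(_ _ eps0).
apply: (@filterS _ _ FF _ _ _ (@filter_forall _ _ _ _ FF h)) => y hy.
by apply: epsA; rewrite ball_cube// => c; rewrite distrC; exact: hy.
Qed.

End HarmonicVectors.

Section HarmonicOn.
Context {R : realType} {n m : nat}.
Notation e := unit_vec.
Variables (D : set 'rV[R]_n) (F : 'rV[R]_n -> 'rV[R]_m).
Hypotheses (oD : open D) (HF : loc_harmonic_on D F).
#[local] Opaque derive derivable.

Lemma C1_along_basis (G : 'rV[R]_n -> 'rV[R]_m) : loc_harmonic_on D G ->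
  C1_along (Defs.basis n) D G.
Proof.
move=> HG v /mapP[l _ ->]; split=> [a Da|]; first exact: (loc_harmonic_on_derivable HG).
apply: continuous_in_subspaceT => x; rewrite in_setE => Dx.
exact: (loc_harmonic_on_continuous (loc_harmonic_on_derive oD HG l) Dx).
Qed.

Lemma loc_harmonic_on_harmonic : harmonic_on D F.
Proof.
split; first exact: C1_along_basis.
  by move=> l; apply: C1_along_basis; exact: loc_harmonic_on_derive.
move=> a Da; apply/rowP => c; rewrite summxE mxE.
rewrite -[RHS](loc_harmonic_laplacian (HF c Da)); apply: eq_bigr => l _.
rewrite (loc_harmonic_on_coord (loc_harmonic_on_derive oD HF l))//.
by apply: (derive_eq_on _ oD Da) => y Dy; rewrite (loc_harmonic_on_coord HF).
Qed.

Lemma loc_harmonic_on_analytic : real_analytic_on D F.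
Proof.
move=> a Da; apply: power_series_real_analytic => c.
by apply: cauchy_bounds_power_series; apply: loc_harmonic_cauchy_bounds; exact: HF.
Qed.

End HarmonicOn.

Section QuaternionAlgebra.
Context {R : realType}.
Implicit Types (p q r J : quaternion R).

Lemma qmulDr p q r : qmul p (q + r) = qmul p q + qmul p r.
Proof. by apply: quat_ext; rewrite !mxE /=; ring. Qed.
Lemma qmulDl p q r : qmul (p + q) r = qmul p r + qmul q r.
Proof. by apply: quat_ext; rewrite !mxE /=; ring. Qed.
Lemma qmulZr (a : R) p q : qmul p (a *: q) = a *: qmul p q.
Proof. by apply: quat_ext; rewrite !mxE /=; ring. Qed.
Lemma qmulZl (a : R) p q : qmul (a *: p) q = a *: qmul p q.
Proof. by apply: quat_ext; rewrite !mxE /=; ring. Qed.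
Lemma qmulNr p q : qmul p (- q) = - qmul p q.
Proof. by apply: quat_ext; rewrite !mxE /=; ring. Qed.
Lemma qmulNl p q : qmul (- p) q = - qmul p q.
Proof. by apply: quat_ext; rewrite !mxE /=; ring. Qed.
Lemma qmulN1q p : qmul (- q1) p = - p.
Proof. by rewrite qmulNl qmul1q. Qed.

Lemma sphere1N J : sphere1 J -> sphere1 (- J).
Proof.
move=> [b [c [-> bc]]]; exists (- b), (- c); split; last by rewrite !sqrrN.
by rewrite opprD !scaleNr.
Qed.

Lemma sphere1_qj : sphere1 (qj : quaternion R).
Proof. by exists 1, 0; rewrite scale1r scale0r addr0 expr1n expr0n addr0. Qed.

Lemma sphere1_qk : sphere1 (qk : quaternion R).
Proof. by exists 0, 1; rewrite scale1r scale0r add0r expr1n expr0n add0r. Qed.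

Lemma sphere1_sqr J : sphere1 J -> qmul J J = - q1.
Proof.
move=> [b [c [-> bc]]]; apply: quat_ext; rewrite !mxE /=; last 3 first.
- by ring.
- by ring.
- by ring.
- by rewrite !(mulr0, mulr1, add0r, addr0, sub0r); move: bc; lra.
Qed.

Lemma sphere1_anti J : sphere1 J -> qmul J qi = - qmul qi J.
Proof. by move=> [b [c [-> _]]]; apply: quat_ext; rewrite !mxE /=; ring. Qed.

Lemma sphere1K J q : sphere1 J -> qmul J (qmul J q) = - q.
Proof. by move=> SJ; rewrite qmulA sphere1_sqr// qmulN1q. Qed.

Lemma qiK q : qmul qi (qmul qi q) = - q.
Proof. by rewrite qmulA qmulii qmulN1q. Qed.

(** The matrix of the left multiplication by p, acting on row vectors from the
right; products are therefore reversed. *)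
Definition Lmul p : 'M[R]_4 := \matrix_(i < 4, c < 4) qmul p (unit_vec i) 0 c.

Lemma sum4 (f : 'I_4 -> R) : \sum_i f i = f 0 + f 1 + f 2 + f 3.
Proof.
rewrite !big_ord_recl big_ord0 addr0 !addrA.
by congr (f _ + f _ + f _ + f _); exact: val_inj.
Qed.

Lemma mulmx_Lmul p q : q *m Lmul p = qmul p q.
Proof.
apply: quat_ext; rewrite mxE sum4 !mxE /=; ring.
Qed.

Lemma Lmul_ext (A B : 'M[R]_4) : (forall q : quaternion R, q *m A = q *m B) -> A = B.
Proof. by move=> h; apply/row_matrixP => i; rewrite !rowE. Qed.

Lemma loc_harmonic_on_lin (D : set (CxR R)) c d (F G : CxR R -> quaternion R) :
  loc_harmonic_on D F -> loc_harmonic_on D G -> loc_harmonic_on D (fun x => c *: F x + d *: G x).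
Proof.
move=> HF HG x l Dx.
have -> : (fun y => (c *: F y + d *: G y) 0 l) = (fun y => c * F y 0 l + d * G y 0 l).
  by apply/funext => y; rewrite !mxE.
by apply: loc_harmonic_lin; [exact: HF|exact: HG].
Qed.

Lemma loc_harmonic_on_qmul (D : set (CxR R)) p (F : CxR R -> quaternion R) :
  loc_harmonic_on D F -> loc_harmonic_on D (fun x => qmul p (F x)).
Proof.
move=> HF x l Dx.
have h a0 a1 a2 a3 (k0 k1 k2 k3 : 'I_4) : loc_harmonic x (fun y =>
    1 * (a0 * F y 0 k0 + a1 * F y 0 k1) + 1 * (a2 * F y 0 k2 + a3 * F y 0 k3)).
  by do 3 (apply: loc_harmonic_lin; do ?exact: HF).
have [->|->|->|->] : [\/ l = 0, l = 1, l = 2 | l = 3].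
- case: l => -[|[|[|[|//]]]] lt4; [constructor 1|constructor 2|constructor 3|constructor 4]; exact: val_inj.
- have := h (p 0 0) (- p 0 1) (- p 0 2) (- p 0 3) 0 1 2 3.
  by congr loc_harmonic; apply/funext => y; rewrite mxE /=; ring.
- have := h (p 0 0) (p 0 1) (p 0 2) (- p 0 3) 1 0 3 2.
  by congr loc_harmonic; apply/funext => y; rewrite mxE /=; ring.
- have := h (p 0 0) (- p 0 1) (p 0 2) (p 0 3) 2 3 0 1.
  by congr loc_harmonic; apply/funext => y; rewrite mxE /=; ring.
- have := h (p 0 0) (p 0 1) (- p 0 2) (p 0 3) 3 2 1 0.
  by congr loc_harmonic; apply/funext => y; rewrite mxE /=; ring.
Qed.

End QuaternionAlgebra.

(** * Restrictions to slices *)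

Section Slices.
Context {R : realType}.
Notation e := unit_vec.
Implicit Types (J q : quaternion R) (x v : CxR R) (D : set (CxR R)) (t : R).
Implicit Types (f : quaternion R -> quaternion R).

Lemma slice_ptD J x y : slice_pt J (x + y) = slice_pt J x + slice_pt J y.
Proof. by apply: quat_ext; rewrite !mxE /=; ring. Qed.

Lemma slice_ptZ J t x : slice_pt J (t *: x) = t *: slice_pt J x.
Proof. by apply: quat_ext; rewrite !mxE /=; ring. Qed.

Lemma slice_pt_e0 J : slice_pt J (e 0) = q1.
Proof. by apply: quat_ext; rewrite !mxE /=; ring. Qed.
Lemma slice_pt_e1 J : slice_pt J (e 1) = qi.
Proof. by apply: quat_ext; rewrite !mxE /=; ring. Qed.
Lemma slice_pt_e2 J : slice_pt J (e 2) = J.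
Proof. by apply: quat_ext; rewrite !mxE /=; ring. Qed.

Lemma slice_pt_conj J x : slice_pt J (conj_beta x) = slice_pt (- J) x.
Proof. by apply: quat_ext; rewrite !mxE /=; ring. Qed.

Lemma slice_pt_real J K x : x 0 2 = 0 -> slice_pt J x = slice_pt K x.
Proof. by rewrite /slice_pt => ->; rewrite !scale0r. Qed.

Let growth f J x v : (fun h : R => h^-1 *: (((f \o slice_pt J) \o shift x) (h *: v) -
    (f \o slice_pt J) x)) =
  (fun h : R => h^-1 *: ((f \o shift (slice_pt J x)) (h *: slice_pt J v) -
    f (slice_pt J x))).
Proof. by apply/funext => h /=; rewrite slice_ptD slice_ptZ. Qed.

Lemma derive_slice f J x v :
  'D_v (f \o slice_pt J) x = 'D_(slice_pt J v) f (slice_pt J x).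
Proof. by rewrite /derive growth. Qed.

Lemma derivable_slice f J x v :
  derivable f (slice_pt J x) (slice_pt J v) -> derivable (f \o slice_pt J) x v.
Proof. by rewrite /derivable growth. Qed.

Lemma slice_pt_continuous J : continuous (slice_pt J).
Proof.
move=> x; have FF : Filter (nbhs x) := nbhs_filter x.
have c i : (fun y : CxR R => y 0 i) @ x --> x 0 i by exact: coord_continuous.
exact: (cvgD (cvgD (cvgZl (c 0)) (cvgZl (c 1))) (cvgZl (c 2))).
Qed.

#[local] Opaque derive derivable.

Section RegularFunction.
Variables (D : set (CxR R)) (f : quaternion R -> quaternion R).
Hypotheses (Dinv : beta_invariant D) (oD : open D) (f_reg : Reg13 (Omega_of D) f).

Let slice_mem J x : sphere1 J -> D x -> slice (Omega_of D) J (slice_pt J x).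
Proof. by move=> SJ Dx; split; [exists x => //; exists J|exists x]. Qed.

Let basis_mem J l : slice_pt J (e l) \in [:: q1; qi; J].
Proof.
have [->|->|->] := ord3 l; rewrite ?slice_pt_e0 ?slice_pt_e1 ?slice_pt_e2;
  by rewrite !inE eqxx ?orbT.
Qed.

(** Regularity gives continuity relative to the slice; as D is open, this is
continuity in the coordinates of the slice. *)
Lemma slice_C1 J x l : sphere1 J -> D x -> derivable (f \o slice_pt J) x (e l) /\
  {for x, continuous ('D_(e l) (f \o slice_pt J))}.
Proof.
move=> SJ Dx; have [/(_ _ (basis_mem J l))[df cf] _] := f_reg SJ; split.
  by apply: derivable_slice; apply: df; exact: slice_mem.
have -> : 'D_(e l) (f \o slice_pt J) = 'D_(slice_pt J (e l)) f \o slice_pt J.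
  by apply/funext => y; rewrite derive_slice.
move/subspace_continuousP : cf => /(_ _ (slice_mem SJ Dx)) cf W /cf.
rewrite /within /= => /(slice_pt_continuous (x := x)) h.
have FF : Filter (nbhs x) := nbhs_filter x.
apply: (@filterS2 _ _ FF _ _ _ _ h (open_nbhs_nbhs (conj oD Dx))) => y hy Dy.
by apply: hy; exact: slice_mem.
Qed.

Lemma slice_equation J x : sphere1 J -> D x ->
  'D_(e 2) (f \o slice_pt J) x =
  qmul J ('D_(e 0) (f \o slice_pt J) x + qmul qi ('D_(e 1) (f \o slice_pt J) x)).
Proof.
move=> SJ Dx; have [_ /(_ _ (slice_mem SJ Dx))] := f_reg SJ.
rewrite !derive_slice slice_pt_e0 slice_pt_e1 slice_pt_e2 => /eqP.
rewrite addr_eq0 => /eqP->.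
by rewrite qmulNr sphere1K// opprK.
Qed.

(** The matrices are those of the left multiplications by J and J i, which square
to - 1 and anticommute because i and J do. *)
Lemma slice_loc_harmonic J : sphere1 J -> loc_harmonic_on D (f \o slice_pt J).
Proof.
move=> SJ.
apply: (@monogenic_loc_harmonic _ _ (Lmul J) (Lmul (qmul J qi)) D _ _ _ _ oD).
- apply: Lmul_ext => q; rewrite mulmxA !mulmx_Lmul sphere1K//.
  by rewrite mulmxN mulmx1.
- apply: Lmul_ext => q; rewrite mulmxA !mulmx_Lmul mulmxN mulmx1.
  by rewrite -!qmulA [qmul qi (qmul J _)]qmulA -[qmul qi J]opprK -(sphere1_anti SJ)
    qmulNl !qmulNr -qmulA qiK !qmulNr opprK sphere1K.
- apply: Lmul_ext => q; rewrite mulmxDr mulmx0 !mulmxA !mulmx_Lmul.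
  rewrite -!qmulA [qmul qi (qmul J _)]qmulA -[qmul qi J]opprK -(sphere1_anti SJ).
  by rewrite qmulNl -qmulA qmulNr !(sphere1K _ SJ) opprK subrr.
- by move=> x l Dx; exact: slice_C1.
- have E (p q : quaternion R) :
      qmul J (p + qmul qi q) = p *m Lmul J + q *m Lmul (qmul J qi).
    by rewrite !mulmx_Lmul qmulDr qmulA.
  by move=> x Dx; exact: (etrans (slice_equation SJ Dx) (E _ _)).
Qed.

End RegularFunction.
End Slices.

(** * The stem functions *)

Section QuaternionDerivatives.
Context {R : realType}.
Notation e := unit_vec.
Implicit Types (p q : quaternion R) (F G : CxR R -> quaternion R) (x v : CxR R).

Lemma qmul_continuous p : continuous (qmul p).
Proof.
move=> q; have FF : Filter (nbhs q) := nbhs_filter q.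
have c i : (fun y : quaternion R => y 0 i) @ q --> q 0 i by exact: coord_continuous.
have E : qmul p = (fun y : quaternion R => y 0 0 *: qmul p q1 + y 0 1 *: qmul p qi +
    y 0 2 *: qmul p qj + y 0 3 *: qmul p qk).
  by apply/funext => y; apply: quat_ext; rewrite !mxE /=; ring.
have h := cvgD (cvgD (cvgD (cvgZl (a := qmul p q1) (c 0)) (cvgZl (a := qmul p qi) (c 1)))
  (cvgZl (a := qmul p qj) (c 2))) (cvgZl (a := qmul p qk) (c 3)).
by rewrite E; exact: h.
Qed.

Lemma is_derive_qmul p F x v d : is_derive x v F d ->
  is_derive x v (fun y => qmul p (F y)) (qmul p d).
Proof.
move=> [dF <-].
have h : h^-1 *: (((fun y => qmul p (F y)) \o shift x) (h *: v) - qmul p (F x)) @[h --> 0^']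
    --> qmul p ('D_v F x).
  have -> : (fun h => h^-1 *: (((fun y => qmul p (F y)) \o shift x) (h *: v) - qmul p (F x))) =
    qmul p \o (fun h => h^-1 *: ((F \o shift x) (h *: v) - F x)).
    by apply/funext => h /=; rewrite qmulZr qmulDr qmulNr.
  by apply: continuous_cvg; [exact: qmul_continuous|exact: dF].
split; first by apply/cvg_ex; exists (qmul p ('D_v F x)).
exact: cvg_lim h.
Qed.
#[local] Opaque derive derivable.

Variables (D : set (CxR R)).
Hypothesis oD : open D.

Lemma derive_qmul p F x l : loc_harmonic_on D F -> D x ->
  'D_(e l) (fun y => qmul p (F y)) x = qmul p ('D_(e l) F x).
Proof.
move=> HF Dx; have h : is_derive x (e l) F ('D_(e l) F x).
  by split => //; exact: loc_harmonic_on_derivable HF _ _ Dx.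
by have [] := is_derive_qmul p h.
Qed.

Lemma derive_qlin c d F G x l : loc_harmonic_on D F -> loc_harmonic_on D G -> D x ->
  'D_(e l) (fun y => c *: F y + d *: G y) x = c *: 'D_(e l) F x + d *: 'D_(e l) G x.
Proof.
move=> HF HG Dx.
have hF : is_derive x (e l) F ('D_(e l) F x).
  by split => //; exact: loc_harmonic_on_derivable HF _ _ Dx.
have hG : is_derive x (e l) G ('D_(e l) G x).
  by split => //; exact: loc_harmonic_on_derivable HG _ _ Dx.
by have [] := is_deriveD (is_deriveZ c hF) (is_deriveZ d hG).
Qed.

Lemma monogenic_identity K F : connected D -> (exists2 x, D x & x 0 2 = 0) ->
  loc_harmonic_on D F ->
  (forall x, D x -> 'D_(e 2) F x = qmul K ('D_(e 0) F x + qmul qi ('D_(e 1) F x))) ->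
  (forall x, D x -> x 0 2 = 0 -> F x = 0) -> forall x, D x -> F x = 0.
Proof.
move=> cD plane HF system F0 x Dx; apply/rowP => c; rewrite [RHS]mxE.
apply: (@identity_theorem _ _ D (Lmul K) (Lmul (qmul K qi)) oD (fun c y => F y 0 c)) => //.
- split=> [y k Dy|y k Dy]; first exact: HF.
  rewrite -(loc_harmonic_on_coord HF)// system// qmulDr qmulA -!mulmx_Lmul !mxE -big_split /=.
  by apply: eq_bigr => b _; congr (_ * _ + _ * _);
    [exact: (loc_harmonic_on_coord HF 0 b Dy)|exact: (loc_harmonic_on_coord HF 1 b Dy)].
- by move=> y k Dy y2; rewrite F0// mxE.
Qed.

End QuaternionDerivatives.

Section Stem.
Context {R : realType}.
Notation e := unit_vec.
Implicit Types (J K : quaternion R) (x : CxR R).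
Variables (D : set (CxR R)) (f : quaternion R -> quaternion R).
Hypotheses (Dinv : beta_invariant D) (oD : open D) (cD : connected D)
  (plane : exists2 x, D x & x 0 2 = 0) (f_reg : Reg13 (Omega_of D) f).
#[local] Opaque derive derivable.

Let u J := f \o slice_pt J.
Let h : R := 2^-1.

Definition stem0 x : quaternion R := h *: f (slice_pt qj x) + h *: f (slice_pt (- qj) x).
Definition stem1 x : quaternion R :=
  qmul qj ((- h) *: f (slice_pt qj x) + h *: f (slice_pt (- qj) x)).

Let uH J : sphere1 J -> loc_harmonic_on D (u J).
Proof. exact: slice_loc_harmonic. Qed.

Let Sj : sphere1 (qj : quaternion R) := sphere1_qj.
Let SNj : sphere1 (- qj : quaternion R) := sphere1N sphere1_qj.

Lemma stem0_loc_harmonic : loc_harmonic_on D stem0.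
Proof. by apply: loc_harmonic_on_lin; exact: uH. Qed.

Let stem1H' : loc_harmonic_on D (fun x => (- h) *: u qj x + h *: u (- qj) x).
Proof. by apply: loc_harmonic_on_lin; exact: uH. Qed.

Lemma stem1_loc_harmonic : loc_harmonic_on D stem1.
Proof. exact: loc_harmonic_on_qmul stem1H'. Qed.

Let derive_stem0 l x : D x ->
  'D_(e l) stem0 x = h *: 'D_(e l) (u qj) x + h *: 'D_(e l) (u (- qj)) x.
Proof. by move=> Dx; rewrite -(derive_qlin h h l (uH Sj) (uH SNj) Dx). Qed.

Let derive_stem1 l x : D x ->
  'D_(e l) stem1 x =
  qmul qj ((- h) *: 'D_(e l) (u qj) x + h *: 'D_(e l) (u (- qj)) x).
Proof.
move=> Dx; rewrite -(derive_qlin (- h) h l (uH Sj) (uH SNj) Dx).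
by rewrite -(derive_qmul qj l stem1H' Dx).
Qed.

(** The sum and the difference of the equations for j and - j, simplified with
i j = - j i. *)
Lemma stem_equations x : D x ->
  'D_(e 0) stem0 x + qmul qi ('D_(e 1) stem0 x) - 'D_(e 2) stem1 x = 0 /\
  'D_(e 2) stem0 x + ('D_(e 0) stem1 x - qmul qi ('D_(e 1) stem1 x)) = 0.
Proof.
move=> Dx; rewrite !(derive_stem0 _ Dx) !(derive_stem1 _ Dx).
rewrite !(slice_equation f_reg Sj Dx) !(slice_equation f_reg SNj Dx).
move: ('D_(e 0) _ x) ('D_(e 0) _ x) ('D_(e 1) _ x) ('D_(e 1) _ x) => a b c d.
have ij (q : quaternion R) : qmul qi (qmul qj q) = - qmul qj (qmul qi q).
  by rewrite !qmulA (sphere1_anti Sj) qmulNl opprK.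
split.
  rewrite !(qmulNl, qmulDr, qmulNr, qmulZr) !(sphere1K _ Sj).
  move: (qmul qi _) (qmul qi _) => p q.
  by apply/rowP => l; rewrite !mxE; ring.
rewrite !(qmulNl, qmulDr, qmulNr, qmulZr, ij).
move: (qmul qj a) (qmul qj b) (qmul qj (qmul qi _)) (qmul qj (qmul qi _)) => p q r s.
by apply/rowP => l; rewrite !mxE; ring.
Qed.

(** The system of the stem functions says exactly that s + J t solves the equation
of the slice of J, for every J. *)
Let subtract_stem J (a0 a1 a2 s0 s1 s2 t0 t1 t2 : quaternion R) : sphere1 J ->
  a2 = qmul J (a0 + qmul qi a1) ->
  s0 + qmul qi s1 - t2 = 0 -> s2 + (t0 - qmul qi t1) = 0 ->
  1 *: a2 + (- 1) *: (1 *: s2 + 1 *: qmul J t2) =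
  qmul J ((1 *: a0 + (- 1) *: (1 *: s0 + 1 *: qmul J t0)) +
    qmul qi (1 *: a1 + (- 1) *: (1 *: s1 + 1 *: qmul J t1))).
Proof.
move=> SJ -> /eqP; rewrite subr_eq0 => /eqP <- /eqP; rewrite addr_eq0 => /eqP ->.
have iJ (q : quaternion R) : qmul qi (qmul J q) = - qmul J (qmul qi q).
  by rewrite !qmulA (sphere1_anti SJ) qmulNl opprK.
rewrite !scale1r !scaleN1r !(qmulDr, qmulNr) iJ !(qmulDr, qmulNr) !(sphere1K _ SJ) !opprK.
move: (qmul qi t1) (qmul J a0) (qmul J s0) (qmul J (qmul qi _)) (qmul J (qmul qi _)) => p q r s t.
by apply/rowP => l; rewrite !mxE; ring.
Qed.

(** The difference of the two sides solves the equation of the slice of J and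
vanishes for beta = 0, where slice_pt does not depend on J. *)
Lemma stem_equation J x : sphere1 J -> D x ->
  f (slice_pt J x) = stem0 x + qmul J (stem1 x).
Proof.
move=> SJ Dx; pose F y := 1 *: u J y + (- 1) *: (1 *: stem0 y + 1 *: qmul J (stem1 y)).
have HJ1 : loc_harmonic_on D (fun y => qmul J (stem1 y)) := loc_harmonic_on_qmul J stem1_loc_harmonic.
have HJ : loc_harmonic_on D (fun y => 1 *: stem0 y + 1 *: qmul J (stem1 y)).
  exact: (loc_harmonic_on_lin 1 1 stem0_loc_harmonic HJ1).
suff : F x = 0.
  by rewrite /F !scale1r scaleN1r => /eqP; rewrite subr_eq0 => /eqP.
apply: (@monogenic_identity _ D oD J F) => //.
- exact: (loc_harmonic_on_lin 1 (-1) (uH SJ) HJ).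
- move=> y Dy.
  have derF l : 'D_(e l) F y = 1 *: 'D_(e l) (u J) y +
      (- 1) *: (1 *: 'D_(e l) stem0 y + 1 *: qmul J ('D_(e l) stem1 y)).
    apply: (etrans (derive_qlin 1 (-1) l (uH SJ) HJ Dy)); congr (_ + _ *: _).
    apply: (etrans (derive_qlin 1 1 l stem0_loc_harmonic HJ1 Dy)); congr (_ + _ *: _).
    exact: (derive_qmul J l stem1_loc_harmonic Dy).
  have [eq0 eq1] := stem_equations Dy.
  apply: (etrans (derF 2)).
  apply: (etrans (subtract_stem SJ (slice_equation f_reg SJ Dy) eq0 eq1)).
  exact: (congr2 (fun p q => qmul J (p + qmul qi q)) (esym (derF 0)) (esym (derF 1))).
- move=> y Dy y2; rewrite /F /stem0 /stem1 /u /= (slice_pt_real J qj y2).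
  rewrite (slice_pt_real (- qj) qj y2) [- h *: _]scaleNr addNr.
  have q0 (p : quaternion R) : qmul p 0 = 0 by rewrite -[X in qmul _ X](scale0r 0) qmulZr scale0r.
  rewrite !q0 !scale1r scaleN1r addr0 -scalerDl.
  by rewrite (_ : h + h = 1) ?scale1r ?subrr// /h; field.
Qed.

End Stem.

(** * From the stem functions to the regular function *)

Section Domain.
Context {R : realType}.
Implicit Types (D : set (CxR R)) (q : quaternion R) (x : CxR R).

Lemma Omega_preimage D J : beta_invariant D -> sphere1 J ->
  D = slice_pt J @^-1` Omega_of D.
Proof. by move=> Dinv SJ; apply/seteqP; split=> x /(Omega_of_slice_pt x Dinv SJ). Qed.

Lemma stem_domain_open D : beta_invariant D -> open (Omega_of D) -> open D.
Proof.
move=> Dinv oO.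
have /continuousP/(_ _ oO) := @slice_pt_continuous R qj.
by rewrite -(Omega_preimage Dinv sphere1_qj).
Qed.

(** D is the image of the slice of j under a linear map. *)
Lemma stem_domain_connected D : beta_invariant D ->
  connected (slice (Omega_of D) qj) -> connected D.
Proof.
move=> Dinv cO; pose phi (q : quaternion R) : CxR R :=
  q 0 0 *: unit_vec 0 + q 0 1 *: unit_vec 1 + q 0 2 *: unit_vec 2.
have phiK x : phi (slice_pt qj x) = x.
  apply/rowP => l; have [->|->|->] := ord3 l; rewrite !mxE /=; ring.
have -> : D = phi @` slice (Omega_of D) qj.
  apply/seteqP; split=> [x Dx|x [q [Oq [y _ yq]] <-]].
    by exists (slice_pt qj x) => //; split; [exists x => //; exists qj => //; exact: sphere1_qj|exists x].
  by rewrite -yq phiK; apply/(Omega_of_slice_pt y Dinv sphere1_qj); rewrite yq.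
apply: connected_continuous_connected cO _; apply: continuous_subspaceT => q.
have FF : Filter (nbhs q) := nbhs_filter q.
have c i : (fun y : quaternion R => y 0 i) @ q --> q 0 i by exact: coord_continuous.
exact: (cvgD (cvgD (cvgZl (c 0)) (cvgZl (c 1))) (cvgZl (c 2))).
Qed.

Lemma stem_domain_plane D : beta_invariant D ->
  Omega_of D `&` complex_plane !=set0 -> exists2 x, D x & x 0 2 = 0.
Proof.
move=> Dinv [q [Oq [a [b qE]]]]; pose x : CxR R := \row_(l < 3) nth 0 [:: a; b; 0] l.
exists x; last by rewrite mxE.
apply/(Omega_of_slice_pt x Dinv sphere1_qj); move: Oq; rewrite qE.
by rewrite /slice_pt !mxE /= scale0r addr0.
Qed.

Lemma sphere1_of_rho q : rho q != 0 ->
  sphere1 (q 0 2 / rho q *: qj + q 0 3 / rho q *: qk).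
Proof.
move=> r0; exists (q 0 2 / rho q), (q 0 3 / rho q); split=> //.
have s0 : 0 <= q 0 2 ^+ 2 + q 0 3 ^+ 2 by rewrite addr_ge0// sqr_ge0.
rewrite !expr_div_n -mulrDl -[X in X / _]sqr_sqrtr// -/(rho q) divff//.
by rewrite expf_neq0.
Qed.

Lemma polar_slice_pt q : exists2 J, sphere1 J & slice_pt J (cyl q) = q.
Proof.
have [r0|r0] := eqVneq (rho q) 0.
  exists qj; first exact: sphere1_qj.
  have [q2 q3] := rho_eq0 r0.
  by apply: quat_ext; rewrite !mxE /= r0 ?q2 ?q3; ring.
exists (q 0 2 / rho q *: qj + q 0 3 / rho q *: qk); first exact: sphere1_of_rho.
by apply: quat_ext; rewrite !mxE /=; field.
Qed.

(** On the axis the quotients by rho are zero by convention, and F1 vanishes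
because it is odd. *)
Lemma is_stem_polar D f F0 F1 q : beta_invariant D -> is_stem D f F0 F1 ->
  D (cyl q) ->
  f q = F0 (cyl q) + (q 0 2 * (rho q)^-1) *: qmul qj (F1 (cyl q)) +
    (q 0 3 * (rho q)^-1) *: qmul qk (F1 (cyl q)).
Proof.
move=> Dinv [_ oddF1 fE] Dq; have [r0|r0] := eqVneq (rho q) 0.
  have [q2 q3] := rho_eq0 r0.
  have E : slice_pt qj (cyl q) = q.
    by apply: quat_ext; rewrite !mxE /= r0 ?q2 ?q3; ring.
  have cE : conj_beta (cyl q) = cyl q.
    by apply/rowP => l; have [->|->|->] := ord3 l; rewrite !mxE /= ?mxE /= ?r0 ?oppr0.
  have F10 : F1 (cyl q) = 0.
    apply/rowP => c; have := oddF1 _ Dq; rewrite cE => /rowP/(_ c).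
    by rewrite !mxE; lra.
  rewrite -{1}E (fE _ _ Dq sphere1_qj) F10 q2 q3 !mul0r !scale0r !addr0.
  by rewrite -[X in qmul _ X](scale0r (0 : quaternion R)) qmulZr scale0r addr0.
have SJ := sphere1_of_rho r0.
have E : slice_pt (q 0 2 / rho q *: qj + q 0 3 / rho q *: qk) (cyl q) = q.
  by apply: quat_ext; rewrite !mxE /=; field.
by rewrite -{1}E (fE _ _ Dq SJ) qmulDl !qmulZl addrA.
Qed.

End Domain.

Section Consequences.
Context {R : realType}.
Variables (D : set (CxR R)) (f : quaternion R -> quaternion R).
Variables (F0 F1 : CxR R -> quaternion R).
Hypotheses (Dinv : beta_invariant D) (fF : is_stem D f F0 F1).

(** Comparing at J = j and J = - j isolates both functions. *)
Lemma stem_unique G0 G1 : is_stem D f G0 G1 -> forall x, D x -> G0 x = F0 x /\ G1 x = F1 x.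
Proof.
move=> [_ _ fG] x Dx; have [_ _ fE] := fF.
have := fG _ _ Dx sphere1_qj; rewrite fE//; last exact: sphere1_qj.
have := fG _ _ Dx (sphere1N sphere1_qj); rewrite fE//; last exact: sphere1N sphere1_qj.
rewrite !qmulNl => /rowP h1 /rowP h2.
have hj : qmul qj (F1 x) = qmul qj (G1 x).
  by apply/rowP => c; have := h1 c; have := h2 c; rewrite !mxE; lra.
split; first by apply/rowP => c; have := h2 c; rewrite hj !mxE; lra.
by apply: oppr_inj; rewrite -!(sphere1K _ sphere1_qj) hj.
Qed.

(** If f preserves slices then, for J = j and J = k, the values at J and - J show
that F0 and J F1 lie in the span of 1, i, J.  The two spans meet in C, and
J = j alone excludes the i-component of F1. *)
Lemma stem_slice_preserving : slice_preserving (Omega_of D) f <->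
  F0 @` D `<=` complex_plane /\ F1 @` D `<=` jk_space.
Proof.
have [_ _ fE] := fF; split=> [pres|[hF0 hF1] J SJ _ [_ [[x Dx [K SK <-]] [y _ xy]] <-]].
  have inS J x : sphere1 J -> D x -> slice_space J (F0 x + qmul J (F1 x)).
    move=> SJ Dx; rewrite -fE//; apply: (pres J SJ); exists (slice_pt J x) => //.
    by split; [exists x => //; exists J|exists x].
  split=> _ [x Dx <-].
    exists (F0 x 0 0), (F0 x 0 1).
    have [a _ /rowP ha] := inS _ _ sphere1_qj Dx.
    have [b _ /rowP hb] := inS _ _ (sphere1N sphere1_qj) Dx.
    have [c _ /rowP hc] := inS _ _ sphere1_qk Dx.
    have [d _ /rowP hd] := inS _ _ (sphere1N sphere1_qk) Dx.
    have := ha 3; have := hb 3; have := hc 2; have := hd 2; rewrite !mxE /= => h1 h2 h3 h4.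
    by apply: quat_ext; rewrite !mxE /=; move: h1 h2 h3 h4; lra.
  exists (F1 x 0 0), (F1 x 0 2), (F1 x 0 3).
  have [a _ /rowP ha] := inS _ _ sphere1_qj Dx.
  have [b _ /rowP hb] := inS _ _ (sphere1N sphere1_qj) Dx.
  have := ha 3; have := hb 3; rewrite !mxE /= => h1 h2.
  by apply: quat_ext; rewrite !mxE /=; move: h1 h2; lra.
have Dy : D y by apply/(Omega_of_slice_pt y Dinv SJ); rewrite xy; exists x => //; exists K.
rewrite -xy fE//.
have [a [b ->]] := hF0 _ (imageP F0 Dy); have [c [d [g ->]]] := hF1 _ (imageP F1 Dy).
case: SJ => s [t [-> _]].
exists (\row_(l < 3) nth 0 [:: a - (s * d + t * g); b + (s * g - t * d); c] l) => //.
by apply: quat_ext; rewrite !mxE /=; ring.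
Qed.

(** In [is_stem_polar] each component is a sum of three functions of the form
[cyl_term]; on the axis they are treated as power series and elsewhere through
bounds on their derivatives. *)
Lemma stem_real_analytic : open (Omega_of D) -> open D ->
  loc_harmonic_on D F0 -> loc_harmonic_on D F1 -> real_analytic_on (Omega_of D) f.
Proof.
move=> oO oD H0 H1 a Oa; have [even0 odd1 _] := fF.
have Dcyl q : Omega_of D q -> D (cyl q).
  move=> Oq; have [J SJ E] := polar_slice_pt q.
  by apply/(Omega_of_slice_pt _ Dinv SJ); rewrite E.
have Hj := loc_harmonic_on_qmul qj H1; have Hk := loc_harmonic_on_qmul qk H1.
have power_series p q (G : CxR R -> quaternion R) c : (p + q <= 1)%N -> loc_harmonic_on D G ->
    (forall x, D x -> G (conj_beta x) = (-1) ^+ (p + q) *: G x) ->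
    power_series_at (cyl_term (fun x => G x 0 c) (p, q, p + q, [::])%N) a.
  move=> pq HG GC; have Da := Dcyl _ Oa.
  have ra : 0 <= rho a by exact: sqrtr_ge0.
  have [r0|r0] := eqVneq (rho a) 0; last first.
    apply: cauchy_bounds_power_series; apply: cyl_cauchy_bounds; first by rewrite lt_def r0.
    by apply: loc_harmonic_cauchy_bounds; exact: HG.
  have [s s0 sD] := nbhs_cube (open_nbhs_nbhs (conj oD Da)).
  apply: (cyl_power_series pq r0 s0) => [z /sD Dz|]; first by rewrite GC// mxE.
  by apply: cauchy_bounds_power_series; apply: loc_harmonic_cauchy_bounds; exact: HG.
apply: power_series_real_analytic => c.
have [r r0 rO] := nbhs_cube (open_nbhs_nbhs (conj oO Oa)).
have oddj (p : quaternion R) x : D x -> qmul p (F1 (conj_beta x)) = (-1) ^+ 1 *: qmul p (F1 x).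
  by move=> Dx; rewrite odd1// expr1 scaleN1r qmulNr.
have s0 := power_series 0%N 0%N F0 c isT H0 (fun x Dx => etrans (even0 x Dx) (esym (scale1r _))).
have s1 := power_series 1%N 0%N _ c isT Hj (oddj qj).
have s2 := power_series 0%N 1%N _ c isT Hk (oddj qk).
apply: (power_series_eq r0 _ (power_seriesD (power_seriesD s0 s1) s2)) => q /rO Oq.
rewrite (is_stem_polar Dinv fF (Dcyl _ Oq)) /cyl_term /=.
by move: (qmul qj _) (qmul qk _) => u v; rewrite !mxE !expr0 !expr1 !mul1r mulr1.
Qed.

End Consequences.

Theorem theorem4p16 (R : realType) (D : set (CxR R)) :
  beta_invariant D -> slice_domain (Omega_of D) ->
  Reg13 (Omega_of D) = SR13 D /\
  forall f : quaternion R -> quaternion R, Reg13 (Omega_of D) f ->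
    real_analytic_on (Omega_of D) f /\
    exists F0 F1 : CxR R -> quaternion R,
      [/\ analytic_stem D f F0 F1,
          (forall G0 G1 : CxR R -> quaternion R, analytic_stem D f G0 G1 ->
             forall x, D x -> G0 x = F0 x /\ G1 x = F1 x),
          (forall x, D x ->
             d_x0 F0 x + qmul qi (d_x1 F0 x) - d_beta F1 x = 0 /\
             d_beta F0 x + (d_x0 F1 x - qmul qi (d_x1 F1 x)) = 0),
          harmonic_on D F0 /\ harmonic_on D F1 &
          slice_preserving (Omega_of D) f <->
            F0 @` D `<=` complex_plane /\ F1 @` D `<=` jk_space].
Proof.
move=> Dinv [[_ oO _] meets_C slices].
have oD := stem_domain_open Dinv oO.
have cD := stem_domain_connected Dinv (slices _ sphere1_qj).
have plane := stem_domain_plane Dinv meets_C.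
have stem f : Reg13 (Omega_of D) f -> is_stem D f (stem0 f) (stem1 f).
  move=> f_reg; split=> [x Dx|x Dx|x J Dx SJ]; last exact: (stem_equation oD cD plane f_reg).
    by rewrite /stem0 !slice_pt_conj opprK addrC.
  rewrite /stem1 !slice_pt_conj opprK -qmulNr opprD -!scaleNr opprK.
  by rewrite addrC.
split.
  apply/seteqP; split=> [f f_reg|f [_ //]].
  by split=> //; exists (stem0 f), (stem1 f); exact: stem.
move=> f f_reg; have fF := stem f f_reg.
have H0 := stem0_loc_harmonic oD f_reg; have H1 := stem1_loc_harmonic oD f_reg.
split; first exact: stem_real_analytic Dinv fF oO oD H0 H1.
exists (stem0 f), (stem1 f); split.
- by split=> //; exact: loc_harmonic_on_analytic.
- by move=> G0 G1 [_ _ fG]; have := stem_unique fF fG; apply.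
- by move=> x Dx; exact: stem_equations oD f_reg x Dx.
- by split; exact: loc_harmonic_on_harmonic.
- exact: stem_slice_preserving.
Qed.
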